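(* Let $K$ be a field, let $Q$ be a finite tree with arms which is not a linearly oriented quiver $\vec A_n$, and let $Q'$ be the associated tree without arms. Let $R$ and $R'$ be sets of zero relations on $Q$ and $Q'$ respectively, and put $B=KQ/\langle R\rangle$ and $B'=KQ'/\langle R'\rangle$. (a) If $R=R'$, then $\mathrm{dom.dim}\,B=\mathrm{dom.dim}\,B'$. (b) If $R'\subsetneq R$ and $R\cap S'=R'$, where $S'$ is the set of all possible zero relations on $Q'$, then $\mathrm{dom.dim}\,B'=0$ implies $\mathrm{dom.dim}\,B=0$.
   Context: A tree is a finite connected quiver whose underlying graph is a tree (a unique, possibly unoriented, path between any two vertices). $\vec A_n$ is the linearly oriented quiver $1\to\cdots\to n$. A branching vertex is a vertex that is the common source of two distinct arrows or the common target of two distinct arrows. A left arm of $Q$ is a linearly oriented subquiver $\vec A_n$ ($n\ge1$), containing no branching vertex of $Q$, from a source of $Q$ to an immediate predecessor of a branching vertex; a right arm is a linearly oriented subquiver $\vec A_n$ ($n\ge1$), containing no branching vertex, from an immediate successor of a branching vertex to a sink. An arm is trivial if $n=1$. A tree without arms is one with no non-trivial arms; a tree with arms has at least one non-trivial arm. For a tree $Q$ with arms, $Q'$ is the full subquiver obtained by truncating every non-trivial left (right) arm to its single vertex adjacent to the branching vertex. A zero relation is a single path of length at least two (set to zero); zero relations are taken to be minimal. Modules are finite dimensional left modules. For a module $M$ and $k\ge 1$, $\mathrm{dom.dim}\,M\ge k$ means that in a minimal injective resolution $0\to M\to I_1\to I_2\to\cdots$ the modules $I_1,\dots,I_k$ are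 projective (zero counts as projective); $\mathrm{dom.dim}\,M=0$ if $I_1$ is not projective; $\mathrm{dom.dim}\,M=k$ if $\ge k$ but not $\ge k+1$; otherwise $\infty$. $\mathrm{dom.dim}$ of an algebra is that of its left regular module. *)

(* Defs.v *)
From HB Require Import structures.
From mathcomp Require Import all_boot all_order all_algebra.
From mathcomp Require Import finmap boolp classical_sets.
From mathcomp Require Import monalg.

Set Implicit Arguments.
Unset Strict Implicit.
Unset Printing Implicit Defensive.

Import GRing.Theory.

Local Open Scope ring_scope.

(** [ring_quotient] gives the quotient additive group in general, but a ring
    structure only over commutative rings; the noncommutative case is done here.
    Ideals are proper because [algType] requires [1 != 0]. *)

Section TwoSidedIdeal.
Variables (K : fieldType) (A : algType K).

Definition two_sided_ideal (J : set A) : Prop :=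
  [/\ J 0, forall x y, J x -> J y -> J (x - y)
    & forall u x v, J x -> J (u * x * v)].

Record ideal := Ideal {
  ideal_set :> set A;
  ideal_two_sided : two_sided_ideal ideal_set;
  ideal_proper : ~ ideal_set 1
}.

Definition ideal_gen (X : set A) : set A := smallest two_sided_ideal X.

Lemma ideal_gen_two_sided (X : set A) : two_sided_ideal (ideal_gen X).
Proof.
split=> [J [[]] //|x y Jx Jy J [idJ XJ]|u x v Jx J [idJ XJ]].
- by case: (idJ) => _ sub _; apply: sub; [apply: Jx|apply: Jy].
- by case: (idJ) => _ _; apply; apply: Jx.
Qed.

Definition ideal_pred (J : ideal) : {pred A} := fun x => x \in (J : set A).

Lemma ideal_pred_zmod_closed (J : ideal) : zmod_closed (ideal_pred J).
Proof.
case: J => J [J0 JB JM] ?; split; first exact: mem_set.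
by move=> x y /set_mem Jx /set_mem Jy; apply/mem_set/JB.
Qed.

HB.instance Definition _ (J : ideal) :=
  GRing.isZmodClosed.Build A (ideal_pred J) (ideal_pred_zmod_closed J).

Lemma ideal_predM (J : ideal) u x v :
  x \in ideal_pred J -> u * x * v \in ideal_pred J.
Proof. by case: J => J [? ? JM] ? /set_mem Jx; apply/mem_set/JM. Qed.

End TwoSidedIdeal.

Definition quot_alg (K : fieldType) (A : algType K) (J : ideal A) : Type :=
  {ideal_quot (ideal_pred J)}.

Section QuotientAlgebra.
Local Open Scope quotient_scope.
Variables (K : fieldType) (A : algType K) (J : ideal A).

HB.instance Definition _ := GRing.Zmodule.on (quot_alg J).

Definition quot_pi (x : A) : quot_alg J := \pi_({ideal_quot (ideal_pred J)}) x.

Lemma quot_pi_eq x y : (quot_pi x = quot_pi y) <-> (x - y \in ideal_pred J).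
Proof. by rewrite Quotient.idealrBE; split => [/eqP|/eqP]. Qed.

Lemma quot_piK (x : quot_alg J) : quot_pi (repr x) = x.
Proof. exact: reprK. Qed.

Lemma quot_piD x y : quot_pi (x + y) = quot_pi x + quot_pi y.
Proof. exact: (raddfD (\pi_({ideal_quot (ideal_pred J)}))). Qed.

Definition quot_one : quot_alg J := quot_pi 1.
Definition quot_mul (x y : quot_alg J) : quot_alg J :=
  quot_pi (repr x * repr y).
Definition quot_scale (k : K) (x : quot_alg J) : quot_alg J :=
  quot_pi (k *: repr x).

Lemma quot_repr x : repr (quot_pi x) - x \in ideal_pred J.
Proof. by apply/quot_pi_eq; rewrite quot_piK. Qed.

Lemma quot_piM x y : quot_pi (x * y) = quot_mul (quot_pi x) (quot_pi y).
Proof.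
apply/esym/quot_pi_eq; set x' := repr _; set y' := repr _.
rewrite -[x' * y'](addrNK (x * y')) -addrA -mulrBl -mulrBr rpredD //.
  by rewrite -[_ * y']mul1r mulrA ideal_predM ?quot_repr.
by rewrite -[_ * _]mulr1 ideal_predM ?quot_repr.
Qed.

Lemma quot_piZ k x : quot_pi (k *: x) = quot_scale k (quot_pi x).
Proof.
apply/esym/quot_pi_eq; rewrite -scalerBr.
by rewrite -[_ - x]mul1r scalerAl -[_ * _]mulr1 ideal_predM ?quot_repr.
Qed.

Lemma quot_mulA : associative quot_mul.
Proof.
move=> x y z; rewrite -[x]quot_piK -[y]quot_piK -[z]quot_piK.
by rewrite -!quot_piM mulrA.
Qed.

Lemma quot_mul1 : left_id quot_one quot_mul.
Proof. by move=> x; rewrite -[x]quot_piK -quot_piM mul1r. Qed.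

Lemma quot_mulr1 : right_id quot_one quot_mul.
Proof. by move=> x; rewrite -[x]quot_piK -quot_piM mulr1. Qed.

Lemma quot_mulDl : left_distributive quot_mul +%R.
Proof.
move=> x y z; rewrite -[x]quot_piK -[y]quot_piK -[z]quot_piK.
by rewrite -quot_piD -!quot_piM mulrDl quot_piD.
Qed.

Lemma quot_mulDr : right_distributive quot_mul +%R.
Proof.
move=> x y z; rewrite -[x]quot_piK -[y]quot_piK -[z]quot_piK.
by rewrite -quot_piD -!quot_piM mulrDr quot_piD.
Qed.

Lemma quot_one_neq0 : quot_one != 0.
Proof.
apply/eqP => e; apply: (ideal_proper (i := J)).
have {}e : quot_pi 1 = quot_pi 0.
  rewrite -[LHS]/quot_one e; apply/esym.
  exact: (raddf0 (\pi_({ideal_quot (ideal_pred J)}))).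
by move/quot_pi_eq: e; rewrite subr0 => /set_mem.
Qed.

HB.instance Definition _ := GRing.Zmodule_isNzRing.Build (quot_alg J)
  quot_mulA quot_mul1 quot_mulr1 quot_mulDl quot_mulDr quot_one_neq0.

Lemma quot_scaleA k l x : quot_scale k (quot_scale l x) = quot_scale (k * l) x.
Proof. by rewrite -[x]quot_piK -!quot_piZ scalerA. Qed.

Lemma quot_scale1 : left_id 1 quot_scale.
Proof. by move=> x; rewrite -[x]quot_piK -quot_piZ scale1r. Qed.

Lemma quot_scaleDr : right_distributive quot_scale +%R.
Proof.
move=> k x y; rewrite -[x]quot_piK -[y]quot_piK.
by rewrite -quot_piD -!quot_piZ scalerDr quot_piD.
Qed.

Lemma quot_scaleDl x : {morph quot_scale^~ x : k l / k + l}.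
Proof.
by move=> k l; rewrite -[x]quot_piK -!quot_piZ -quot_piD scalerDl.
Qed.

HB.instance Definition _ := GRing.Zmodule_isLmodule.Build K (quot_alg J)
  quot_scaleA quot_scale1 quot_scaleDr quot_scaleDl.

Lemma quot_scaleAl (k : K) (x y : quot_alg J) : k *: (x * y) = (k *: x) * y.
Proof.
rewrite -[x]quot_piK -[y]quot_piK.
by rewrite /GRing.scale/= /GRing.mul/= -quot_piM -!quot_piZ scalerAl quot_piM.
Qed.

Lemma quot_scaleAr (k : K) (x y : quot_alg J) : k *: (x * y) = x * (k *: y).
Proof.
rewrite -[x]quot_piK -[y]quot_piK.
by rewrite /GRing.scale/= /GRing.mul/= -quot_piM -!quot_piZ scalerAr quot_piM.
Qed.

HB.instance Definition _ :=
  GRing.Lmodule_isLalgebra.Build K (quot_alg J) quot_scaleAl.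
HB.instance Definition _ :=
  GRing.Lalgebra_isAlgebra.Build K (quot_alg J) quot_scaleAr.

End QuotientAlgebra.

Section DominantDimension.
Variables (K : fieldType) (A : algType K).
Implicit Types M N X Y : lmodType A.

(** [K] acts on an [A]-module through [c |-> c%:A = c *: 1]. *)
Definition finite_dim M : Prop :=
  exists s : seq M, forall m : M, exists c : nat -> K,
    m = \sum_(i < size s) (c i)%:A *: s`_i.

Definition injective_module M : Prop :=
  forall (X Y : lmodType A) (f : {linear X -> Y}) (g : {linear X -> M}),
    finite_dim X -> finite_dim Y -> injective f ->
    exists h : {linear Y -> M}, forall x, h (f x) = g x.

Definition projective_module M : Prop :=
  forall (X Y : lmodType A) (f : {linear X -> Y}) (g : {linear M -> Y}),
    finite_dim X -> finite_dim Y -> (forall y, exists x, f x = y) ->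
    exists h : {linear M -> X}, forall m, f (h m) = g m.

Definition essential_image M N (f : {linear M -> N}) : Prop :=
  forall S : {pred N}, GRing.submod_closed S ->
    (exists2 x, x \in S & x != 0) ->
    exists2 m, f m \in S & f m != 0.

(** The term [I_(i+1)] of [0 -> M -> I_1 -> I_2 -> ...] is [mir_term i].
    Minimality: each [I_(i+1)] is the injective envelope of the image of the
    map into it. *)
Record min_injective_resolution M := MinInjectiveResolution {
  mir_term : nat -> lmodType A;
  mir_aug : {linear M -> mir_term 0};
  mir_diff : forall i, {linear mir_term i -> mir_term i.+1};
  mir_finite_dim : forall i, finite_dim (mir_term i);
  mir_injective : forall i, injective_module (mir_term i);
  mir_exact_aug : injective mir_aug;
  mir_exact0 : forall x, mir_diff 0 x = 0 <-> exists m, mir_aug m = x;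
  mir_exact : forall i x,
    mir_diff i.+1 x = 0 <-> exists y, mir_diff i y = x;
  mir_minimal_aug : essential_image mir_aug;
  mir_minimal : forall i, essential_image (mir_diff i)
}.

Definition dom_dim_ge M (k : nat) : Prop :=
  exists I : min_injective_resolution M,
    forall i, (i < k)%N -> projective_module (mir_term I i).

Definition has_dom_dim M (k : nat) : Prop :=
  ((0 < k)%N -> dom_dim_ge M k) /\ ~ dom_dim_ge M k.+1.

(** [None] stands for infinity. *)
Definition dom_dim M : option nat :=
  if pselect (exists k, has_dom_dim M k) is left h then Some (sval (cid h))
  else None.

Definition alg_dom_dim : option nat := dom_dim (A^o : lmodType A).

End DominantDimension.

Arguments alg_dom_dim {K} A.

Record quiver := Quiver {
  vertex : finType;
  arrow : finType;
  source : arrow -> vertex;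
  target : arrow -> vertex;
  vertex_nonempty : (0 < #|vertex|)%N
}.

Section Paths.
Variable Q : quiver.

Fixpoint is_path (x : vertex Q) (s : seq (arrow Q)) : bool :=
  if s is a :: s' then (source a == x) && is_path (target a) s' else true.

(** A path is its starting vertex together with its arrows, listed in the order
    in which they are traversed. *)
Definition is_qpath (p : vertex Q * seq (arrow Q)) : bool := is_path p.1 p.2.
Definition qpath : Type := {p | is_qpath p}.

HB.instance Definition _ := Choice.on qpath.

Definition parrows (p : qpath) : seq (arrow Q) := (val p).2.
Definition psource (p : qpath) : vertex Q := (val p).1.
Definition ptarget (p : qpath) : vertex Q :=
  last (psource p) (map (@target Q) (parrows p)).
Definition pverts (p : qpath) : seq (vertex Q) :=
  psource p :: map (@target Q) (parrows p).
Definition plength (p : qpath) : nat := size (parrows p).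

Definition trivial_path (x : vertex Q) : qpath :=
  exist is_qpath (x, [::]) isT.

(** [pcomp p q] traverses [q] first and then [p], so that left modules over the
    path algebra are the covariant representations of the quiver. *)
Definition pcomp (p q : qpath) : option qpath :=
  if ptarget q == psource p
  then (insub (psource q, parrows q ++ parrows p) : option {p | is_qpath p})
  else None.

Lemma is_path_cat x s t :
  is_path x (s ++ t) =
  is_path x s && is_path (last x (map (@target Q) s)) t.
Proof. by elim: s x => //= a s IH x; rewrite IH andbA. Qed.

Variant pcomp_spec (p q : qpath) : option qpath -> Prop :=
| PcompSome r of ptarget q = psource p & psource r = psource q
    & parrows r = parrows q ++ parrows p & ptarget r = ptarget p :
    pcomp_spec p q (Some r)
| PcompNone of ptarget q <> psource p : pcomp_spec p q None.

Lemma pcompP p q : pcomp_spec p q (pcomp p q).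
Proof.
rewrite /pcomp; case: eqP => [e|]; last by constructor.
case: insubP => [r _ er|]; last first.
  move: (valP p) (valP q); rewrite /is_qpath -!/(psource _) -!/(parrows _) /=.
  by move=> hp hq; rewrite is_path_cat hq -/(ptarget q) e hp.
have er1 : psource r = psource q by rewrite /psource er.
have er2 : parrows r = parrows q ++ parrows p by rewrite /parrows er.
constructor => //.
by rewrite /ptarget er1 er2 map_cat last_cat -/(ptarget q) e.
Qed.

Lemma qpath_inj (p q : qpath) :
  psource p = psource q -> parrows p = parrows q -> p = q.
Proof.
move=> e1 e2; apply: val_inj.
by rewrite [val p]surjective_pairing [val q]surjective_pairing; congr (_, _).
Qed.

Lemma pcompA p q r :
  obind (pcomp p) (pcomp q r) = obind (pcomp^~ r) (pcomp p q).
Proof.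
case: (pcompP q r) => [u e1 e2 e3 e4|n1];
  case: (pcompP p q) => [v f1 f2 f3 f4|n2] //=.
- case: (pcompP p u) => [w g1 g2 g3 g4|]; last by rewrite e4 f1.
  case: (pcompP v r) => [w' h1 h2 h3 h4|]; last by rewrite e1 f2.
  congr Some; apply: qpath_inj; first by rewrite g2 h2 e2.
  by rewrite g3 h3 e3 f3 catA.
- by case: (pcompP p u) => // w g1; rewrite e4 in g1.
- by case: (pcompP v r) => // w g1; rewrite f2 in g1.
Qed.

End Paths.

Section LinearExtension.
Variables (K : fieldType) (P : choiceType) (V : lmodType K) (F : P -> V).
Local Open Scope fset_scope.

Definition lin_ext (f : {malg K[P]}) : V := \sum_(p <- msupp f) f@_p *: F p.

Lemma lin_extw (d : {fset P}) f : msupp f `<=` d ->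
  lin_ext f = \sum_(p <- d) f@_p *: F p.
Proof.
move=> sd; apply: big_fset_incl => // p _ /mcoeff_outdom ->.
by rewrite scale0r.
Qed.

Lemma lin_ext_linear : linear lin_ext.
Proof.
move=> k f g; pose d := msupp f `|` msupp g.
have sf : msupp f `<=` d by apply: fsubsetUl.
have sg : msupp g `<=` d by apply: fsubsetUr.
have sfg : msupp (k *: f + g) `<=` d.
  apply: (fsubset_trans (msuppD_le _ _)).
  by rewrite fsetSU // msuppZ_le.
rewrite (lin_extw sf) (lin_extw sg) (lin_extw sfg) scaler_sumr -big_split /=.
by apply: eq_bigr => p _; rewrite mcoeffD mcoeffZ scalerDl scalerA.
Qed.

HB.instance Definition _ :=
  GRing.isLinear.Build K {malg K[P]} V _ lin_ext lin_ext_linear.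

Lemma lin_extU p : lin_ext << p >> = F p.
Proof.
by rewrite (lin_extw msuppU_le) big_seq_fset1 mcoeffUU scale1r.
Qed.

End LinearExtension.

Lemma malg_linE (K : fieldType) (P : choiceType) (f : {malg K[P]}) :
  f = \sum_(p <- msupp f) f@_p *: << p >>.
Proof.
rewrite {1}[f]monalgE; apply: eq_bigr => p _; apply/malgP => q.
by rewrite mcoeffZ !mcoeffU mulrnAr mulr1.
Qed.

Definition path_alg (K : fieldType) (Q : quiver) : Type := {malg K[qpath Q]}.
HB.instance Definition _ K Q := GRing.Lmodule.on (path_alg K Q).

(* Locked: unfolding them makes unification compute with finite maps. *)
HB.lock Definition path_elt (K : fieldType) (Q : quiver)
    (p : qpath Q) : path_alg K Q := << p >>.

Definition path_prod (K : fieldType) (Q : quiver)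
    (p q : qpath Q) : path_alg K Q :=
  if pcomp p q is Some r then path_elt K r else 0.

Definition path_one (K : fieldType) (Q : quiver) : path_alg K Q :=
  \sum_(x : vertex Q) path_elt K (trivial_path x).

HB.lock Definition path_mul (K : fieldType) (Q : quiver)
    (f g : path_alg K Q) : path_alg K Q :=
  \sum_(p <- msupp f) \sum_(q <- msupp g) (f@_p * g@_q) *: path_prod K p q.

Section PathAlgebra.
Variables (K : fieldType) (Q : quiver).
Local Notation path_alg := (path_alg K Q).
Local Notation path_one := (path_one K Q).
Local Notation path_elt := (@path_elt K Q).
Local Notation path_prod := (@path_prod K Q).
Local Notation path_mul := (@path_mul K Q).
Implicit Types (f g h : path_alg) (p q r : qpath Q).

Lemma path_mulEl f g :
  path_mul f g = lin_ext (fun p => lin_ext (path_prod p) g) f.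
Proof.
rewrite path_mul.unlock; apply: eq_bigr => p _; rewrite scaler_sumr.
by apply: eq_bigr => q _; rewrite scalerA.
Qed.

Lemma path_mulEr f g :
  path_mul f g = lin_ext (fun q => lin_ext (path_prod^~ q) f) g.
Proof.
rewrite path_mul.unlock exchange_big /=.
apply: eq_bigr => p _; rewrite scaler_sumr.
by apply: eq_bigr => q _; rewrite scalerA mulrC.
Qed.

Lemma path_mulPl k f f' g :
  path_mul (k *: f + f') g = k *: path_mul f g + path_mul f' g.
Proof. by rewrite !path_mulEl linearP. Qed.

Lemma path_mulPr k f g g' :
  path_mul f (k *: g + g') = k *: path_mul f g + path_mul f g'.
Proof. by rewrite !path_mulEr linearP. Qed.

Lemma path_mulUU p q : path_mul (path_elt p) (path_elt q) = path_prod p q.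
Proof. by rewrite path_mulEl path_elt.unlock !lin_extU. Qed.

Lemma path_mul0f f : path_mul 0 f = 0.
Proof. by rewrite path_mulEl linear0. Qed.

Lemma path_mulf0 f : path_mul f 0 = 0.
Proof. by rewrite path_mulEr linear0. Qed.

Lemma path_alg_ind (P : path_alg -> Prop) :
  P 0 -> (forall p, P (path_elt p)) ->
  (forall k f g, P f -> P g -> P (k *: f + g)) -> forall f, P f.
Proof.
move=> P0 PU PD f; rewrite [f]malg_linE.
rewrite path_elt.unlock in PU.
by apply: (@big_rec path_alg P) => [|p g _ Pg]; [exact: P0|exact: (PD _ _ _ (PU p) Pg)].
Qed.

Lemma path_mulDl : left_distributive path_mul +%R.
Proof. by move=> f g h; rewrite -[f]scale1r path_mulPl !scale1r. Qed.

Lemma path_mulDr : right_distributive path_mul +%R.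
Proof. by move=> f g h; rewrite -[g]scale1r path_mulPr !scale1r. Qed.

Lemma path_scaleAl k f g : k *: path_mul f g = path_mul (k *: f) g.
Proof. by rewrite -[k *: f]addr0 path_mulPl path_mul0f addr0. Qed.

Lemma path_scaleAr k f g : k *: path_mul f g = path_mul f (k *: g).
Proof. by rewrite -[k *: g]addr0 path_mulPr path_mulf0 addr0. Qed.

Lemma path_mulA : associative path_mul.
Proof.
move=> f g h; elim/path_alg_ind: f => [|p|k f f' IH IH'].
- by rewrite !path_mul0f.
- elim/path_alg_ind: g => [|q|k g g' IH IH'].
  + by rewrite path_mul0f path_mulf0 path_mul0f.
  + elim/path_alg_ind: h => [|r|k h h' IH IH'].
    * by rewrite !path_mulf0.
    * rewrite !path_mulUU; have := pcompA p q r; rewrite /Defs.path_prod.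
      case: (pcomp q r) => [u|]; case: (pcomp p q) => [v|] /=;
        rewrite ?path_mulUU ?path_mul0f ?path_mulf0 // /Defs.path_prod.
      - by move=> ->.
      - by move=> ->.
      - by move=> <-.
    * by rewrite !path_mulPr IH IH'.
  + by rewrite !(path_mulPl, path_mulPr) IH IH'.
- by rewrite !path_mulPl IH IH'.
Qed.

Lemma path_mul_sumr f (I : finType) (F : I -> path_alg) :
  path_mul f (\sum_i F i) = \sum_i path_mul f (F i).
Proof.
by rewrite path_mulEr linear_sum; apply: eq_bigr => i _; rewrite path_mulEr.
Qed.

Lemma path_mul_suml f (I : finType) (F : I -> path_alg) :
  path_mul (\sum_i F i) f = \sum_i path_mul (F i) f.
Proof.
by rewrite path_mulEl linear_sum; apply: eq_bigr => i _; rewrite path_mulEl.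
Qed.

Lemma path_mul1 : left_id path_one path_mul.
Proof.
move=> f; elim/path_alg_ind: f => [|p|k f f' IH IH'].
- by rewrite path_mulf0.
- rewrite path_mul_suml (bigD1 (ptarget p)) //= big1 => [|x nx];
    rewrite path_mulUU /Defs.path_prod; case: pcompP => [r|] //.
  + by move=> _ e1 e2 _; rewrite addr0; congr path_elt; apply: qpath_inj;
      rewrite // e2 cats0.
  + by move=> e; rewrite e eqxx in nx.
- by rewrite path_mulPr IH IH'.
Qed.

Lemma path_mulr1 : right_id path_one path_mul.
Proof.
move=> f; elim/path_alg_ind: f => [|p|k f f' IH IH'].
- by rewrite path_mul0f.
- rewrite path_mul_sumr (bigD1 (psource p)) //= big1 => [|x nx];
    rewrite path_mulUU /Defs.path_prod; case: pcompP => [r|] //.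
  + by move=> _ e1 e2 _; rewrite addr0; congr path_elt; apply: qpath_inj.
  + by move=> e; rewrite -e eqxx in nx.
- by rewrite path_mulPl IH IH'.
Qed.

Lemma path_coefP k f g p : (k *: f + g)@_p = k * f@_p + g@_p.
Proof. by rewrite mcoeffD mcoeffZ. Qed.

Lemma path_eltE p q : (path_elt p)@_q = (p == q)%:R.
Proof. by rewrite path_elt.unlock mcoeffU. Qed.

Lemma path_one_trivial x : path_one@_(trivial_path x) = 1.
Proof.
rewrite raddf_sum (bigD1 x) //= big1 => [|y nyx]; rewrite path_eltE ?addr0.
  by rewrite eqxx.
case: eqP => // /(congr1 (@psource Q)) e.
by rewrite -[y]/(psource (trivial_path y)) e eqxx in nyx.
Qed.

Lemma path_one_neq0 : path_one != 0.
Proof.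
have /card_gt0P [x _] := vertex_nonempty Q.
apply/eqP => /(congr1 (mcoeff (trivial_path x))) /eqP.
by rewrite path_one_trivial mcoeff0 oner_eq0.
Qed.

HB.instance Definition _ := GRing.Zmodule_isNzRing.Build path_alg
  path_mulA path_mul1 path_mulr1 path_mulDl path_mulDr path_one_neq0.
HB.instance Definition _ :=
  GRing.Lmodule_isLalgebra.Build K path_alg path_scaleAl.
HB.instance Definition _ :=
  GRing.Lalgebra_isAlgebra.Build K path_alg path_scaleAr.

(** The elements of [KQ] without constant terms form an ideal. *)
Definition no_trivial_path : set path_alg :=
  [set f | forall x, (f : {malg K[qpath Q]})@_(trivial_path x) = 0].

Lemma path_prod_trivial p q x :
  (path_prod p q)@_(trivial_path x) != 0 ->
  p = trivial_path x /\ q = trivial_path x.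
Proof.
rewrite /Defs.path_prod; case: pcompP => [r e1 e2 e3 e4|_]; last first.
  by rewrite mcoeff0 eqxx.
rewrite path_eltE; have [er _|_] := eqVneq r (trivial_path x); last first.
  by rewrite /= eqxx.
move: e3; rewrite er /=; case eq: (parrows q) => //; case ep: (parrows p) => //.
have sq : psource q = x by rewrite -e2 er.
have sp : psource p = x by rewrite -e1 /ptarget eq.
by move=> _; split; apply: qpath_inj.
Qed.

Lemma path_mul_trivial f g x :
  (path_mul f g)@_(trivial_path x) =
  f@_(trivial_path x) * g@_(trivial_path x).
Proof.
elim/path_alg_ind: f => [|p|k f f' IH IH'].
- by rewrite path_mul0f !mcoeff0 mul0r.
- elim/path_alg_ind: g => [|q|k g g' IH IH'].
  + by rewrite path_mulf0 !mcoeff0 mulr0.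
  + rewrite path_mulUU !path_eltE.
    have [e|/path_prod_trivial [-> ->]] :=
        eqVneq (path_prod p q)@_(trivial_path x) 0.
      rewrite e; case: eqP => [ep|_]; last by rewrite mul0r.
      case: eqP => [eq|_]; last by rewrite mulr0.
      move: e; rewrite ep eq /Defs.path_prod; case: pcompP => // r _ e1 e2 _.
      by rewrite path_eltE (_ : r = trivial_path x) ?eqxx ?mulr1 //;
        apply: qpath_inj.
    rewrite /Defs.path_prod; case: pcompP => // r _ e1 e2 _.
    by rewrite path_eltE (_ : r = trivial_path x) ?eqxx ?mulr1 //;
      apply: qpath_inj.
  + by rewrite path_mulPr path_coefP IH IH' path_coefP mulrDr mulrCA.
- by rewrite path_mulPl path_coefP IH IH' path_coefP mulrDl mulrA.
Qed.

Lemma no_trivial_path_ideal : two_sided_ideal no_trivial_path.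
Proof.
split=> [x|f g f0 g0 x|u f v f0 x]; first exact: mcoeff0.
  by rewrite mcoeffB f0 g0 subr0.
by rewrite /GRing.mul /= !path_mul_trivial f0 mulr0 mul0r.
Qed.

End PathAlgebra.

Section BoundQuiverAlgebra.
Variables (K : fieldType) (Q : quiver).

Definition zero_relation (p : qpath Q) : Prop := (2 <= plength p)%N.

(** A set of zero relations, none of which is a proper subpath of another. *)
Record zero_relations := ZeroRelations {
  relset :> set (qpath Q);
  relset_zero : forall p, relset p -> zero_relation p;
  relset_minimal : forall p q, relset p -> relset q ->
    infix (parrows p) (parrows q) -> p = q
}.

Definition relation_ideal (R : zero_relations) : set (path_alg K Q) :=
  ideal_gen (@path_elt K Q @` R).

Lemma relation_ideal_proper (R : zero_relations) : ~ relation_ideal R 1.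
Proof.
have /card_gt0P [x _] := vertex_nonempty Q.
move=> /(_ (@no_trivial_path K Q)) /= J1.
have /eqP : (path_one K Q)@_(trivial_path x) = 0.
  apply: J1; split; first exact: no_trivial_path_ideal.
  move=> _ [p /relset_zero p2 <-] y; rewrite path_eltE.
  by case: eqP => // e; move: p2; rewrite e.
by rewrite path_one_trivial oner_eq0.
Qed.

Definition bound_quiver_alg (R : zero_relations) : Type :=
  quot_alg (Ideal (ideal_gen_two_sided (@path_elt K Q @` R))
                  (relation_ideal_proper (R := R))).
HB.instance Definition _ R := GRing.Algebra.on (bound_quiver_alg R).

End BoundQuiverAlgebra.

Section Trees.
Variable Q : quiver.

(** An arrow together with a direction of traversal ([true]: from source to
    target). *)
Definition estart (e : arrow Q * bool) : vertex Q :=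
  if e.2 then source e.1 else target e.1.
Definition eend (e : arrow Q * bool) : vertex Q :=
  if e.2 then target e.1 else source e.1.

Fixpoint is_walk (x y : vertex Q) (w : seq (arrow Q * bool)) : bool :=
  if w is e :: w' then (estart e == x) && is_walk (eend e) y w' else x == y.

(** Unoriented paths use each arrow at most once. Repetitions are forbidden for
    arrows rather than vertices, so that uniqueness (with [x = y]) also rules
    out loops. *)
Definition unoriented_path (x y : vertex Q) (w : seq (arrow Q * bool)) : Prop :=
  is_walk x y w /\ uniq (map fst w).

Definition is_tree : Prop :=
  forall x y : vertex Q, exists! w, unoriented_path x y w.

Definition branching (v : vertex Q) : bool :=
  [exists a, exists b, (a != b) &&
    (((source a == v) && (source b == v)) ||
     ((target a == v) && (target b == v)))].

Definition is_source (v : vertex Q) : bool := [forall a, target a != v].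
Definition is_sink (v : vertex Q) : bool := [forall a, source a != v].

(** An arm [1 -> ... -> n] is given by the path of length [n - 1] along it; it
    is trivial when this path has length zero. *)
Definition left_arm (p : qpath Q) : bool :=
  [&& all (predC branching) (pverts p), is_source (psource p) &
    [exists a, (source a == ptarget p) && branching (target a)]].

Definition right_arm (p : qpath Q) : bool :=
  [&& all (predC branching) (pverts p), is_sink (ptarget p) &
    [exists a, (target a == psource p) && branching (source a)]].

Definition has_arms : Prop :=
  exists p, (left_arm p \/ right_arm p) /\ (0 < plength p)%N.

Definition truncated (v : vertex Q) : Prop :=
  exists2 p, (0 < plength p)%N & v \in pverts p /\
    ((left_arm p /\ v <> ptarget p) \/ (right_arm p /\ v <> psource p)).

Definition kept : {set vertex Q} := [set v | ~~ `[< truncated v >]].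

Lemma branching_kept v : branching v -> v \in kept.
Proof.
move=> bv; rewrite inE; apply/asboolPn => -[p _ [vp arm]].
have /allP/(_ v vp) /= : all (predC branching) (pverts p).
  by case: arm => -[/and3P []].
by rewrite bv.
Qed.

Lemma kept_nonempty : exists v, v \in kept.
Proof.
have /card_gt0P [x _] := vertex_nonempty Q.
have [/existsP [v bv]|/existsPn nb] := boolP [exists v, branching v].
  by exists v; apply: branching_kept.
exists x; rewrite inE; apply/asboolPn => -[p _ [_ arm]].
by case: arm => -[/and3P [_ _ /existsP [a /andP[_]]]]; rewrite (negPf (nb _)).
Qed.

End Trees.

Section FullSubquiver.
Variables (Q : quiver) (S : {set vertex Q}).
Hypothesis S_nonempty : exists v, v \in S.

Definition sub_vertex : finType := {v : vertex Q | v \in S}.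
Definition sub_arrow : finType :=
  {a : arrow Q | (source a \in S) && (target a \in S)}.

Definition sub_source (a : sub_arrow) : sub_vertex :=
  exist _ (source (val a)) (proj1 (andP (valP a))).
Definition sub_target (a : sub_arrow) : sub_vertex :=
  exist _ (target (val a)) (proj2 (andP (valP a))).

Lemma sub_vertex_nonempty : (0 < #|sub_vertex|)%N.
Proof.
by case: S_nonempty => v vS; apply/card_gt0P; exists (exist _ v vS).
Qed.

Definition full_subquiver : quiver :=
  Quiver sub_source sub_target sub_vertex_nonempty.

Lemma sub_path_is_qpath (p : qpath full_subquiver) :
  is_qpath (val (psource p), map val (parrows p)).
Proof.
case: p => -[x s]; rewrite /is_qpath /parrows /psource /=.
by elim: s x => //= a s IH x /andP [/eqP <- /IH ->]; rewrite eqxx.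
Qed.

Definition sub_path (p : qpath full_subquiver) : qpath Q :=
  exist (@is_qpath Q) _ (sub_path_is_qpath p).

End FullSubquiver.

Definition truncation (Q : quiver) : quiver :=
  full_subquiver (kept_nonempty Q).

Definition truncation_path (Q : quiver) (p : qpath (truncation Q)) : qpath Q :=
  sub_path p.

(** The linearly oriented quiver with [n + 1] vertices. *)
Definition linear_quiver (n : nat) : quiver :=
  @Quiver 'I_n.+1 'I_n (widen_ord (leqnSn n)) (lift ord0)
    (eq_ind_r (fun m => 0 < m)%N (ltn0Sn n) (card_ord n.+1)).

Definition quiver_iso (Q1 Q2 : quiver) : Prop :=
  exists (f : vertex Q1 -> vertex Q2) (g : arrow Q1 -> arrow Q2),
    [/\ bijective f, bijective g, forall a, source (g a) = f (source a)
      & forall a, target (g a) = f (target a)].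

Definition linearly_oriented (Q : quiver) : Prop :=
  exists n, quiver_iso Q (linear_quiver n).

(* Main.v *)
Require Import Defs.
From HB Require Import structures.
From mathcomp Require Import all_boot all_order all_algebra.
From mathcomp Require Import zify.
From mathcomp Require Import finmap boolp classical_sets monalg.

Set Implicit Arguments.
Unset Strict Implicit.
Unset Printing Implicit Defensive.

Import GRing.Theory VectorInternalTheory.
Local Open Scope ring_scope.


(** A bound quiver algebra [B] of a tree with a branching vertex has dominant
    dimension 0 or 1, and which of the two is decided by a combinatorial
    condition on the nonzero paths that truncating arms preserves.

    Write [D(B)] for the dual of the right regular module and [delta_p] in
    [D(B)] for the coefficient at a nonzero path [p]; a path [s] maps [delta_p]
    to [delta_t] if [p] is [s] followed by [t], and to 0 if [p] does not start
    with [s]. A _fork_ consists of two nonzero paths ending with a common part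
    [t], which they enter by different arrows [a] and [a'], such that some
    nonzero path with the same end cannot be prolonged there; a cofork is a
    fork of the opposite quiver.

    If the injective hull [E] of [B] is projective, then it embeds into a power
    of [B]. A path [p] that cannot be prolonged spans a simple submodule of
    [B], hence of [E], and the injectivity of [E] extends the inclusion of this
    simple module to [D(B) -> E]; composing with a map [E -> B] gives
    [H : D(B) -> B] that is nonzero on the socle element at the end of [p].
    A fork at that end would give a nonzero element of [B] that lies both in
    [a B] and in [a' B] ([socle_map_no_fork]), and a cofork is excluded by the
    coefficients of [H delta_p] ([socle_map_prefix]). Conversely, without forks
    and coforks the paths out of the source, and those into the target, of a
    bimaximal path are all parts of it. The sum [lambda] of the functionals
    dual to bimaximal paths then identifies the left ideal generated by the
    idempotent of their sources with a direct summand of [D(B)], which is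
    injective, and [B] embeds into a power of this left ideal: so the
    first term of the minimal injective resolution is projective
    ([no_fork_dom_dim_ge1]).

    The second term never is ([not_dom_dim_ge2]). A branching vertex yields two
    arrows with a common source [v]. The first term [E] has an element [x] at
    [v] on which one of them acts as on [B] and the other by zero; such an [x]
    cannot come from [B], and its image in the second term is a socle element
    at [v]. If the second term were projective, this would again exclude two
    nonzero paths joining by different arrows on their way to [v], but the
    bimaximal paths through the two arrows provide such a pair.

    Finally, forks correspond to each other under truncation. A fork of the
    truncated tree remains one, except that its end may now be the first vertex
    of an arm, where the two branches are prolonged along the arm as far as
    possible ([fork_of_truncation]); a fork of the whole tree is cut down to
    the kept arrows if no relation meets the truncated ones
    ([fork_to_truncation]). *)

(** * Linear algebra of finite-dimensional modules *)

Section FiniteDimensional.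
Variables (K : fieldType) (A : algType K).
Implicit Types M N X Y C E : lmodType A.

Definition mk_linear M N (f : M -> N) (h : linear f) : {linear M -> N} :=
  HB.pack f (GRing.isLinear.Build A M N *:%R f h).

(** A module over [A] carries no separate structure of vector space: scalars act
    through their images in [A]. *)
Definition klinear M (V : lmodType K) (f : M -> V) : Prop :=
  forall c x y, f (c%:A *: x + y) = c *: f x + f y.

Lemma kscaleN1 M (x : M) : (-1 : K)%:A *: x = - x.
Proof. by rewrite scaleN1r scaleN1r. Qed.

Lemma kscale1 M (x : M) : (1 : K)%:A *: x = x.
Proof. by rewrite !scale1r. Qed.

Lemma kscaleD M (k l : K) (x : M) : (k + l)%:A *: x = k%:A *: x + l%:A *: x.
Proof. by rewrite !scalerDl. Qed.

Lemma kscaleA M (k : K) (a : A) (x : M) : (k *: a) *: x = k%:A *: (a *: x).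
Proof. by rewrite scalerA mulr_algl. Qed.

Lemma kscaleM M (k l : K) (x : M) : (k * l)%:A *: x = k%:A *: (l%:A *: x).
Proof. by rewrite -scalerA kscaleA. Qed.

Lemma kscaleC M (k : K) (a : A) (x : M) : a *: (k%:A *: x) = k%:A *: (a *: x).
Proof. by rewrite !scalerA mulr_algl mulr_algr. Qed.

Lemma kscale_comb M (k c d : K) (a b : A) (x : M) :
  a *: x = c%:A *: x -> b *: x = d%:A *: x ->
  (k *: a + b) *: x = (k * c + d)%:A *: x.
Proof. by move=> ea eb; rewrite [LHS]scalerDl kscaleA ea eb kscaleD kscaleM. Qed.

Lemma klinear0 M (V : lmodType K) (f : M -> V) : klinear f -> f 0 = 0.
Proof.
move=> h; have := h 1 0 0; rewrite kscale1 scale1r addr0 => /eqP.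
by rewrite -subr_eq0 opprD addrA addrN sub0r oppr_eq0 => /eqP.
Qed.

Lemma klinearD M (V : lmodType K) (f : M -> V) : klinear f ->
  {morph f : x y / x + y}.
Proof. by move=> h x y; have := h 1 x y; rewrite kscale1 scale1r. Qed.

Lemma klinearB M (V : lmodType K) (f : M -> V) : klinear f ->
  {morph f : x y / x - y}.
Proof.
move=> h x y; rewrite -[x - y]addrC.
by have := h (-1) y x; rewrite kscaleN1 scaleN1r => ->; rewrite addrC.
Qed.

Lemma klinear_inj M (V : lmodType K) (f : M -> V) : klinear f ->
  (forall x, f x = 0 -> x = 0) -> injective f.
Proof.
move=> h i x y e; apply/eqP; rewrite -subr_eq0; apply/eqP/i.
by rewrite klinearB // e subrr.
Qed.

(** A matrix of largest rank with rows in [P] has all of [P] as row space, since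
    any further vector of [P] would raise the rank. *)
Lemma subspace_mx n (P : 'rV[K]_n -> Prop) : P 0 ->
  (forall c x y, P x -> P y -> P (c *: x + y)) ->
  exists W : 'M[K]_n, forall v, P v <-> (v <= W)%MS.
Proof.
move=> P0 PD; have PM m (u : 'rV_m) (W : 'M_(m, n)) :
    (forall i, P (row i W)) -> P (u *m W).
  move=> h; rewrite mulmx_sum_row; elim/big_ind: _ => // [x y hx hy|i _].
    by rewrite -[x]scale1r; apply: PD.
  by rewrite -[_ *: _]addr0; apply: PD.
pose Q r := `[< exists2 W : 'M[K]_n, \rank W = r & forall i, P (row i W) >].
have [||r /asboolP [W rW hW] rmax] := @ex_maxnP Q n.
- by exists 0%N; apply/asboolP; exists 0; [rewrite mxrank0|move=> i; rewrite row0].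
- by move=> r /asboolP [W <- _]; apply: rank_leq_row.
exists W => v; split=> [Pv|/submxP [u ->]]; last exact: PM.
apply/negbNE/negP => nv.
have lt : (W < W + v)%MS.
  by rewrite ltmxE addsmxSl /= addsmx_sub negb_and nv orbT.
have := rmax (\rank (W + v)%MS); rewrite leqNgt -rW (rank_ltmx lt).
move=> /(_ _)/negP; apply=> //.
apply/asboolP; exists (W + v)%MS => // i.
have /sub_addsmxP [[a b] /= ->] : (row i (W + v)%MS <= W + v)%MS by apply: row_sub.
rewrite -[_ *m W]scale1r; apply: PD; apply: PM => // j.
by rewrite row_id.
Qed.

(** Reduce coordinates modulo the subspace of coordinates of elements of [S].
    Such maps serve where one would otherwise form quotient modules. *)
Lemma subspace_ker M (S : {pred M}) : finite_dim M -> 0 \in S ->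
  (forall c x y, x \in S -> y \in S -> c%:A *: x + y \in S) ->
  exists n, exists2 c : M -> 'rV[K]_n, klinear c &
    forall x, c x = 0 <-> x \in S.
Proof.
move=> [s sP] S0 SD; set n := size s in sP.
pose p (v : 'rV[K]_n) := \sum_(i < n) (v 0 i)%:A *: s`_i.
have pD c x y : p (c *: x + y) = c%:A *: p x + p y.
  rewrite scaler_sumr -big_split; apply: eq_bigr => i _ /=.
  by rewrite !mxE scalerDl scalerDl -[c *: 1]/(c%:A) scalerA mulr_algl !scalerA.
have pex m : exists v, p v = m.
  have [c ->] := sP m; exists (\row_i c i).
  by apply: eq_bigr => i _; rewrite mxE.
have p0 : p 0 = 0.
  by rewrite /p big1 // => i _; rewrite mxE scale0r scale0r.
have [||W WP] := @subspace_mx n (fun v => p v \in S).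
- by rewrite p0.
- by move=> c x y; rewrite pD; apply: SD.
have {pex} [q qK] := choice pex.
have SB x y : x \in S -> y \in S -> x - y \in S.
  by move=> Sx Sy; rewrite addrC -kscaleN1; apply: SD.
have pB v w : p v = p w -> v *m cokermx W = w *m cokermx W.
  move=> e; apply/eqP; rewrite -subr_eq0 -mulmxBl.
  rewrite -submxE; apply/WP.
  by rewrite addrC -scaleN1r pD kscaleN1 e addNr.
exists n, (fun x => q x *m cokermx W).
  move=> c x y; rewrite scalemxAl -mulmxDl; apply: pB.
  by rewrite pD !qK.
move=> x; rewrite -{2}[x]qK; split=> [/eqP|/WP]; first by rewrite -submxE => /WP.
by rewrite submxE => /eqP.
Qed.

Lemma finite_dim_coord M : finite_dim M ->
  exists n, exists2 c : M -> 'rV[K]_n, klinear c & injective c.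
Proof.
move=> fM; have [|c x y|n [c cl cP]] := subspace_ker (S := pred1 0) fM.
- exact: eqxx.
- by rewrite !inE => /eqP-> /eqP->; rewrite scaler0 addr0.
exists n, c => //; apply: klinear_inj => // x /cP; rewrite inE => /eqP.
by [].
Qed.

(** The image is the row space of a matrix, and preimages of the rows span. *)
Lemma finite_dim_inj M (V : vectType K) (c : M -> V) :
  klinear c -> injective c -> finite_dim M.
Proof.
move=> cl ci; set n := dim V.
pose P (v : 'rV[K]_n) := exists x, v2r (c x) = v.
have [||W WP] := @subspace_mx n P.
- by exists 0; rewrite klinear0 // linear0.
- move=> k _ _ [x <-] [y <-]; exists (k%:A *: x + y).
  by rewrite cl linearP.
have Wrow i : P (row i W) by apply/WP/row_sub.
have [m mP] := choice Wrow.
exists (mkseq (fun i => if insub i is Some i then m i else 0) n) => x.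
rewrite size_mkseq.
have /submxP [u uP] : (v2r (c x) <= W)%MS by apply/WP; exists x.
exists (fun i => if insub i is Some i then u 0 i else 0).
apply: ci; apply: (can_inj v2rK); rewrite uP mulmx_sum_row.
rewrite [RHS](_ : _ = \sum_(i < n) u 0 i *: v2r (c (m i))).
  by apply: eq_bigr => i _; rewrite mP.
have -> : \sum_(i < n) (if insub (val i) is Some i then u 0 i else 0)%:A *:
   (mkseq (fun i => if insub i is Some i then m i else 0) n)`_i
   = \sum_(i < n) (u 0 i)%:A *: m i.
  by apply: eq_bigr => i _; rewrite nth_mkseq // valK.
elim/big_rec2: _ => [|i y z _ <-]; first by rewrite klinear0 // linear0.
by rewrite cl linearP.
Qed.

(** This is the dimension, kept abstract: extremality arguments only use that it
    is bounded and strictly monotone. *)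
Lemma submod_dim M : finite_dim M ->
  exists n (d : {pred M} -> nat),
    (forall S, GRing.submod_closed S -> d S <= n)%N /\
    (forall S T, GRing.submod_closed S -> GRing.submod_closed T ->
       {subset S <= T} -> (d S <= d T)%N /\ ((d T <= d S)%N -> {subset T <= S})).
Proof.
move=> /finite_dim_coord [n [c cl ci]].
have PW (S : {pred M}) : GRing.submod_closed S ->
    exists W : 'M_n, forall v, (exists2 x, x \in S & c x = v) <-> (v <= W)%MS.
  move=> [S0 SD]; apply: subspace_mx; first by exists 0; rewrite ?klinear0.
  move=> k _ _ [x Sx <-] [y Sy <-]; exists (k%:A *: x + y); last exact: cl.
  exact: SD.
pose W (S : {pred M}) := if pselect (GRing.submod_closed S) is left h
  then sval (cid (PW S h)) else 0.
have WP (S : {pred M}) (h : GRing.submod_closed S) v :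
    (exists2 x, x \in S & c x = v) <-> (v <= W S)%MS.
  rewrite /W; case: pselect => // h'; exact: (svalP (cid (PW S h'))).
have WS (S : {pred M}) (h : GRing.submod_closed S) x :
    (x \in S) = (c x <= W S)%MS.
  apply/idP/idP => [Sx|/(WP _ h) [y Sy /ci <- //]].
  by apply/(WP _ h); exists x.
exists n, (fun S => \rank (W S)); split=> [S _|S T hS hT sST].
  exact: rank_leq_row.
have sW : (W S <= W T)%MS.
  apply/row_subP => i; have /(WP _ hS) [x Sx <-] := row_sub i (W S).
  by rewrite -WS // sST.
split=> [|le x]; first exact: mxrankS.
rewrite !WS // => /submx_trans; apply.
by rewrite -(geq_leqif (mxrank_leqif_sup sW)).
Qed.

(** The pairs of coordinates of [f x] and [g x] form a subspace in which, [f] being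
    injective, the first component determines the second; a pseudo-inverse
    turns this into a matrix for the extension. *)
Lemma klinear_extend X Y n (f : {linear X -> Y}) (g : X -> 'rV[K]_n) :
  finite_dim Y -> injective f -> klinear g ->
  exists2 h : Y -> 'rV[K]_n, klinear h & forall x, h (f x) = g x.
Proof.
move=> /finite_dim_coord [m [c cl ci]] fi gl.
pose P (v : 'rV[K]_(m + n)) := exists x, row_mx (c (f x)) (g x) = v.
have [||W WP] := @subspace_mx _ P.
- by exists 0; rewrite linear0 !klinear0 // row_mx0.
- move=> k _ _ [x <-] [y <-]; exists (k%:A *: x + y).
  by rewrite linearP cl gl scale_row_mx add_row_mx.
have ker (u : 'rV_(m + n)) : u *m lsubmx W = 0 -> u *m rsubmx W = 0.
  move=> u0; have [x] : P (u *m W) by apply/WP/submxMl.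
  rewrite -[W in u *m W]hsubmxK mul_mx_row u0 => /eq_row_mx [cx <-].
  rewrite (_ : x = 0) ?klinear0 //; apply: fi; apply: ci.
  by rewrite cx linear0 klinear0.
have {}ker q (u : 'M_(q, m + n)) : u *m lsubmx W = 0 -> u *m rsubmx W = 0.
  move=> u0; apply/row_matrixP => i; rewrite row_mul row0.
  by apply: ker; rewrite -row_mul u0 row0.
pose H := pinvmx (lsubmx W) *m rsubmx W.
have HP : lsubmx W *m H = rsubmx W.
  apply/eqP; rewrite -subr_eq0 mulmxA -[X in _ - X]mul1mx -mulmxBl; apply/eqP/ker.
  by rewrite mulmxBl mul1mx mulmxKpV ?subrr.
exists (fun y => c y *m H) => [k x y|x].
  by rewrite cl mulmxDl scalemxAl.
have /submxP [u] : (row_mx (c (f x)) (g x) <= W)%MS by apply/WP; exists x.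
rewrite -[W]hsubmxK mul_mx_row => /eq_row_mx [-> ->].
by rewrite -mulmxA HP.
Qed.

Lemma injective_retract M N (i : {linear N -> M}) (r : {linear M -> N}) :
  cancel i r -> injective_module M -> injective_module N.
Proof.
move=> ir hM X Y f g fX fY fi.
have [h hP] := hM X Y f (i \o g) fX fY fi.
by exists (r \o h) => x /=; rewrite hP /= ir.
Qed.

Lemma projective_retract M N (i : {linear N -> M}) (r : {linear M -> N}) :
  cancel i r -> projective_module M -> projective_module N.
Proof.
move=> ir hM X Y f g fX fY fs.
have [h hP] := hM X Y f (g \o r) fX fY fs.
by exists (h \o i) => x /=; rewrite hP /= ir.
Qed.

End FiniteDimensional.
(** * Submodules and injective hulls *)

Section Submodules.
Variables (K : fieldType) (A : algType K).
Implicit Types M N X Y C E : lmodType A.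

Definition mk_submod M (S : {pred M}) (h : GRing.submod_closed S) :
  submodClosed M := HB.pack S (GRing.isSubmodClosed.Build A M S h).

Definition submodule M (S : submodClosed M) : Type := {x : M | x \in S}.
HB.instance Definition _ M (S : submodClosed M) := SubType.on (submodule S).
HB.instance Definition _ M (S : submodClosed M) :=
  [Choice of submodule S by <:].
HB.instance Definition _ M (S : submodClosed M) :=
  [SubChoice_isSubLmodule of submodule S by <:].

Definition submod_incl M (S : submodClosed M) : {linear submodule S -> M} := val.

Lemma submod_lift M N (S : submodClosed M) (f : {linear N -> M}) :
  (forall x, f x \in S) ->
  exists g : {linear N -> submodule S}, forall x, val (g x) = f x.
Proof.
move=> fS; pose g0 x : submodule S := exist _ (f x) (fS x).
have gl : linear g0.
  move=> a x y; apply: val_inj; rewrite [val _]/= linearP.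
  exact/esym/(linearP (submod_incl S)).
by exists (mk_linear gl).
Qed.

Lemma submodule_finite_dim M (S : submodClosed M) :
  finite_dim M -> finite_dim (submodule S : lmodType A).
Proof.
move=> /finite_dim_coord [n [c cl ci]].
apply: (@finite_dim_inj _ _ _ _ (c \o submod_incl S)).
  by move=> k x y; rewrite /comp linearP cl.
by move=> x y /= /ci /val_inj.
Qed.

Lemma submod_closed_image M N (f : {linear M -> N}) (S : {pred M}) :
  GRing.submod_closed S ->
  GRing.submod_closed (fun y => `[< exists2 x, x \in S & f x = y >]).
Proof.
move=> [S0 SD]; split; first by apply/asboolP; exists 0; rewrite ?linear0.
move=> a _ _ /asboolP[x Sx <-] /asboolP[y Sy <-]; apply/asboolP.
by exists (a *: x + y); [apply: SD|rewrite linearP].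
Qed.

Lemma submod_closed_preim M N (f : {linear M -> N}) (S : {pred N}) :
  GRing.submod_closed S -> GRing.submod_closed (fun x => f x \in S).
Proof.
move=> [S0 SD]; split; first by rewrite -topredE /= linear0.
by move=> a x y; rewrite -!topredE /= linearP; apply: SD.
Qed.

Lemma submod_closed0 M : GRing.submod_closed (pred1 (0 : M)).
Proof.
split; first by rewrite inE.
by move=> a x y; rewrite !inE => /eqP-> /eqP->; rewrite scaler0 addr0.
Qed.

Lemma submod_closedT M : GRing.submod_closed (predT : {pred M}).
Proof. by []. Qed.

End Submodules.

Section Hull.
Variables (K : fieldType) (A : algType K) (C : lmodType A) (N : {pred C}).
Hypotheses (C_fd : finite_dim C) (C_inj : injective_module C).
Hypothesis N_submod : GRing.submod_closed N.

Let ker (f : {linear C -> C}) : {pred C} := fun x => f x \in pred1 0.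
Let im (f : {linear C -> C}) : {pred C} :=
  fun y => `[< exists2 x, x \in (predT : {pred C}) & f x = y >].

(** Maximize the dimension of the kernel plus the codimension of the image: a
    map at least as good in both respects is then equal in both. *)
Let extremal_endo : exists2 phi : {linear C -> C},
  (forall x, x \in N -> phi x = x) &
  forall psi : {linear C -> C}, (forall x, x \in N -> psi x = x) ->
    {subset ker phi <= ker psi} -> {subset im psi <= im phi} ->
    {subset ker psi <= ker phi} /\ {subset im phi <= im psi}.
Proof.
have [n [d [dn dlt]]] := submod_dim C_fd.
have kS f : GRing.submod_closed (ker f).
  exact: submod_closed_preim (submod_closed0 C).
have iS f : GRing.submod_closed (im f).
  exact: submod_closed_image (submod_closedT C).
pose P m := `[< exists2 phi : {linear C -> C},
  (forall x, x \in N -> phi x = x) & (d (ker phi) + (n - d (im phi)) = m)%N >].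
have [||_ /asboolP [phi phiN <-] phimax] := @ex_maxnP P (n + n).
- by exists (d (ker idfun) + (n - d (im idfun)))%N; apply/asboolP; exists idfun.
- by move=> _ /asboolP [phi _ <-]; rewrite leq_add ?dn ?leq_subr.
exists phi => // psi psiN sk si.
have [lek subk] := dlt _ _ (kS phi) (kS psi) sk.
have [lei subi] := dlt _ _ (iS psi) (iS phi) si.
have := phimax (d (ker psi) + (n - d (im psi)))%N.
have /[swap]/[apply] : P (d (ker psi) + (n - d (im psi)))%N.
  by apply/asboolP; exists psi.
have := dn _ (iS phi); have := dn _ (iS psi) => le1 le2 le3.
split; [apply: subk|apply: subi]; lia.
Qed.

(** Comparing an extremal [phi] with [phi o phi] shows that [phi] permutes its
    image [E], so that [E] is a direct summand of [C]. If a submodule of [E]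
    met [N] trivially, then an endomorphism of [C] that fixes [N] and kills it
    would make a larger kernel possible, so that [N] is essential in [E]. *)
Lemma injective_hull : exists (E : submodClosed C) (r : {linear C -> C}),
  [/\ forall x, r x \in E, forall x, x \in E -> r x = x, {subset N <= E}
    & forall S : {pred C}, GRing.submod_closed S -> {subset S <= E} ->
        (exists2 x, x \in S & x != 0) -> exists2 x, x \in N & (x \in S) && (x != 0)].
Proof.
have [phi phiN phimax] := extremal_endo.
have imP (f : {linear C -> C}) y : reflect (exists x, f x = y) (y \in im f).
  apply: (iffP (asboolP _)) => [[x _ <-]|[x <-]]; by exists x.
have kerP (f : {linear C -> C}) x : reflect (f x = 0) (x \in ker f) by apply: eqP.
have [k2 i2] : {subset ker (phi \o phi) <= ker phi} /\
               {subset im phi <= im (phi \o phi)}.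
  apply: phimax => [x Nx /=|x /kerP e|_ /imP [x <-]]; first by rewrite !phiN.
    by apply/kerP; rewrite /= e linear0.
  by apply/imP; exists (phi x).
have inj2 x y : x \in im phi -> y \in im phi -> phi x = phi y -> x = y.
  move=> /imP [u <-] /imP [v <-] e; apply/eqP; rewrite -subr_eq0 -linearB.
  apply/eqP/kerP/k2/kerP; by rewrite /= linearB linearB e subrr.
pose E := mk_submod (submod_closed_image phi (submod_closedT C)).
have EE x : (x \in E) = (x \in im phi) by [].
have rex x : exists y, y \in E /\ phi y = phi x.
  have /i2 /imP [u /= e] : phi x \in im phi by apply/imP; exists x.
  by exists (phi u); rewrite EE e; split => //; apply/imP; exists u.
have [r0 r0P] := choice rex.
have rl : linear r0.
  move=> a x y; apply: inj2; rewrite -?EE; first by case: (r0P (a *: x + y)).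
    apply: rpredD; last by case: (r0P y).
    by apply: rpredZ; case: (r0P x).
  rewrite !linearP; case: (r0P x) => _ ->; case: (r0P y) => _ ->.
  by case: (r0P (a *: x + y)) => _ ->; rewrite linearP.
exists E, (mk_linear rl); split=> [x|x Ex|x Nx|S SS sSE [s Ss s0]].
- by case: (r0P x).
- by case: (r0P x) => Er er; apply: inj2.
- by rewrite EE; apply/imP; exists x; apply: phiN.
apply: contrapT => noN.
have NS x : x \in N -> x \in S -> x = 0.
  move=> Nx Sx; apply/eqP/negPn/negP => x0; apply: noN.
  by exists x => //; rewrite Sx.
(* Extend the map that is the identity on [N] and zero on [S] to all of [C]. *)
pose NSp : {pred C} := fun x => `[< exists2 u, u \in N & x - u \in S >].
have SB := GRing.submod_closedB SS; have NB := GRing.submod_closedB N_submod.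
have NSS : GRing.submod_closed NSp.
  split; first by apply/asboolP; exists 0; rewrite ?subr0 ?(proj1 SS) ?(proj1 N_submod).
  move=> a x y /asboolP [u Nu Su] /asboolP [v Nv Sv]; apply/asboolP.
  exists (a *: u + v); first exact: (proj2 N_submod).
  by rewrite opprD addrACA -scalerBr; apply: (proj2 SS).
have pex (x : submodule (mk_submod NSS)) : exists u, u \in N /\ val x - u \in S.
  by case: x => x /= /asboolP [u ? ?]; exists u.
have [p pP] := choice pex.
have uniqp x u : u \in N -> val x - u \in S -> p x = u.
  move=> Nu Su; have [Np Sp] := pP x; apply/eqP; rewrite -subr_eq0; apply/eqP/NS.
    exact: (proj2 NB).
  have -> : p x - u = (val x - u) - (val x - p x) by rewrite opprB [RHS]addrC subrKA.
  exact: (proj2 SB).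
have pl : linear p.
  move=> a x y; have [Nx Sx] := pP x; have [Ny Sy] := pP y.
  apply: uniqp; first exact: (proj2 N_submod).
  rewrite -/(submod_incl _ _) linearP opprD addrACA -scalerBr.
  exact: (proj2 SS).
have [psi psiP] := @C_inj (submodule (mk_submod NSS)) C (submod_incl _)
  (mk_linear pl) (submodule_finite_dim _ C_fd) C_fd val_inj.
have psiN x : x \in N -> psi x = x.
  move=> Nx; have NSx : x \in mk_submod NSS.
    by apply/asboolP; exists x; rewrite // subrr (proj1 SS).
  have /= -> := psiP (exist _ x NSx); apply: uniqp => //=.
  by rewrite subrr (proj1 SS).
have psiS x : x \in S -> psi x = 0.
  move=> Sx; have NSx : x \in mk_submod NSS.
    by apply/asboolP; exists 0; rewrite ?subr0 // (proj1 N_submod).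
  have /= -> := psiP (exist _ x NSx).
  by apply: uniqp; rewrite /= ?subr0 // (proj1 N_submod).
have [k3 _] : {subset ker (phi \o (psi \o phi)) <= ker phi} /\
              {subset im phi <= im (phi \o (psi \o phi))}.
  apply: phimax => [x Nx /=|x /kerP e|_ /imP [x <-]].
  - by rewrite (phiN x) // psiN // phiN.
  - by apply/kerP; rewrite /= e !linear0.
  - by apply/imP; exists (psi (phi x)).
have /imP [x ex] : s \in im phi by rewrite -EE sSE.
have /k3/kerP e : x \in ker (phi \o (psi \o phi)).
  by apply/kerP; rewrite /= ex psiS // linear0.
by rewrite -ex e eqxx in s0.
Qed.

End Hull.

(** * Coinduced modules and minimal injective resolutions *)

Section Coinduced.
Variables (K : fieldType) (A : algType K) (V : vectType K).
Implicit Types M X Y E : lmodType A.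

(** [Hom_K(A, V)] with [a phi = (x |-> phi (x a))]; for [V = K] it is the dual
    [D(A)] of the right regular module. *)
Definition coind : Type := {f : A -> V | `[< linear f >]}.
HB.instance Definition _ := SubType.on coind.
HB.instance Definition _ := [Choice of coind by <:].

Definition mk_coind (f : A -> V) (h : linear f) : coind :=
  exist _ f (introT (asboolP _) h).

Definition coind_lin (phi : coind) : {linear A -> V} :=
  HB.pack (val phi) (GRing.isLinear.Build K A V *:%R (val phi)
    (elimT (asboolP _) (valP phi))).

Lemma coind_valD (phi : coind) x y : val phi (x + y) = val phi x + val phi y.
Proof. exact: (linearD (coind_lin phi)). Qed.

Lemma coind_valZ (phi : coind) k x : val phi (k *: x) = k *: val phi x.
Proof. exact: (linearZ_LR (coind_lin phi)). Qed.

Lemma coind_val_sum (phi : coind) (I : Type) (r : seq I) (P : pred I) (F : I -> A) :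
  val phi (\sum_(i <- r | P i) F i) = \sum_(i <- r | P i) val phi (F i).
Proof. exact: (linear_sum (coind_lin phi)). Qed.

Lemma coind_ext (phi psi : coind) : val phi =1 val psi -> phi = psi.
Proof. by move=> e; apply/val_inj/funext. Qed.

Fact coind0_subproof : linear (fun _ : A => 0 : V).
Proof. by move=> k x y; rewrite scaler0 addr0. Qed.
Fact coindD_subproof (phi psi : coind) :
  linear (fun x => coind_lin phi x + coind_lin psi x).
Proof. by move=> k x y; rewrite !linearP scalerDr addrACA. Qed.
Fact coindN_subproof (phi : coind) : linear (fun x => - coind_lin phi x).
Proof. by move=> k x y; rewrite [coind_lin _ _]linearP opprD scalerN. Qed.
Fact coindZ_subproof (a : A) (phi : coind) :
  linear (fun x => coind_lin phi (x * a)).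
Proof. by move=> k x y; rewrite mulrDl -scalerAl linearP. Qed.

Definition coind0 := mk_coind coind0_subproof.
Definition coindD phi psi := mk_coind (coindD_subproof phi psi).
Definition coindN phi := mk_coind (coindN_subproof phi).
Definition coindZ a phi := mk_coind (coindZ_subproof a phi).

Fact coindDA : associative coindD.
Proof. by move=> f g h; apply: coind_ext => x /=; rewrite addrA. Qed.
Fact coindDC : commutative coindD.
Proof. by move=> f g; apply: coind_ext => x /=; rewrite addrC. Qed.
Fact coind0D : left_id coind0 coindD.
Proof. by move=> f; apply: coind_ext => x /=; rewrite add0r. Qed.
Fact coindND : left_inverse coind0 coindN coindD.
Proof. by move=> f; apply: coind_ext => x /=; rewrite addNr. Qed.
HB.instance Definition _ :=
  GRing.isZmodule.Build coind coindDA coindDC coind0D coindND.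

Fact coindZA a b phi : coindZ a (coindZ b phi) = coindZ (a * b) phi.
Proof. by apply: coind_ext => x /=; rewrite mulrA. Qed.
Fact coind1Z : left_id 1 coindZ.
Proof. by move=> f; apply: coind_ext => x /=; rewrite mulr1. Qed.
Fact coindZDr : right_distributive coindZ +%R.
Proof. by move=> a f g; apply: coind_ext. Qed.
Fact coindZDl phi : {morph coindZ^~ phi : a b / a + b}.
Proof.
by move=> a b; apply: coind_ext => x /=; rewrite mulrDr; apply: coind_valD.
Qed.
HB.instance Definition _ := GRing.Zmodule_isLmodule.Build A coind
  coindZA coind1Z coindZDr coindZDl.

Lemma coindDE (phi psi : coind) x : val (phi + psi) x = val phi x + val psi x.
Proof. by []. Qed.

Lemma coindZE a (phi : coind) x : val (a *: phi) x = val phi (x * a).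
Proof. by []. Qed.

Lemma coindE_klinear x : klinear (fun phi : coind => val phi x).
Proof.
move=> k phi psi; by rewrite coindDE coindZE -scalerAr mulr1 coind_valZ.
Qed.

(** Coinduction is right adjoint to forgetting the action of [A]. *)
Lemma coind_adj M (c : M -> V) : klinear c ->
  exists f : {linear M -> coind}, forall m x, val (f m) x = c (x *: m).
Proof.
move=> cl; have cxl m : linear (fun x : A => c (x *: m)).
  by move=> k x y; rewrite scalerDl -[k *: x]mulr_algl -scalerA cl.
have fl : linear (fun m => mk_coind (cxl m)).
  move=> a m m'; apply: coind_ext => x /=.
  by rewrite scalerDr scalerA klinearD.
by exists (mk_linear fl).
Qed.

Lemma coind_finite_dim : finite_dim (A^o : lmodType A) ->
  finite_dim (coind : lmodType A).
Proof.
move=> [s sP].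
pose c (phi : coind) : {ffun 'I_(size s) -> V} :=
    [ffun i : 'I_(size s) => val phi s`_i].
apply: (@finite_dim_inj _ _ _ _ c).
  by move=> k f g; apply/ffunP => i; rewrite !ffunE coindE_klinear.
move=> f g /ffunP e; apply: coind_ext => x; have [k ->] := sP x.
rewrite !coind_val_sum.
apply: eq_bigr => i _; have := e i; rewrite !ffunE => ei.
rewrite -[_ *: _]/(_ * _ : A) -scalerAl mul1r.
by rewrite !coind_valZ ei.
Qed.

(** By adjunction, extending an [A]-linear map to a coinduced module amounts to
    extending a [K]-linear map to [V]. *)
Lemma coind_injective : injective_module (coind : lmodType A).
Proof.
move=> X Y f g fX fY fi; pose c x := v2r (val (g x) 1).
have cl : klinear c.
  by move=> k x y; rewrite /c linearP coindE_klinear linearP.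
have [h0 h0l h0P] := klinear_extend fY fi cl.
have [|h hP] := @coind_adj Y (fun y => r2v (h0 y)).
  by move=> k x y; rewrite h0l linearP.
exists h => x; apply: coind_ext => a.
by rewrite hP -linearZ h0P /c linearZ v2rK coindZE mul1r.
Qed.

End Coinduced.

Section Resolution.
Variables (K : fieldType) (A : algType K).
Hypothesis A_fd : finite_dim (A^o : lmodType A).
Implicit Types M X Y E : lmodType A.

(** A [K]-linear map [c] with kernel [S] gives [m |-> (x |-> c (x m))], whose
    kernel is the largest submodule inside [S], that is [S] itself. So [E / S]
    embeds into an injective module, and has a hull there. *)
Lemma injective_cosyzygy E (S : {pred E}) :
  finite_dim E -> GRing.submod_closed S ->
  exists (E' : lmodType A) (d : {linear E -> E'}),
    [/\ finite_dim E', injective_module E', forall x, d x = 0 <-> x \in S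
      & essential_image d].
Proof.
move=> fE [S0 SD].
have [|n [c cl cP]] := subspace_ker fE S0; first by move=> k x y; apply: SD.
pose C : lmodType A := coind A 'rV[K]_n.
have [j jP] : exists j : {linear E -> C}, forall m x, val (j m) x = c (x *: m).
  exact: coind_adj.
have jker x : j x = 0 <-> x \in S.
  split=> [jx|Sx].
    by apply/cP; rewrite -[x]scale1r -jP jx.
  apply: coind_ext => a; rewrite jP; apply/cP.
  by rewrite -[_ *: _]addr0; apply: SD.
have fC : finite_dim C by apply: coind_finite_dim.
have iC : injective_module C by apply: coind_injective.
have NS := submod_closed_image j (submod_closedT E).
have [E' [r [rE rK NE ess]]] := injective_hull fC iC NS.
have jE x : j x \in E' by apply/NE/asboolP; exists x.
have [d dP] := submod_lift jE.
have [r' r'P] := submod_lift rE.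
exists (submodule E'), d; split.
- exact: submodule_finite_dim.
- apply: (@injective_retract _ _ _ _ (submod_incl E') r') => // x.
  by apply: val_inj; rewrite r'P rK //; apply: valP.
- move=> x; rewrite -jker -dP; split=> [-> //|e]; exact: val_inj.
move=> T TS [x Tx x0].
have [||z /asboolP [m _ <-] /andP [/asboolP [t Tt et] jm0]] :=
  ess _ (submod_closed_image (submod_incl E') TS).
- by move=> _ /asboolP [t _ <-]; apply: valP.
- by exists (val x); [apply/asboolP; exists x|].
exists m; first by rewrite (_ : d m = t) //; apply: val_inj; rewrite dP -et.
by apply: contraNneq jm0 => e; rewrite -dP e.
Qed.

(** The state of the recursion that builds a resolution: the current term and
    the image of the map into it, which is what the next map has to kill. *)
Record cosyzygy_stage := CosyzygyStage {
  stage_mod : lmodType A;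
  stage_fd : finite_dim stage_mod;
  stage_sub : {pred stage_mod};
  stage_subP : GRing.submod_closed stage_sub
}.

Let next_ex (s : cosyzygy_stage) : exists p : {E' : lmodType A &
    {linear stage_mod s -> E'}},
  [/\ finite_dim (projT1 p), injective_module (projT1 p),
    forall x, projT2 p x = 0 <-> x \in @stage_sub s
    & essential_image (projT2 p)].
Proof.
have [E' [d dP]] := injective_cosyzygy (stage_fd s) (@stage_subP s).
by exists (existT _ E' d).
Qed.

Let next_map (s : cosyzygy_stage) := sval (cid (next_ex s)).
Let next_mapP (s : cosyzygy_stage) := svalP (cid (next_ex s)).
Let next_fd (s : cosyzygy_stage) : finite_dim (projT1 (next_map s)).
Proof. by case: (next_mapP s). Qed.
Let next (s : cosyzygy_stage) : cosyzygy_stage := CosyzygyStage (next_fd s)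
  (submod_closed_image (projT2 (next_map s)) (submod_closedT _)).

(** The first term can be prescribed: it is the one whose projectivity is at
    stake in [dom_dim_ge M 1]. *)
Lemma injective_resolution_exists M E (i : {linear M -> E}) :
  finite_dim E -> injective_module E -> injective i -> essential_image i ->
  exists I : min_injective_resolution M, mir_term I 0 = E.
Proof.
move=> fE iE inj_i ess_i.
pose s0 := CosyzygyStage fE (submod_closed_image i (submod_closedT M)).
pose st n := iter n next s0.
pose d n : {linear stage_mod (st n) -> stage_mod (st n.+1)} :=
  projT2 (next_map (st n)).
have sub_im (s : cosyzygy_stage) x :
    x \in @stage_sub (next s) <-> exists y, projT2 (next_map s) y = x.
  split=> [/asboolP [y _ <-]|[y <-]]; first by exists y.
  by apply/asboolP; exists y.
unshelve eexists (@MinInjectiveResolution _ _ M (fun n => stage_mod (st n)) i d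
  _ _ inj_i _ _ ess_i _) => //.
- by move=> n; apply: stage_fd.
- by case=> [//|n]; case: (next_mapP (st n)).
- move=> x; case: (next_mapP s0) => _ _ -> _.
  split=> [/asboolP [y _ <-]|[y <-]]; first by exists y.
  by apply/asboolP; exists y.
- move=> n x; rewrite -sub_im.
  by case: (next_mapP (st n.+1)).
- by move=> n; case: (next_mapP (st n)).
Qed.

End Resolution.

(** * Powers, projectivity and the first step of dominant dimension *)

Section Powers.
Variables (K : fieldType) (A : algType K) (I : finType).
Implicit Types M X Y E : lmodType A.

Fact power_proj_subproof M i : linear (fun f : {ffun I -> M} => f i).
Proof. by move=> a f g; rewrite !ffunE. Qed.
Definition power_proj M i : {linear {ffun I -> M} -> M} :=
  mk_linear (@power_proj_subproof M i).

Lemma power_map M X (f : I -> {linear X -> M}) :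
  exists g : {linear X -> {ffun I -> M}}, forall x i, g x i = f i x.
Proof.
have gl : linear (fun x => [ffun i => f i x]).
  by move=> a x y; apply/ffunP => i; rewrite !ffunE linearP.
by exists (mk_linear gl) => x i; rewrite ffunE.
Qed.

Lemma copower_map M X (f : I -> {linear M -> X}) :
  exists g : {linear {ffun I -> M} -> X}, forall m, g m = \sum_i f i (m i).
Proof.
have gl : linear (fun m : {ffun I -> M} => \sum_i f i (m i)).
  move=> a x y; rewrite scaler_sumr -big_split; apply: eq_bigr => i _ /=.
  by rewrite !ffunE linearP.
by exists (mk_linear gl).
Qed.

Lemma power_finite_dim M : finite_dim M ->
  finite_dim ({ffun I -> M} : lmodType A).
Proof.
move=> /finite_dim_coord [n [c cl ci]].
pose c' (m : {ffun I -> M}) : {ffun I -> 'rV[K]_n} := [ffun i => c (m i)].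
apply: (@finite_dim_inj K A _ _ c').
  by move=> k x y; apply/ffunP => i; rewrite !ffunE cl.
by move=> x y /ffunP e; apply/ffunP => i; apply: ci; have := e i; rewrite !ffunE.
Qed.

Lemma power_injective M : injective_module M ->
  injective_module ({ffun I -> M} : lmodType A).
Proof.
move=> iM X Y f g fX fY fi.
have /choice [h hP] i := iM X Y f (power_proj M i \o g) fX fY fi.
have [k kP] := power_map h; exists k => x.
by apply/ffunP => i; rewrite kP hP.
Qed.

Lemma power_projective M : projective_module M ->
  projective_module ({ffun I -> M} : lmodType A).
Proof.
move=> pM X Y f g fX fY fs.
have injl i : linear (fun m : M => [ffun j : I => if j == i then m else 0]).
  move=> a x y; apply/ffunP => j; rewrite !ffunE.
  by case: eqP => // _; rewrite scaler0 addr0.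
have /choice [h hP] i := pM X Y f (g \o mk_linear (injl i)) fX fY fs.
have [k kP] := copower_map h; exists k => m.
rewrite kP linear_sum (eq_bigr _ (fun i _ => hP i (m i))) /= -linear_sum.
congr (g _); apply/ffunP => j; rewrite sum_ffunE (bigD1 j) //= big1.
  by rewrite ffunE eqxx addr0.
by move=> i ij; rewrite ffunE eq_sym (negPf ij).
Qed.

End Powers.

Section RegularModule.
Variables (K : fieldType) (A : algType K).
Hypothesis A_fd : finite_dim (A^o : lmodType A).
Implicit Types M X Y E : lmodType A.

Lemma rmul_linear M (m : M) :
  exists f : {linear A^o -> M}, forall a : A, f a = a *: m.
Proof.
have fl : linear (fun a : A^o => (a : A) *: m).
  by move=> a x y; rewrite scalerDl scalerA.
by exists (mk_linear fl).
Qed.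

Lemma regular_projective : projective_module (A^o : lmodType A).
Proof.
move=> X Y f g fX fY fs; have [x fx] := fs (g (1 : A)).
have [h hP] := rmul_linear x; exists h => m.
rewrite hP linearZ fx -linearZ; congr (g _); exact: mulr1.
Qed.

(** A finite-dimensional projective module embeds into a power of [A], hence is
    separated by its maps to [A]. *)
Lemma projective_separated E (x : E) : finite_dim E -> projective_module E ->
  x != 0 -> exists f : {linear E -> A^o}, f x != 0.
Proof.
move=> fE pE x0; have [s sP] := fE.
have /choice [f fP] (i : 'I_(size s)) := rmul_linear s`_i.
have [p pP] := copower_map f.
have [|h hP] := pE _ _ p (idfun : {linear E -> E}) (power_finite_dim _ A_fd) fE.
  move=> y; have [c ->] := sP y; exists [ffun i : 'I__ => (c i)%:A].
  by rewrite pP; apply: eq_bigr => i _; rewrite fP ffunE.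
have [/existsP [i hi]|/existsPn h0] := boolP [exists i, h x i != 0].
  by exists (power_proj _ i \o h).
case/eqP: x0; rewrite -[x]/(idfun x) -hP (_ : h x = 0) ?linear0 //.
by apply/ffunP => i; rewrite ffunE; apply/eqP/negPn/h0.
Qed.

End RegularModule.

Section DominantDimensionOne.
Variables (K : fieldType) (A : algType K).

Lemma dom_dim_ge_le (M : lmodType A) j k :
  (j <= k)%N -> dom_dim_ge M k -> dom_dim_ge M j.
Proof. by move=> jk [I h]; exists I => i ij; apply: h; apply: leq_trans jk. Qed.

(** The bounds [dom_dim_ge M k] are monotone in [k], which makes the value chosen
    in [dom_dim] unique. *)
Lemma dom_dimP (M : lmodType A) k : has_dom_dim M k -> dom_dim M = Some k.
Proof.
move=> hk; rewrite /dom_dim; case: pselect => [h|]; last by case; exists k.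
congr Some; case: (cid h) => j /= hj; have [g1 n1] := hk; have [g2 n2] := hj.
have [jk|kj|//] := ltngtP j k.
  by case: n2; apply: (dom_dim_ge_le jk); apply: g1; apply: leq_ltn_trans jk.
by case: n1; apply: (dom_dim_ge_le kj); apply: g2; apply: leq_ltn_trans kj.
Qed.

(** A projective-injective module containing [M] contains an injective hull of
    [M] as a direct summand, which is then projective too. *)
Lemma dom_dim_ge1 (M P : lmodType A) (i : {linear M -> P}) :
  finite_dim (A^o : lmodType A) -> finite_dim P -> injective_module P ->
  projective_module P -> injective i -> dom_dim_ge M 1.
Proof.
move=> fA fP iP pP ii; have iS := submod_closed_image i (submod_closedT M).
have [E [r [rE rK NE ess]]] := injective_hull fP iP iS.
have [j jP] : exists j : {linear M -> submodule E}, forall x, val (j x) = i x.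
  by apply: submod_lift => x; apply/NE/asboolP; exists x.
have [r' r'P] := submod_lift rE.
have incK : cancel (submod_incl E) r'.
  by move=> x; apply: val_inj; rewrite r'P rK //; apply: valP.
have [||x y|T TS [x Tx x0]|I I0] := @injective_resolution_exists _ _ fA _ _ j.
- exact: submodule_finite_dim.
- exact: injective_retract incK iP.
- by move=> e; apply: ii; rewrite -!jP e.
- have [||z /asboolP [m _ <-] /andP [/asboolP [t Tt et] jm0]] :=
    ess _ (submod_closed_image (submod_incl E) TS).
  + by move=> _ /asboolP [t _ <-]; apply: valP.
  + by exists (val x); [apply/asboolP; exists x|].
  exists m; first by rewrite (_ : j m = t) //; apply: val_inj; rewrite jP -et.
  by apply: contraNneq jm0 => e; rewrite -jP e.
exists I => -[|//] _; rewrite I0; exact: projective_retract incK pP.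
Qed.

End DominantDimensionOne.

(** * The basis of nonzero paths of a bound quiver algebra *)

Section QuotientMap.
Variables (K : fieldType) (A : algType K) (J : ideal A).

Lemma quot_pi0 : quot_pi J 0 = 0.
Proof. exact: (raddf0 (\pi_({ideal_quot (ideal_pred J)}))%qT). Qed.

Lemma quot_pi_sum (I : Type) (r : seq I) (P : pred I) (F : I -> A) :
  quot_pi J (\sum_(i <- r | P i) F i) = \sum_(i <- r | P i) quot_pi J (F i).
Proof. exact: (raddf_sum (\pi_({ideal_quot (ideal_pred J)}))%qT). Qed.

End QuotientMap.

Section PathBasis.
Variables (K : fieldType) (Q : quiver) (R : zero_relations Q).
Local Notation B := (bound_quiver_alg K R).
Local Notation endpoint x s := (last x (map (@target Q) s)).

Definition nonzero_path (x : vertex Q) (s : seq (arrow Q)) : bool :=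
  is_path x s && ~~ `[< exists2 r, relset R r & infix (parrows r) s >].

Definition nzq (p : qpath Q) : bool := nonzero_path (psource p) (parrows p).

Lemma nonzero_infix x y s t : is_path y t -> infix t s ->
  nonzero_path x s -> nonzero_path y t.
Proof.
move=> yt ts /andP [_ /asboolPn ns]; apply/andP; split=> //.
by apply/asboolPn => -[r Rr rt]; apply: ns; exists r => //; apply: infix_trans ts.
Qed.

Lemma nonzero_catl x s t : nonzero_path x (s ++ t) -> nonzero_path x s.
Proof.
move=> h; have := h; rewrite /nonzero_path is_path_cat -andbA => /and3P [xs _ _].
by apply: nonzero_infix h => //; apply/prefixW/prefix_prefix.
Qed.

Lemma nonzero_catr x s t : nonzero_path x (s ++ t) -> nonzero_path (endpoint x s) t.
Proof.
move=> h; have := h; rewrite /nonzero_path is_path_cat -andbA => /and3P [_ xt _].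
by apply: nonzero_infix h => //; apply/suffixW/suffix_suffix.
Qed.

Lemma nonzero_nil x : nonzero_path x [::].
Proof.
apply/andP; split=> //; apply/asboolPn => -[r /relset_zero].
by rewrite /zero_relation /plength infixs0 => h /eqP e; rewrite e in h.
Qed.

(** This ideal contains the relation ideal, so that coefficients at nonzero paths
    make sense in the quotient. *)
Definition zero_supported : set (path_alg K Q) :=
  [set f | forall p, nzq p -> (f : {malg K[qpath Q]})@_p = 0].

Lemma nzq_comp p q r : Defs.pcomp p q = Some r -> nzq r -> nzq p /\ nzq q.
Proof.
case: pcompP => // r' e1 e2 e3 e4 [<-]; rewrite /nzq e2 e3 => h.
by split; [rewrite -e1; apply: nonzero_catr h|apply: nonzero_catl h].
Qed.

Lemma zero_supported_ideal : two_sided_ideal zero_supported.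
Proof.
have mull (f g : path_alg K Q) : zero_supported g -> zero_supported (path_mul f g).
  move=> hg; elim/path_alg_ind: f => [r _|p r hr|k f f' IH IH' r hr].
  - by rewrite path_mul0f mcoeff0.
  - rewrite path_mulEl path_elt.unlock lin_extU raddf_sum big1 // => q _ /=.
    rewrite mcoeffZ /path_prod; case e: (Defs.pcomp p q) => [u|];
      last by rewrite mcoeff0 mulr0.
    rewrite path_eltE; case: eqP => [eu|_]; last by rewrite mulr0.
    by rewrite eu in e; have [_ /hg ->] := nzq_comp e hr; rewrite mul0r.
  - by rewrite path_mulPl path_coefP IH // IH' // mulr0 addr0.
have mulr (f g : path_alg K Q) : zero_supported g -> zero_supported (path_mul g f).
  move=> hg; elim/path_alg_ind: f => [r _|p r hr|k f f' IH IH' r hr].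
  - by rewrite path_mulf0 mcoeff0.
  - rewrite path_mulEr path_elt.unlock lin_extU raddf_sum big1 // => q _ /=.
    rewrite mcoeffZ /path_prod; case e: (Defs.pcomp q p) => [u|];
      last by rewrite mcoeff0 mulr0.
    rewrite path_eltE; case: eqP => [eu|_]; last by rewrite mulr0.
    by rewrite eu in e; have [/hg -> _] := nzq_comp e hr; rewrite mul0r.
  - by rewrite path_mulPr path_coefP IH // IH' // mulr0 addr0.
split=> [p _|f g f0 g0 p hp|u f v f0]; first exact: mcoeff0.
  by rewrite mcoeffB f0 // g0 // subr0.
by apply: mulr; apply: mull.
Qed.

Lemma relation_zero_supported f : @relation_ideal K Q R f -> zero_supported f.
Proof.
apply; split; first exact: zero_supported_ideal.
move=> _ [r Rr <-] p np; rewrite path_eltE; case: eqP => // e.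
by move: np; rewrite -e => /andP [_ /asboolPn []]; exists r => //; apply: infix_refl.
Qed.

Definition path_class (p : qpath Q) : B := quot_pi _ (path_elt K p).

(** The class of a path, extended by zero to all sequences of arrows so that the
    product formula [pathBM] has no side condition. *)
Definition pathB (x : vertex Q) (s : seq (arrow Q)) : B :=
  if insub (x, s) is Some p then path_class p else 0.

Lemma pathB_qpath p : pathB (psource p) (parrows p) = path_class p.
Proof.
rewrite /pathB /psource /parrows -surjective_pairing.
by rewrite (valK p).
Qed.

Lemma pathB_ispath x s : ~~ is_path x s -> pathB x s = 0.
Proof. by move=> h; rewrite /pathB insubN. Qed.

Lemma pathBP x s : is_path x s ->
  exists p : qpath Q, [/\ psource p = x, parrows p = s & pathB x s = path_class p].
Proof. by move=> h; exists (exist _ (x, s) h); split=> //; rewrite -pathB_qpath. Qed.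

Lemma path_classM p q :
  path_class p * path_class q = if Defs.pcomp p q is Some r then path_class r else 0.
Proof.
rewrite /path_class -[LHS]quot_piM -[_ * _]/(path_mul _ _) path_mulUU /path_prod.
by case: (Defs.pcomp p q) => //; apply: quot_pi0.
Qed.

Lemma pathBM y t x s : pathB y t * pathB x s =
  if y == endpoint x s then pathB x (s ++ t) else 0.
Proof.
have [xs|xs] := boolP (is_path x s); last first.
  by rewrite (pathB_ispath xs) mulr0 pathB_ispath ?if_same // is_path_cat negb_and xs.
have [yt|yt] := boolP (is_path y t); last first.
  rewrite (pathB_ispath yt) mul0r; case: eqP => // e.
  by rewrite pathB_ispath // is_path_cat negb_and -e yt orbT.
have [p [px ps ->]] := pathBP xs; have [q [qy qt ->]] := pathBP yt.
rewrite path_classM -px -qy -ps -qt -/(ptarget p); case: pcompP => [r e1 e2 e3 e4|e].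
  by rewrite e1 eqxx -e2 -e3 pathB_qpath.
by rewrite eq_sym; case: eqP.
Qed.

Lemma pathB1 : 1 = \sum_x pathB x [::].
Proof.
rewrite -[LHS]/(quot_pi _ (path_one K Q)) /path_one.
rewrite quot_pi_sum.
by apply: eq_bigr => x _; symmetry; apply: (pathB_qpath (trivial_path x)).
Qed.

Lemma pathB0 x s : ~~ nonzero_path x s -> pathB x s = 0.
Proof.
have [xs|/pathB_ispath -> //] := boolP (is_path x s).
rewrite negb_and xs /= negbK => /asboolP [r Rr /infixP [u [v es]]].
move: xs; rewrite es is_path_cat is_path_cat => /and3P [_ h _].
have {}h : psource r = endpoint x u.
  have := relset_zero Rr; rewrite /zero_relation /plength.
  have := valP r; rewrite /is_qpath -/(psource r) -/(parrows r).
  by move: h; case: (parrows r) => //= a w /andP [/eqP <- _] /andP [/eqP <- _].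
have -> : pathB x (u ++ (parrows r ++ v)) =
    pathB (endpoint (endpoint x u) (parrows r)) v * path_class r * pathB x u.
  rewrite -pathB_qpath h !pathBM eqxx /= pathBM eqxx.
  by [].
rewrite (_ : path_class r = 0) ?mulr0 ?mul0r //.
rewrite /path_class -quot_pi0.
apply/quot_pi_eq; rewrite subr0; apply/mem_set => J [idJ XJ].
by apply: XJ; exists r.
Qed.

(** Read off a representative, whose choice does not matter by [coefB_pi]. *)
Definition coefB (x : vertex Q) (s : seq (arrow Q)) (b : B) : K^o :=
  if nonzero_path x s then
    if insub (x, s) is Some p then ((repr b : path_alg K Q) : {malg K[qpath Q]})@_p
    else 0
  else 0.

Lemma coefB_pi p (f : path_alg K Q) : nzq p ->
  coefB (psource p) (parrows p) (quot_pi _ f) = (f : {malg K[qpath Q]})@_p.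
Proof.
move=> np; rewrite /coefB -[nonzero_path _ _]/(nzq p) np.
rewrite /psource /parrows -surjective_pairing (valK p).
apply/eqP; rewrite -subr_eq0 -mcoeffB; apply/eqP.
have /set_mem/relation_zero_supported := quot_repr (Ideal
  (ideal_gen_two_sided (@path_elt K Q @` R)) (@relation_ideal_proper K Q R)) f.
by apply.
Qed.

Lemma coefB0 x s b : ~~ nonzero_path x s -> coefB x s b = 0.
Proof. by rewrite /coefB => /negPf ->. Qed.

Lemma coefBP x s : nonzero_path x s ->
  exists p : qpath Q, [/\ psource p = x, parrows p = s & nzq p].
Proof.
by move=> h; have /andP [h' _] := h; exists (exist _ (x, s) h').
Qed.

Lemma quot_repr_ex (b : B) : exists f, b = quot_pi _ f.
Proof. by exists (repr b); rewrite quot_piK. Qed.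

Lemma coefB_linear x s : linear (coefB x s).
Proof.
have [/coefBP [p [<- <- np]]|h] := boolP (nonzero_path x s); last first.
  by move=> k a b; rewrite !coefB0 // scaler0 addr0.
move=> k a b; have [f ->] := quot_repr_ex a; have [g ->] := quot_repr_ex b.
have -> : k *: quot_pi _ f + quot_pi _ g = quot_pi _ (k *: f + g) :> B.
  by rewrite quot_piD quot_piZ.
by rewrite !coefB_pi // path_coefP.
Qed.

HB.instance Definition _ x s :=
  GRing.isLinear.Build K B K^o *:%R (coefB x s) (coefB_linear x s).

Lemma coefB_comb x s k a b :
  coefB x s (k *: a + b) = k * coefB x s a + coefB x s b.
Proof. exact: coefB_linear. Qed.

Lemma coefB_pathB x s y t :
  coefB x s (pathB y t) = (nonzero_path x s && (x == y) && (s == t))%:R.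
Proof.
have [nz|nz] := boolP (nonzero_path x s); last by rewrite coefB0.
have [/pathBP [q [<- <- ->]]|nt] := boolP (is_path y t); last first.
  rewrite pathB_ispath // linear0.
  case: eqP => //= exy; case: eqP => //= est; move: nt; rewrite -exy -est.
  by case/andP: nz => ->.
have [p [<- <- np]] := coefBP nz.
by rewrite coefB_pi // path_eltE eq_sym.
Qed.

Lemma pathB_ind (P : B -> Prop) :
  P 0 -> (forall x s, nonzero_path x s -> P (pathB x s)) ->
  (forall k a b, P a -> P b -> P (k *: a + b)) -> forall b, P b.
Proof.
move=> P0 PU PD b; have [f ->] := quot_repr_ex b.
elim/path_alg_ind: f => [|p|k f g].
- by rewrite quot_pi0.
- rewrite -/(path_class p) -pathB_qpath.
  by case: (boolP (nzq p)) => [/PU //|/pathB0 ->].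
- by rewrite quot_piD quot_piZ => hf hg; apply: PD.
Qed.

Lemma coefB_eq0 b : (forall x s, coefB x s b = 0) -> b = 0.
Proof.
have [f ->] := quot_repr_ex b => h.
have {}h p : nzq p -> (f : {malg K[qpath Q]})@_p = 0.
  by move=> np; rewrite -coefB_pi.
rewrite [f]malg_linE.
rewrite quot_pi_sum big1 // => p _.
have [/h ->|/pathB0 np] := boolP (nzq p).
  by rewrite scale0r quot_pi0.
rewrite quot_piZ.
have -> : (<< p >> : path_alg K Q) = path_elt K p by rewrite path_elt.unlock.
rewrite -/(path_class p) -pathB_qpath np; exact: scaler0.
Qed.

End PathBasis.

(** * Forks *)

Section ArrowSequences.
Variables (V : eqType) (E : eqType) (src tgt : E -> V) (k : pred E) (Z : set (seq E)).

Definition composable : rel E := fun a b => tgt a == src b.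

Definition nonzero_seq (s : seq E) : bool :=
  [&& all k s, sorted composable s & ~~ `[< exists2 r, Z r & infix r s >]].

Definition terminal_seq b p : Prop :=
  nonzero_seq (b :: p) /\ forall c, ~~ nonzero_seq (rcons (b :: p) c).

(** The obstruction to the injective module at the end of a terminal path being
    projective: two nonzero paths into that vertex that are not parts of one
    another. Sequences of arrows in a set [k] are used instead of paths,
    because they are symmetric under reversal and restrict to subquivers. *)
Definition fork : Prop := exists a a' t b p,
  [/\ a != a', tgt a = tgt a', nonzero_seq (a :: t), nonzero_seq (a' :: t)
    & terminal_seq b p /\ tgt (last b p) = tgt (last a t)].

Lemma nonzero_seq_infix s t : infix s t -> nonzero_seq t -> nonzero_seq s.
Proof.
move=> st /and3P [kt ct /asboolPn nt]; apply/and3P; split.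
- by apply/allP => a /(mem_infix st) /(allP kt).
- exact: infix_sorted st ct.
- by apply/asboolPn => -[r Zr rs]; apply: nt; exists r => //; apply: infix_trans st.
Qed.

End ArrowSequences.

Lemma last_rev (T : Type) (x y : T) s : last x (rev (y :: s)) = y.
Proof. by rewrite rev_cons last_rcons. Qed.

Lemma nonzero_seq_rev (V E : eqType) (src tgt : E -> V) k (Z : set (seq E)) s :
  nonzero_seq tgt src k (rev @` Z)%classic s = nonzero_seq src tgt k Z (rev s).
Proof.
rewrite /nonzero_seq all_rev; congr [&& _, _ & ~~ _].
  rewrite rev_sorted; case: s => //= a s; apply: eq_path => x y.
  by rewrite /composable eq_sym.
apply/asbool_equiv_eq; split=> [[_ [r Zr <-] rs]|[r Zr rs]].
  by exists r => //; rewrite -[r]revK infix_rev.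
by exists (rev r); [exists r|rewrite -infix_rev revK].
Qed.

Definition cofork (V E : eqType) (src tgt : E -> V) k (Z : set (seq E)) : Prop :=
  fork tgt src k (rev @` Z)%classic.

Lemma coforkP (V E : eqType) (src tgt : E -> V) k (Z : set (seq E)) :
  cofork src tgt k Z <-> exists a a' t b p,
  [/\ a != a', src a = src a', nonzero_seq src tgt k Z (rcons t a),
      nonzero_seq src tgt k Z (rcons t a')
    & [/\ nonzero_seq src tgt k Z (rcons p b),
          forall c, ~~ nonzero_seq src tgt k Z (c :: rcons p b)
        & src (head b p) = src (head a t)]].
Proof.
have hd (x : E) s : last x (rev s) = head x s by case: s => // y s; rewrite last_rev.
split=> -[a [a' [t [b [p]]]]].
  rewrite /terminal_seq !nonzero_seq_rev !rev_cons => -[aa e h1 h2 [[h3 h4] h5]].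
  exists a, a', (rev t), b, (rev p); split=> //; split=> // [c|].
    by have := h4 c; rewrite nonzero_seq_rev rev_rcons rev_cons.
  by rewrite -!hd !revK.
move=> [aa e h1 h2 [h3 h4 h5]]; exists a, a', (rev t), b, (rev p).
rewrite /terminal_seq !nonzero_seq_rev !rev_cons !revK !hd.
by split=> //; split=> //; split=> // c; rewrite nonzero_seq_rev rev_rcons rev_cons revK.
Qed.

Section QuiverSequences.
Variables (Q : quiver) (R : zero_relations Q).
Local Notation endpoint x s := (last x (map (@target Q) s)).

Definition relation_seqs : set (seq (arrow Q)) := (@parrows Q @` (R : set _))%classic.

Local Notation nzs := (nonzero_seq (@source Q) (@target Q) predT relation_seqs).

Lemma is_path_cons x a s :
  is_path x (a :: s) =
    (source a == x) && sorted (composable (@source Q) (@target Q)) (a :: s).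
Proof.
rewrite /=; congr (_ && _); elim: s a => //= b s IH a.
by rewrite IH /composable eq_sym.
Qed.

Lemma nonzero_path_cons x a s :
  nonzero_path R x (a :: s) = (source a == x) && nzs (a :: s).
Proof.
rewrite /nonzero_path is_path_cons /nonzero_seq all_predT -andbA; congr [&& _, _ & ~~ _].
apply/asbool_equiv_eq; split=> [[r Rr h]|[_ [r Rr <-] h]]; last by exists r.
by exists (parrows r) => //; exists r.
Qed.

Lemma nonzero_path_rcons x a s :
  nonzero_path R x (rcons s a) = (source (head a s) == x) && nzs (rcons s a).
Proof. by case: s => [|b s]; rewrite nonzero_path_cons. Qed.

Lemma nonzero_seq1 a : nzs [:: a].
Proof.
apply/and3P; split=> //; apply/asboolPn => -[_ [r Rr <-]] /size_infix h.
by have := leq_trans (relset_zero Rr) h.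
Qed.

Lemma nonzero_path1 a : nonzero_path R (source a) [:: a].
Proof. by rewrite nonzero_path_cons eqxx nonzero_seq1. Qed.

Definition right_max x s : Prop :=
  nonzero_path R x s /\ forall c, ~~ nonzero_path R x (rcons s c).
Definition left_max x s : Prop :=
  nonzero_path R x s /\
  forall c, target c = x -> ~~ nonzero_path R (source c) (c :: s).

Variable N : nat.
Hypothesis bounded : forall (x : vertex Q) s, is_path x s -> (size s <= N)%N.

Lemma right_max_ext x s : nonzero_path R x s -> exists t, right_max x (s ++ t).
Proof.
move=> h; pose P n := `[< exists2 t, nonzero_path R x (s ++ t) & size t = n >].
have [||n /asboolP [t ht <-] tmax] := @ex_maxnP P N.
- by exists 0%N; apply/asboolP; exists [::]; rewrite ?cats0.
- move=> _ /asboolP [t /andP[/bounded ht _] <-].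
  by apply: leq_trans ht; rewrite size_cat leq_addl.
exists t; split=> // c; apply/negP => hc; have := tmax (size t).+1.
rewrite ltnn => /(_ _)/negP; apply=> //; apply/asboolP; exists (rcons t c).
  by rewrite -rcons_cat.
by rewrite size_rcons.
Qed.

Lemma endpoint_cat x s t : endpoint x (s ++ t) = endpoint (endpoint x s) t.
Proof. by rewrite map_cat last_cat. Qed.

Lemma left_max_ext x s : nonzero_path R x s ->
  exists z t, endpoint z t = x /\ left_max z (t ++ s).
Proof.
move=> h; pose P n := `[< exists z t,
  [/\ nonzero_path R z (t ++ s), endpoint z t = x & size t = n] >].
have [||n /asboolP [z [t [ht et <-]]] tmax] := @ex_maxnP P N.
- by exists 0%N; apply/asboolP; exists x, [::].
- move=> _ /asboolP [z [t [/andP[/bounded ht _] _ <-]]].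
  by apply: leq_trans ht; rewrite size_cat leq_addr.
exists z, t; split=> //; split=> // c ec; apply/negP => hc.
have := tmax (size t).+1; rewrite ltnn => /(_ _)/negP; apply=> //; apply/asboolP.
by exists (source c), (c :: t); split; rewrite //= ec.
Qed.

Lemma right_max_catl x s t : nonzero_path R x (s ++ t) ->
  right_max (endpoint x s) t -> right_max x (s ++ t).
Proof.
move=> h [_ ht]; split=> // c; apply/negP; rewrite rcons_cat => /nonzero_catr.
exact/negP.
Qed.

Lemma bimax_ext x s : nonzero_path R x s -> exists z g h,
  [/\ endpoint z g = x, right_max z (g ++ s ++ h) & left_max z (g ++ s ++ h)].
Proof.
move=> /right_max_ext [h rh]; have [z [g [eg lg]]] := left_max_ext (proj1 rh).
exists z, g, h; split=> //; apply: right_max_catl; first by case: lg.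
by rewrite eg.
Qed.

End QuiverSequences.

Lemma common_prefix (T : eqType) (s t : seq T) : exists p s' t',
  [/\ s = p ++ s', t = p ++ t' & [\/ s' = [::], t' = [::] |
    exists a b s1 t1, [/\ a != b, s' = a :: s1 & t' = b :: t1]]].
Proof.
elim: s t => [|a s IH] t; first by exists [::], [::], t; split=> //; constructor 1.
case: t => [|b t]; first by exists [::], (a :: s), [::]; split=> //; constructor 2.
have [->|ab] := eqVneq a b.
  by have [p [s' [t' [-> -> h]]]] := IH t; exists (b :: p), s', t'.
exists [::], (a :: s), (b :: t); split=> //; constructor 3.
by exists a, b, s, t.
Qed.

Lemma common_suffix (T : eqType) (s t : seq T) : exists p s' t',
  [/\ s = s' ++ p, t = t' ++ p & [\/ s' = [::], t' = [::] |
    exists a b s1 t1, [/\ a != b, s' = rcons s1 a & t' = rcons t1 b]]].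
Proof.
have [p [s' [t' [es et h]]]] := common_prefix (rev s) (rev t).
exists (rev p), (rev s'), (rev t'); rewrite -!rev_cat -es -et !revK; split=> //.
case: h => [->|->|[a [b [s1 [t1 [ab -> ->]]]]]];
  [constructor 1|constructor 2|constructor 3] => //.
by exists a, b, (rev s1), (rev t1); rewrite !rev_cons.
Qed.

Section NoFork.
Variables (Q : quiver) (R : zero_relations Q).
Local Notation endpoint x s := (last x (map (@target Q) s)).
Local Notation nzs := (nonzero_seq (@source Q) (@target Q) predT (relation_seqs R)).
Hypothesis no_fork : ~ fork (@source Q) (@target Q) predT (relation_seqs R).
Hypothesis no_cofork : ~ cofork (@source Q) (@target Q) predT (relation_seqs R).

Lemma endpoint_cons x a s : endpoint x (a :: s) = target (last a s).
Proof. by rewrite /= last_map. Qed.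

Lemma no_fork_path x y a a' s s' t b p :
  a != a' -> endpoint x (rcons s a) = endpoint y (rcons s' a') ->
  nonzero_path R x (rcons s a ++ t) -> nonzero_path R y (rcons s' a' ++ t) ->
  right_max R b p -> endpoint b p = endpoint x (rcons s a ++ t) -> False.
Proof.
rewrite !map_rcons !last_rcons !cat_rcons => aa e h1 h2 [h3 h4] h5; apply: no_fork.
have nza : nzs (a :: t).
  by have := nonzero_catr h1; rewrite nonzero_path_cons => /andP [].
have nza' : nzs (a' :: t).
  by have := nonzero_catr h2; rewrite nonzero_path_cons => /andP [].
case: p h3 h4 h5 => [|c p] h3 h4 h5.
  (* A trivial right maximal path sits at a sink, where the branches of the
     fork are themselves terminal. *)
  exists a, a', t, a, t; split=> //; split=> //; split=> // c; apply/negP => hc.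
  have := h4 c; rewrite nonzero_path_cons /= nonzero_seq1 andbT => /negP; apply.
  move: h5; rewrite endpoint_cat endpoint_cons /= => ->.
  case/and3P: hc => _ + _; rewrite -cats1 cat_cons /=  cat_path /=.
  by rewrite /composable => /and3P [_ /eqP -> _].
exists a, a', t, c, p; split=> //; split; last first.
  by move: h5; rewrite endpoint_cat !endpoint_cons.
move: h3; rewrite nonzero_path_cons => /andP [/eqP ec ?]; split=> // d.
by have := h4 d; rewrite /= nonzero_path_cons ec eqxx.
Qed.

Lemma no_cofork_path x a a' t s s' p : a != a' -> source a = source a' ->
  nonzero_path R x (t ++ a :: s) -> nonzero_path R x (t ++ a' :: s') ->
  left_max R x p -> False.
Proof.
rewrite -!cat_rcons => aa e /nonzero_catl h1 /nonzero_catl h2 [h3 h4].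
apply: no_cofork; apply/coforkP.
move: (h1) (h2); rewrite !nonzero_path_rcons => /andP [/eqP e1 nz1] /andP [/eqP e2 nz2].
case/lastP: p h3 h4 => [|p b] h3 h4.
  exists a, a', t, a, t; split=> //; split=> // c; apply/negP => hc.
  have := h4 c; rewrite nonzero_path1 => /(_ _)/negP; apply=> //.
  move: hc => /and3P [_ + _]; rewrite -e1.
  by case: (t) => [|d t'] /= /andP [/eqP ->].
exists a, a', t, b, p; move: h3; rewrite nonzero_path_rcons => /andP [/eqP eb nzb].
split=> //; split=> // [c|]; last by rewrite eb.
apply/negP => hc; have := h4 c; rewrite nonzero_path_cons eqxx hc => /(_ _)/negP.
apply=> //; case/and3P: hc => _ + _; rewrite -eb.
by case: (p) => [|d t'] /= /andP [/eqP ->].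
Qed.

(** Otherwise the two paths differ before their longest common final part, which
    makes a fork. With [bimax_prefix], this says that the indecomposable
    projective at the source of a bimaximal path is the indecomposable
    injective at its target. *)
Lemma bimax_suffix z q u w : right_max R z q -> left_max R z q ->
  nonzero_path R u w -> endpoint u w = endpoint z q ->
  exists2 g, q = g ++ w & endpoint z g = u.
Proof.
move=> rq lq nw e; have [t [q' [w' [eq ew h]]]] := common_suffix q w.
have hq : nonzero_path R z q by case: rq.
have sp v c r : nonzero_path R v (rcons r c ++ t) ->
    endpoint v (rcons r c) = (if t is d :: _ then source d else target c).
  move=> /nonzero_catr; case: t {eq ew} => [|d t]; first by rewrite map_rcons last_rcons.
  by rewrite nonzero_path_cons => /andP [/eqP ->].
have st v r : nonzero_path R v (r ++ t) -> endpoint v (r ++ t) = endpoint z q ->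
    endpoint v r = if t is d :: _ then source d else endpoint z q.
  case: t {eq ew sp} => [|d t]; first by rewrite cats0.
  by move=> /nonzero_catr; rewrite nonzero_path_cons => /andP [/eqP ->].
have ends : endpoint z q' = endpoint u w'.
  by rewrite (st z q') -?eq // (st u w') -?ew.
case: h => [q0|w0|[a [b [s1 [t1 [ab qa wb]]]]]]; last first.
- exfalso; apply: (@no_fork_path z u a b s1 t1 t z q) => //.
  + by rewrite -qa -wb.
  + by rewrite -qa -eq.
  + by rewrite -wb -ew.
  + by rewrite -qa -eq.
- by exists q'; rewrite ?ew ?w0 // ends w0.
case/lastP: w' ew ends => [|w' c] ew ends.
  by exists [::]; [rewrite eq ew q0|move: ends; rewrite q0].
have ez : target c = z.
  by move: ends; rewrite q0 /= map_rcons last_rcons.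
case/negP: (proj2 lq c ez); move: nw; rewrite eq q0 /= ew cat_rcons => /nonzero_catr.
by rewrite !nonzero_path_cons eqxx => /andP [].
Qed.

Lemma bimax_prefix z q w : right_max R z q -> left_max R z q ->
  nonzero_path R z w -> exists g, q = w ++ g.
Proof.
move=> rq lq nw; have [t [q' [w' [eq ew h]]]] := common_prefix q w.
have hq : nonzero_path R z q by case: rq.
case: h => [q0|w0|[a [b [s1 [t1 [ab qa wb]]]]]].
- case: w' ew => [|c w'] ew; first by exists [::]; rewrite eq ew q0 !cats0.
  have /negP := proj2 rq c; case; rewrite eq q0 cats0.
  by move: nw; rewrite ew -cat_rcons => /nonzero_catl.
- by exists q'; rewrite eq ew w0 cats0.
have sh c r : nonzero_path R z (t ++ c :: r) -> source c = endpoint z t.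
  by move=> /nonzero_catr; rewrite nonzero_path_cons => /andP [/eqP ->].
exfalso; apply: (@no_cofork_path z a b t s1 t1 q) => //.
- by rewrite (sh _ s1) -?qa -?eq // (sh _ t1) -?wb -?ew.
- by rewrite -qa -eq.
- by rewrite -wb -ew.
Qed.

End NoFork.

(** * Coefficients of products and functionals dual to paths *)

Section Coefficients.
Variables (K : fieldType) (Q : quiver) (R : zero_relations Q).
Local Notation B := (bound_quiver_alg K R).
Local Notation endpoint x s := (last x (map (@target Q) s)).
Local Notation pathB := (@pathB K Q R).
Local Notation coefB := (@coefB K Q R).
Implicit Types (x y z : vertex Q) (s t r : seq (arrow Q)) (h : B).

Lemma coef_lmul x s t h : nonzero_path R x (s ++ t) ->
  coefB x (s ++ t) (pathB (endpoint x s) t * h) = coefB x s h.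
Proof.
move=> nst; elim/pathB_ind: h => [|y r nr|k a b IH IH'].
- by rewrite mulr0 !linear0.
- rewrite pathBM [RHS]coefB_pathB (nonzero_catl nst) /=.
  case: eqP => e; last first.
    rewrite linear0; case: eqP => //= exy; case: eqP => //= esr.
    by case: e; rewrite exy esr.
  rewrite coefB_pathB nst /=; congr (_ && _)%:R.
  rewrite -[LHS](inj_eq (can_inj revK)) !rev_cat eqseq_cat // eqxx.
  by rewrite (inj_eq (can_inj revK)).
- by rewrite mulrDr -scalerAr !coefB_comb IH IH'.
Qed.

Lemma coef_lmul0 x r y t h : (forall s, r = s ++ t -> endpoint x s <> y) ->
  coefB x r (pathB y t * h) = 0.
Proof.
move=> nst; elim/pathB_ind: h => [|u w nr|k a b IH IH'].
- by rewrite mulr0 linear0.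
- rewrite pathBM; case: eqP => e; last by rewrite linear0.
  rewrite coefB_pathB; case: (nonzero_path _ _ _) => //=.
  case: eqP => //= exu; case: eqP => //= er.
  by case: (nst w er); rewrite e exu.
- by rewrite mulrDr -scalerAr coefB_comb IH IH' mulr0 addr0.
Qed.

Lemma coef_rmul x s t h : nonzero_path R x (s ++ t) ->
  coefB x (s ++ t) (h * pathB x s) = coefB (endpoint x s) t h.
Proof.
move=> nst; elim/pathB_ind: h => [|y r nr|k a b IH IH'].
- by rewrite mul0r !linear0.
- rewrite pathBM [RHS]coefB_pathB (nonzero_catr nst) /= eq_sym.
  case: eqP => e; last by rewrite linear0.
  by rewrite coefB_pathB nst eqxx eqseq_cat // eqxx.
- by rewrite mulrDl -scalerAl !coefB_comb IH IH'.
Qed.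

Lemma coef_rmul0 x r y s h : (x = y -> forall t, r <> s ++ t) ->
  coefB x r (h * pathB y s) = 0.
Proof.
move=> nst; elim/pathB_ind: h => [|u w nr|k a b IH IH'].
- by rewrite mul0r linear0.
- rewrite pathBM; case: eqP => e; last by rewrite linear0.
  rewrite coefB_pathB; case: (nonzero_path _ _ _) => //=.
  by case: eqP => //= exu; case: eqP => //= er; case: (nst exu w).
- by rewrite mulrDl -scalerAl coefB_comb IH IH' mulr0 addr0.
Qed.

Lemma coef_vertexM x (a b : B) :
  coefB x [::] (a * b) = coefB x [::] a * coefB x [::] b.
Proof.
elim/pathB_ind: b => [|y s ns|k b b' IH IH'].
- by rewrite mulr0 linear0 mulr0.
- rewrite coefB_pathB nonzero_nil /=; case: eqP => [<-|ne]; last first.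
    by rewrite mulr0 coef_rmul0.
  case: s {ns} => [|c s]; last by rewrite mulr0 coef_rmul0.
  by rewrite mulr1 -[[::]](cats0 [::]) coef_rmul ?nonzero_nil.
- by rewrite mulrDr -scalerAr !coefB_comb IH IH' mulrDr mulrCA.
Qed.

Lemma coef_vertex1 x : coefB x [::] 1 = 1.
Proof.
rewrite pathB1 linear_sum (bigD1 x) //= big1 => [|y nyx].
  by rewrite coefB_pathB nonzero_nil eqxx addr0.
by rewrite coefB_pathB eq_sym (negPf nyx) andbF.
Qed.

(** Paths act on these elements of [D(B)] by cancelling initial parts. *)
Definition coef_dual x s : coind B K^o := mk_coind (@coefB_linear K Q R x s).

Lemma coef_dual_path x s t : nonzero_path R x (s ++ t) ->
  pathB x s *: coef_dual x (s ++ t) = coef_dual (endpoint x s) t.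
Proof. by move=> h; apply: coind_ext => a; rewrite coindZE /= coef_rmul. Qed.

Lemma coef_dual_path0 x r y s : (x = y -> forall t, r <> s ++ t) ->
  pathB y s *: coef_dual x r = 0.
Proof. by move=> h; apply: coind_ext => a; rewrite coindZE /= coef_rmul0. Qed.

(** An element at [y] killed by all arrows spans a simple module, on which [B]
    acts by the character that reads the coefficient at [y]. *)
Lemma socle_scale (M : lmodType B) y (m : M) : pathB y [::] *: m = m ->
  (forall c, pathB (source c) [:: c] *: m = 0) ->
  forall a, a *: m = (coefB y [::] a : K)%:A *: m.
Proof.
move=> em cm a; elim/pathB_ind: a => [|x s ns|k a b IH IH'].
- by rewrite linear0 !scale0r.
- rewrite coefB_pathB nonzero_nil /=; case: s ns => [|c s] ns.
    rewrite andbT; case: eqP => [<-|ne]; first by rewrite !scale1r.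
    rewrite !scale0r -em scalerA pathBM; case: eqP => [e|]; last by rewrite scale0r.
    by case: ne; rewrite e.
  have -> : pathB x (c :: s) = pathB (target c) s * pathB (source c) [:: c].
    rewrite pathBM /= eqxx; move: ns; rewrite nonzero_path_cons.
    by move=> /andP [/eqP -> _].
  by rewrite -scalerA cm scaler0 andbF !scale0r.
- rewrite coefB_comb.
  exact: (@kscale_comb K B M k _ _ a b m IH IH').
Qed.

Lemma pathB_neq0 x s : nonzero_path R x s -> pathB x s != 0.
Proof.
move=> h; apply/eqP => /(congr1 (coefB x s)).
by rewrite coefB_pathB h !eqxx linear0 => /eqP; rewrite oner_eq0.
Qed.

Lemma coef_neq0 (b : B) : b != 0 -> exists x s, nonzero_path R x s /\ coefB x s b != 0.
Proof.
move=> /eqP b0; apply: contrapT => h; apply: b0; apply: coefB_eq0 => x s.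
have [ns|/coefB0 -> //] := boolP (nonzero_path R x s).
by apply/eqP/negPn/negP => h'; apply: h; exists x, s.
Qed.

Variable N : nat.
Hypothesis bounded : forall x s, is_path x s -> (size s <= N)%N.

(** Bounded sequences index the nonzero paths by a finite type. *)
Definition bpath : finType := (vertex Q * N.-bseq (arrow Q))%type.
Definition bsource (i : bpath) : vertex Q := i.1.
Definition barrows (i : bpath) : seq (arrow Q) := bseqval i.2.

Lemma bpath_of x s : nonzero_path R x s ->
  exists i : bpath, bsource i = x /\ barrows i = s.
Proof. by case/andP => /bounded h _; exists (x, Bseq h). Qed.

Lemma bpath_inj (i j : bpath) :
  bsource i = bsource j -> barrows i = barrows j -> i = j.
Proof.
case: i j => [x s] [y t]; rewrite /bsource /barrows /= => -> e.
by congr (_, _); apply: val_inj.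
Qed.

Lemma bound_finite_dim : finite_dim (B^o : lmodType B).
Proof.
pose c (b : B) : {ffun bpath -> K^o} := [ffun i => coefB (bsource i) (barrows i) b].
apply: (@finite_dim_inj K B (B^o : lmodType B) {ffun bpath -> K^o} c).
  move=> k a b; apply/ffunP => i; rewrite !ffunE -[_ *: a]/(_ * _ : B).
  by rewrite mulr_algl coefB_comb.
move=> a b /ffunP e; apply/eqP; rewrite -subr_eq0; apply/eqP/coefB_eq0 => x s.
have [/bpath_of [i [<- <-]]|/coefB0 -> //] := boolP (nonzero_path R x s).
by have := e i; rewrite !ffunE linearB /= => ->; apply: subrr.
Qed.

Lemma path_expand (b : B) :
  b = \sum_(i : bpath)
        (coefB (bsource i) (barrows i) b : K) *: pathB (bsource i) (barrows i).
Proof.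
apply/eqP; rewrite -subr_eq0; apply/eqP/coefB_eq0 => x s.
have [nz|/coefB0 -> //] := boolP (nonzero_path R x s).
have [i [ix is_]] := bpath_of nz.
rewrite linearB linear_sum (bigD1 i) //= big1 => [|j ij].
  rewrite addr0 linearZ /= coefB_pathB ix is_ nz !eqxx /= -[_ *: _]/(_ * _) mulr1.
  exact: subrr.
rewrite linearZ /= coefB_pathB nz /= (_ : _ && _ = false) ?scaler0 //.
by apply: contraNF ij => /andP [/eqP e1 /eqP e2]; apply/eqP/bpath_inj;
  rewrite ?ix ?is_.
Qed.

End Coefficients.

(** A character [delta] of [A] spans a simple submodule of [D(A)]; sending
    [delta] to [m] is a map from it to [E], which extends to [D(A)]. *)
Lemma character_extend (K : fieldType) (A : algType K) (E : lmodType A)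
    (delta : coind A K^o) (m : E) :
  finite_dim (A^o : lmodType A) -> finite_dim E -> injective_module E ->
  val delta 1 = 1 -> (forall a b, val delta (a * b) = val delta a * val delta b) ->
  (forall a, a *: m = (val delta a)%:A *: m) ->
  exists h : {linear (coind A K^o : lmodType A) -> E}, h delta = m.
Proof.
move=> fA fE iE d1 dM dm; pose D : lmodType A := coind A K^o.
have fD : finite_dim D by apply: coind_finite_dim.
pose S : {pred D} := fun phi => `[< exists k : K, phi = k%:A *: delta >].
have dZ a : a *: delta = (val delta a : K)%:A *: delta.
  apply: coind_ext => x; rewrite !coindZE dM -scalerAr mulr1 coind_valZ.
  exact: mulrC.
have SS : GRing.submod_closed S.
  split; first by apply/asboolP; exists 0; rewrite !scale0r.
  move=> a _ _ /asboolP [k ->] /asboolP [l ->]; apply/asboolP.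
  exists (k * val delta a + l); rewrite kscaleD kscaleM; congr (_ + _).
  by rewrite kscaleC dZ.
pose g (phi : submodule (mk_submod SS)) : E := (val (val phi) 1 : K)%:A *: m.
have gl : linear g.
  move=> a phi psi; rewrite /g -/(submod_incl _ _) linearP coindDE.
  rewrite kscaleD; congr (_ + _).
  have /asboolP [k ek] : val phi \in S := valP phi.
  rewrite -[submod_incl _ phi]/(val phi) ek.
  have dK l : val (l%:A *: delta) 1 = l.
    by rewrite coindZE mul1r coind_valZ d1 -[_ *: 1]/(_ * 1) mulr1.
  have -> : a *: (k%:A *: delta) = (k * val delta a)%:A *: delta.
    by rewrite kscaleC (dZ a) kscaleM.
  by rewrite !dK kscaleM -dm kscaleC.
have [h hP] := iE _ _ (submod_incl (mk_submod SS)) (mk_linear gl)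
  (submodule_finite_dim _ fD) fD val_inj.
have Sd : delta \in mk_submod SS by apply/asboolP; exists 1; rewrite kscale1.
exists h; have := hP (exist _ delta Sd); rewrite /= /g /= d1 kscale1.
by [].
Qed.

(** * Forks are excluded by a projective first term *)

Section Criterion.
Variables (K : fieldType) (Q : quiver) (R : zero_relations Q).
Local Notation B := (bound_quiver_alg K R).
Local Notation D := (coind B K^o : lmodType B).
Local Notation endpoint x s := (last x (map (@target Q) s)).
Local Notation pathB := (@pathB K Q R).
Local Notation coefB := (@coefB K Q R).
Local Notation coef_dual := (@coef_dual K Q R).
Variable N : nat.
Hypothesis bounded : forall (x : vertex Q) s, is_path x s -> (size s <= N)%N.

Let B_fd : finite_dim (B^o : lmodType B) := @bound_finite_dim K Q R N bounded.

(** Extend the inclusion of the simple module spanned by [m] from the socle of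
    [D(B)] to [D(B)], and separate [m] from 0 by a map to [B]. *)
Lemma socle_map (E : lmodType B) y (m : E) :
  finite_dim E -> injective_module E -> projective_module E -> m != 0 ->
  pathB y [::] *: m = m -> (forall c, pathB (source c) [:: c] *: m = 0) ->
  exists H : {linear D -> B^o}, H (coef_dual y [::]) != 0.
Proof.
move=> fE iE pE m0 ym cm.
have [h hy] := @character_extend K B E (coef_dual y [::]) m B_fd fE iE
  (coef_vertex1 K R y) (coef_vertexM y) (socle_scale ym cm).
have [f fm] := projective_separated B_fd fE pE m0.
by exists (f \o h); rewrite /= hy.
Qed.

Lemma linear_mul (H : {linear D -> B^o}) (a : B) phi : H (a *: phi) = a * H phi.
Proof. exact: (linearZ_LR H). Qed.

Lemma coef_lmulP x r y t (h : B) : coefB x r (pathB y t * h) != 0 ->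
  exists s, [/\ r = s ++ t, endpoint x s = y & coefB x s h != 0].
Proof.
move=> c0; have nr : nonzero_path R x r.
  by apply: contraNT c0 => /coefB0 ->.
have [s [es ey]] : exists s, r = s ++ t /\ endpoint x s = y.
  apply: contrapT => h0; case/eqP: c0; apply: coef_lmul0 => s es ey.
  by apply: h0; exists s.
by exists s; split=> //; move: c0; rewrite es -ey coef_lmul // -es.
Qed.

(** The image [b] of the functional dual to [t] is nonzero, as multiplying by [t]
    leads to [y]. It is also the product of either arrow with another element,
    so that every path occurring in [b] would end with both arrows. *)
Lemma socle_map_no_fork (H : {linear D -> B^o}) y a a' t :
  H (coef_dual y [::]) != 0 -> a != a' -> target a = target a' ->
  nonzero_path R (source a) (a :: t) -> nonzero_path R (source a') (a' :: t) ->
  endpoint (target a) t <> y.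
Proof.
move=> H0 aa e nza nza' ey; pose b : B := H (coef_dual (target a) t).
have b0 : b != 0.
  apply: contraNneq H0 => b0.
  have := coef_dual_path K (s := t) (t := [::]) (x := target a) (R := R).
  rewrite cats0 ey => <-; last by apply: (@nonzero_catr _ _ (source a) [:: a]).
  by rewrite linear_mul -/b b0 mulr0.
have last_arrow c : target c = target a -> nonzero_path R (source c) (c :: t) ->
    exists h, b = pathB (source c) [:: c] * h.
  move=> ec nzc; exists (H (coef_dual (source c) (c :: t))).
  by rewrite -linear_mul -[c :: t]cat1s coef_dual_path // /b /= ec.
have [h bh] := last_arrow a erefl nza.
have [h' bh'] := last_arrow a' (esym e) nza'.
have [x [s [_ cs]]] := coef_neq0 b0.
move: (cs) (cs); rewrite {1}bh bh' => /coef_lmulP [u [eu _ _]] /coef_lmulP [w [ew _ _]].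
move: ew; rewrite eu !cats1 => /rcons_inj [_ ea].
by rewrite ea eqxx in aa.
Qed.

(** Let [h] be the image of the functional dual to [s]. The product of [s] and [h]
    is nonzero, so [h] has a nonzero coefficient at [z], no nonzero path being
    a proper prolongation of [s] to the left. Hence the product of [w] and [h]
    is nonzero; but [w] kills the functional unless [s] starts with [w]. *)
Lemma socle_map_prefix (H : {linear D -> B^o}) z s w :
  H (coef_dual (endpoint z s) [::]) != 0 -> left_max R z s ->
  nonzero_path R z w -> exists g, s = w ++ g.
Proof.
move=> H0 [ns lm] nw; pose h : B := H (coef_dual z s).
have sh : pathB z s * h != 0.
  by rewrite -linear_mul -{2}[s]cats0 coef_dual_path ?cats0.
have [x [r [nr]]] := coef_neq0 sh.
move=> /coef_lmulP [u [eu ez cu]].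
have u0 : u = [::].
  case/lastP: u eu ez {cu} => // u c eu ez.
  have ec : target c = z by rewrite -ez map_rcons last_rcons.
  case/negP: (lm c ec); move: nr; rewrite eu cat_rcons => /nonzero_catr.
  by rewrite !nonzero_path_cons eqxx => /andP [].
rewrite u0 /= in ez cu; rewrite ez in cu.
apply: contrapT => nsw.
have /eqP : pathB z w * h = 0.
  by rewrite -linear_mul coef_dual_path0 ?linear0 // => _ g eg; apply: nsw; exists g.
apply/negP; apply: contraNneq cu => wh.
have := coef_lmul (x := z) (s := [::]) (t := w) h nw.
by rewrite /= wh linear0 => <-.
Qed.

Section FirstTermProjective.
Variables (E : lmodType B) (iota : {linear B^o -> E}).
Hypotheses (E_fd : finite_dim E) (E_inj : injective_module E).
Hypotheses (E_proj : projective_module E) (iota_inj : injective iota).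

Lemma right_max_socle_map x s : right_max R x s ->
  exists H : {linear D -> B^o}, H (coef_dual (endpoint x s) [::]) != 0.
Proof.
move=> [ns nc]; have iotaM (a b : B) : a *: iota b = iota (a * b).
  exact/esym/(linearZ_LR iota).
apply: (@socle_map E _ (iota (pathB x s))) => //.
- apply: contraNneq (pathB_neq0 K ns); rewrite -(linear0 iota) => /iota_inj ->.
  exact: eqxx.
- by rewrite iotaM pathBM eqxx cats0.
- move=> c; rewrite iotaM pathBM; case: eqP => _; last exact: linear0.
  by rewrite cats1 pathB0 ?linear0.
Qed.

Lemma projective_no_fork : ~ fork (@source Q) (@target Q) predT (relation_seqs R).
Proof.
case=> [a [a' [t [b [p [aa e nza nza' [[nzb nzc] ebt]]]]]]].
have [|H H0] := @right_max_socle_map (source b) (b :: p).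
  split; first by rewrite nonzero_path_cons eqxx.
  by move=> c; rewrite rcons_cons nonzero_path_cons eqxx /=; apply: nzc.
apply: (socle_map_no_fork (t := t) H0 aa e); rewrite ?nonzero_path_cons ?eqxx //.
by rewrite /= !last_map ebt.
Qed.

Lemma projective_no_cofork :
  ~ cofork (@source Q) (@target Q) predT (relation_seqs R).
Proof.
move=> /coforkP [a [a' [t [b [p [aa e nza nza' [nzb nzc eb]]]]]]].
pose z := source (head a t).
have nz c : source c = source a ->
    nonzero_seq (@source Q) (@target Q) predT (relation_seqs R) (rcons t c) ->
    nonzero_path R z (rcons t c).
  by move=> ec nc; rewrite nonzero_path_rcons nc andbT /z; case: (t) => //=; rewrite ec.
have nzp : nonzero_path R z (rcons p b) by rewrite nonzero_path_rcons nzb eb eqxx.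
have [u rs] := right_max_ext bounded nzp.
have [H H0] := right_max_socle_map rs.
have lm : left_max R z (rcons p b ++ u).
  split=> [|c _]; first by case: rs.
  apply/negP; rewrite -cat_cons => /nonzero_catl.
  by rewrite nonzero_path_cons eqxx; apply/negP/nzc.
have [g eg] := socle_map_prefix H0 lm (nz a erefl nza).
have [g' eg'] := socle_map_prefix H0 lm (nz a' (esym e) nza').
move: eg'; rewrite eg => /eqP; rewrite eqseq_cat ?size_rcons //.
move=> /andP [/eqP/rcons_inj[]].
by move=> ea; rewrite ea eqxx in aa.
Qed.

End FirstTermProjective.

Section TwoDiverging.
Hypothesis no_fork : ~ fork (@source Q) (@target Q) predT (relation_seqs R).
Hypothesis no_cofork : ~ cofork (@source Q) (@target Q) predT (relation_seqs R).

(** Prolong both arrows to right maximal paths. In the absence of forks neither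
    prolongation is an initial part of the other, so that they diverge. *)
Lemma joining_diverging (a a' : arrow Q) : a != a' -> target a = target a' ->
  exists b b' : arrow Q, b != b' /\ source b = source b'.
Proof.
move=> aa e.
have [t ra] := right_max_ext bounded (nonzero_path1 R a).
have [t' ra'] := right_max_ext bounded (nonzero_path1 R a').
have [p [s [s' [et et' h]]]] := common_prefix t t'.
have nzs c w : nonzero_path R (source c) ([:: c] ++ w) ->
    nonzero_seq (@source Q) (@target Q) predT (relation_seqs R) (c :: w).
  by rewrite nonzero_path_cons => /andP [].
have term c w : right_max R (source c) ([:: c] ++ w) ->
    terminal_seq (@source Q) (@target Q) predT (relation_seqs R) c w.
  move=> [/nzs nc nd]; split=> // d; apply/negP => hd; case/negP: (nd d).
  by rewrite /= nonzero_path_cons eqxx.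
have prefix_nz c w w' : nonzero_path R (source c) ([:: c] ++ (w ++ w')) ->
    nonzero_seq (@source Q) (@target Q) predT (relation_seqs R) (c :: w).
  by rewrite catA => /nonzero_catl /nzs.
have lastE (c d : arrow Q) w : target c = target d ->
    target (last c w) = target (last d w) by case: w.
case: h => [s0|s0|[b [b' [s1 [s1' [bb es es']]]]]].
- case: no_fork; exists a, a', t, a, t; split=> //.
  + exact: nzs (proj1 ra).
  + apply: (prefix_nz _ _ s').
    by rewrite et s0 cats0 -et'; case: ra'.
  + by split=> //; apply: term.
- case: no_fork; exists a, a', t', a', t'; split=> //.
  + apply: (prefix_nz _ _ s).
    by rewrite et' s0 cats0 -et; case: ra.
  + exact: nzs (proj1 ra').
  + by split; [apply: term|rewrite (lastE a' a)].
exists b, b'; split=> //.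
have sh c d w w' : nonzero_path R (source c) ([:: c] ++ (w ++ d :: w')) ->
    source d = endpoint (target c) w.
  by move=> /nonzero_catr/nonzero_catr; rewrite nonzero_path_cons => /andP [/eqP ->].
have := proj1 ra; rewrite et es => /sh ->.
by have := proj1 ra'; rewrite et' es' => /sh ->; rewrite e.
Qed.

(** Take bimaximal paths through the two arrows. If their parts before the common
    source were comparable, then one of the bimaximal paths would start at the
    same vertex as a nonzero path through the other arrow, against
    [bimax_prefix]. *)
Lemma diverging_joining (b b' : arrow Q) : b != b' -> source b = source b' ->
  exists (a a' : arrow Q) t, [/\ a != a', target a = target a',
    nonzero_path R (source a) (a :: t), nonzero_path R (source a') (a' :: t)
    & endpoint (target a) t = source b].
Proof.
move=> bb e.
have [z [g [h [eg rg lg]]]] := bimax_ext bounded (nonzero_path1 R b).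
have [z' [g' [h' [eg' rg' lg']]]] := bimax_ext bounded (nonzero_path1 R b').
have [t [s [s' [et et' hs]]]] := common_suffix g g'.
have ends : endpoint z s = endpoint z' s'.
  have sh v r c w : nonzero_path R v ((r ++ t) ++ c ++ w) ->
      endpoint v (r ++ t) = source b ->
      endpoint v r = if t is d :: _ then source d else source b.
    move=> /nonzero_catl; case: (t) => [|d t1]; first by rewrite cats0.
    by move=> /nonzero_catr; rewrite nonzero_path_cons => /andP [/eqP ->].
  have := proj1 rg; have := proj1 rg'.
  rewrite {1}et {1}et' => /sh -> //; last by rewrite -et' eg' -e.
  by move=> /sh -> //; rewrite -et.
have clash x y c d r u w : c != d -> endpoint y u = x ->
    right_max R x (r ++ [:: c] ++ w) -> left_max R x (r ++ [:: c] ++ w) ->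
    forall w', nonzero_path R y ((u ++ r) ++ [:: d] ++ w') -> False.
  move=> cd ux rm lm w'; rewrite -!catA => /nonzero_catr; rewrite ux catA.
  move=> /nonzero_catl nd; have [k] := bimax_prefix no_cofork rm lm nd.
  move/eqP; rewrite -catA eqseq_cat // eqxx /= eqseq_cons => /andP [/eqP ecd _].
  by rewrite ecd eqxx in cd.
case: hs => [s0|s0|[a [a' [s1 [s1' [aa es es']]]]]].
- exfalso; rewrite s0 /= in et ends; rewrite -et in et'.
  apply: (clash z z' b b' g s' h bb (esym ends) rg lg h').
  by rewrite -et'; case: rg'.
- exfalso; rewrite s0 /= in et' ends; rewrite -et' in et.
  apply: (clash z' z b' b g' s h' _ ends rg' lg' h); first by rewrite eq_sym.
  by rewrite -et; case: rg.
have nz v r c w : nonzero_path R v ((rcons r c ++ t) ++ w) ->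
    nonzero_path R (source c) (c :: t).
  move=> /nonzero_catl; rewrite cat_rcons => /nonzero_catr.
  by rewrite !nonzero_path_cons eqxx => /andP [].
exists a, a', t; split=> //.
- by move: ends; rewrite es es' !map_rcons !last_rcons.
- by have := proj1 rg; rewrite et es => /nz.
- by have := proj1 rg'; rewrite et' es' => /nz.
- by rewrite -eg et es endpoint_cat map_rcons last_rcons.
Qed.

End TwoDiverging.
End Criterion.

(** * The second term is not projective *)

Section SecondTerm.
Variables (K : fieldType) (Q : quiver) (R : zero_relations Q).
Local Notation B := (bound_quiver_alg K R).
Local Notation D := (coind B K^o : lmodType B).
Local Notation endpoint x s := (last x (map (@target Q) s)).
Local Notation pathB := (@pathB K Q R).
Local Notation coefB := (@coefB K Q R).
Local Notation coef_dual := (@coef_dual K Q R).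
Variable N : nat.
Hypothesis bounded : forall (x : vertex Q) s, is_path x s -> (size s <= N)%N.

Let B_fd : finite_dim (B^o : lmodType B) := @bound_finite_dim K Q R N bounded.

Local Notation bpath := (bpath Q N).

Definition starting_part (c : arrow Q) (b : B) : B :=
  \sum_(i : bpath | ohead (barrows i) == Some c)
    (coefB (bsource i) (barrows i) b : K) *: pathB (bsource i) (barrows i).

Lemma coef_starting_part c b x s :
  coefB x s (starting_part c b) = if ohead s == Some c then coefB x s b else 0.
Proof.
have [nz|nz] := boolP (nonzero_path R x s); last by rewrite !coefB0 ?if_same.
have coefi (i : bpath) : coefB x s
    ((coefB (bsource i) (barrows i) b : K) *: pathB (bsource i) (barrows i)) =
    if (x == bsource i) && (s == barrows i) then coefB x s b else 0.
  rewrite linearZ /= coefB_pathB nz /= -[_ *: _]/(_ * _).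
  case: eqP => [<-|_]; last by rewrite mulr0.
  by case: eqP => [<-|_]; rewrite ?mulr0 ?mulr1.
have [i [ix is_]] := bpath_of bounded nz.
rewrite linear_sum /=; case: eqP => hs.
  have hi : ohead (barrows i) == Some c by rewrite is_ hs.
  rewrite (bigD1 i hi) /= big1 => [|j /andP [_ ij]].
    by rewrite coefi ix is_ !eqxx addr0.
  rewrite coefi; case: eqP => //= e1; case: eqP => //= e2.
  by case/eqP: ij; apply: bpath_inj; rewrite ?ix ?is_.
rewrite big1 // => j /eqP hj; rewrite coefi; case: (_ == _) => //=.
by case: eqP => // e; case: hs; rewrite e.
Qed.

Definition radical : {pred B^o} := fun b => `[< forall x, coefB x [::] b = 0 >].

Lemma radical_submod : GRing.submod_closed radical.
Proof.
split; first by apply/asboolP => x; rewrite linear0.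
move=> a b c /asboolP hb /asboolP hc; apply/asboolP => x.
rewrite -[a *: b]/(a * b : B) linearD /= coef_vertexM hb hc mulr0.
exact: addr0.
Qed.

(** Multiplying on the left does not change the first arrow of a nontrivial
    path, so that taking this component is linear on the radical. *)
Lemma starting_part_mul c a b : b \in radical ->
  starting_part c (a * b) = a * starting_part c b.
Proof.
move=> /asboolP b0; apply/eqP; rewrite -subr_eq0; apply/eqP/coefB_eq0 => x r.
rewrite linearB /= coef_starting_part.
elim/pathB_ind: a => [|y t nt|k a a' IH IH'].
- by rewrite !mul0r linear0 if_same; apply: subrr.
- have [/existsP [i /andP [/eqP er /eqP ey]]|/existsPn nos] :=
      boolP [exists i : 'I_(size r).+1, (r == take i r ++ t) && (endpoint x (take i r) == y)]; last first.
    have nos' s : r = s ++ t -> endpoint x s <> y.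
      move=> er ey; have ls : (size s < (size r).+1)%N.
        by rewrite er size_cat ltnS leq_addr.
      have /negP := nos (Ordinal ls); apply.
      have es : take (size s) r = s by rewrite er take_size_cat.
      by rewrite /= es -er eqxx ey eqxx.
    by rewrite !coef_lmul0 ?if_same ?subrr.
  have [nr|nr] := boolP (nonzero_path R x r); last by rewrite !coefB0 ?if_same ?subrr.
  move: nr; set s := take i r in er ey; rewrite er -ey => nr.
  rewrite !coef_lmul // coef_starting_part.
  case: (s) => [|d s'] /=; last by rewrite subrr.
  by rewrite b0 if_same subr0.
- have cm (w : B) : (k *: a + a') * w = k *: (a * w) + a' * w.
    by rewrite mulrDl -scalerAl.
  rewrite !cm !coefB_comb.
  move/eqP: IH; rewrite subr_eq0 => /eqP <-; move/eqP: IH'; rewrite subr_eq0 => /eqP <-.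
  by case: ifP => _; rewrite ?mulr0 ?addr0 subrr.
Qed.

Lemma dom_dim_ge1_no_fork : dom_dim_ge (B^o : lmodType B) 1 ->
  ~ fork (@source Q) (@target Q) predT (relation_seqs R) /\
  ~ cofork (@source Q) (@target Q) predT (relation_seqs R).
Proof.
move=> [I /(_ 0%N isT) pI]; split.
- apply: (@projective_no_fork K Q R N bounded (mir_term I 0) (mir_aug I)) => //.
  + exact: mir_finite_dim.
  + exact: mir_injective.
  + exact: mir_exact_aug.
- apply: (@projective_no_cofork K Q R N bounded (mir_term I 0) (mir_aug I)) => //.
  + exact: mir_finite_dim.
  + exact: mir_injective.
  + exact: mir_exact_aug.
Qed.

(** The map [radical -> B -> E] given by the paths starting with [b] extends to
    [B]; let [x] in the first term [E] be the image of the idempotent at the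
    source of [b]. Then [b] acts on [x] as on [B] and [b'] by zero, hence [x]
    is not in [B]: its coefficient at that vertex would have to be both 1 and
    0. All arrows send [x] into [B], so that its image in the second term is a
    nonzero socle element, and [diverging_joining] contradicts
    [socle_map_no_fork] if the second term is projective. *)
Lemma not_dom_dim_ge2 (b b' : arrow Q) : b != b' -> source b = source b' ->
  ~ dom_dim_ge (B^o : lmodType B) 2.
Proof.
move=> bb e ge2; have [nf ncf] := dom_dim_ge1_no_fork (dom_dim_ge_le (leqnSn 1) ge2).
have [I pI] := ge2.
have [a [a' [t [aa ea na na' et]]]] := diverging_joining bounded ncf bb e.
pose iota : {linear B^o -> mir_term I 0} := mir_aug I.
have iotaM (u w : B) : u *: iota w = iota (u * w) by exact/esym/(linearZ_LR iota).
pose g0 (u : submodule (mk_submod radical_submod)) := iota (starting_part b (val u)).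
have g0l : linear g0.
  move=> u v w; rewrite /g0 -/(submod_incl _ _) linearP.
  rewrite -[u *: submod_incl _ v]/(u * val v : B).
  have spD (x y : B) : starting_part b (x + y) = starting_part b x + starting_part b y.
    rewrite -big_split; apply: eq_bigr => i _ /=.
    by rewrite linearD scalerDl.
  by rewrite spD starting_part_mul ?(valP v) // linearD -iotaM.
have [h hP] := @mir_injective _ _ _ I 0 _ _ (submod_incl (mk_submod radical_submod))
  (mk_linear g0l) (submodule_finite_dim _ B_fd) B_fd val_inj.
pose x := h (pathB (source b) [::]).
have hM (u w : B) : u *: h w = h (u * w) by exact/esym/(linearZ_LR h).
have arrow_x c : pathB (source c) [:: c] *: x =
    if c == b then iota (pathB (source b) [:: b]) else 0.
  rewrite hM pathBM /=; case: eqP => [ec|nec]; last first.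
    by case: eqP nec => [->|_] // _; apply: linear0.
  have rc : (pathB (source b) [:: c] : B^o) \in mk_submod radical_submod.
    by apply/asboolP => y; rewrite coefB_pathB andbF.
  have := hP (exist (fun u => u \in mk_submod radical_submod) _ rc).
  rewrite /= => ->; rewrite /g0 /=.
  rewrite (_ : starting_part b _ = if c == b then pathB (source b) [:: b] else 0).
    by case: eqP => // _; apply: linear0.
  apply/eqP; rewrite -subr_eq0; apply/eqP/coefB_eq0 => y s.
  rewrite linearB /= coef_starting_part coefB_pathB.
  case: (eqVneq c b) => [->|ncb]; last first.
    rewrite linear0 subr0; case: eqP => // hs; case: s hs => // d s [->].
    by rewrite eqseq_cons [b == c]eq_sym (negPf ncb) andbF.
  rewrite coefB_pathB; case: eqP => hs; rewrite ?subrr //.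
  by case: (s =P [:: b]) hs => [-> //|_ _]; rewrite andbF subrr.
pose m := mir_diff I 0 x.
have [||c|H H0] := @socle_map K Q R N bounded _ (source b) m (mir_finite_dim I 1)
  (@mir_injective _ _ _ I 1) (pI 1%N isT).
- apply/eqP => /mir_exact0 [u ux].
  have co c : source c = source b ->
      coefB (source b) [:: c] (pathB (source c) [:: c] * u) = coefB (source b) [::] u.
    move=> ec; rewrite ec -[[:: c]]cat0s.
    by apply: (coef_lmul (x := source b) (s := [::])); rewrite /= -ec nonzero_path1.
  have := arrow_x b; have := arrow_x b'.
  rewrite -ux !iotaM eqxx eq_sym (negPf bb) => e0 /(mir_exact_aug (m := I)) e1.
  have {}e0 : pathB (source b') [:: b'] * u = 0.
    by apply: (mir_exact_aug (m := I)); rewrite linear0.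
  have := co b erefl; rewrite e1 coefB_pathB nonzero_path1 !eqxx /= => c1.
  have := co b' (esym e); rewrite e0 linear0 -c1 => /eqP.
  by rewrite eq_sym oner_eq0.
- by rewrite -linearZ hM pathBM eqxx.
- rewrite -linearZ arrow_x; apply/mir_exact0.
  by case: eqP => _; [exists (pathB (source b) [:: b])|exists 0; apply: linear0].
- exact: (socle_map_no_fork H0 aa ea na na' et).
Qed.

End SecondTerm.

(** * Without forks the first term is projective *)

(** If [a |-> a lambda] identifies the projective module [A e] with the direct
    summand [D(e' A)] of [D(A)], then [A e] is injective as well, and its power
    contains [A] when right multiplications map [A] jointly injectively to it. *)
Section IdempotentIdeal.
Variables (K : fieldType) (A : algType K) (e e' : A) (lambda : coind A K^o).
Hypothesis A_fd : finite_dim (A^o : lmodType A).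
Hypothesis ee : e * e = e.
Hypothesis lambda_inj : forall a, a * e = a ->
  (forall x, val lambda (x * a) = 0) -> a = 0.
Hypothesis lambda_onto : forall phi : coind A K^o, exists a : A, a * e = a /\
  forall x, val phi (e' * x) = val lambda (x * a).
Hypothesis lambda_supp : forall x, val lambda (e' * x) = val lambda x.
Local Notation D := (coind A K^o : lmodType A).

Let e_fixed : {pred A^o} := fun a => (a : A) * e == a.

Let e_fixed_submod : GRing.submod_closed e_fixed.
Proof.
split; first by rewrite /e_fixed -topredE /= mul0r.
move=> a b c /eqP eb /eqP ec; apply/eqP.
by rewrite -[a *: b]/(a * b : A) mulrDl -mulrA eb ec.
Qed.

Let Ae : lmodType A := submodule (mk_submod e_fixed_submod).
Let incl : {linear Ae -> A^o} := submod_incl (mk_submod e_fixed_submod).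

Let inclE (x : Ae) : (incl x : A) * e = incl x.
Proof. by apply/eqP; have := valP x. Qed.

Let retract : exists r : {linear A^o -> Ae},
  cancel incl r /\ forall b : A, incl (r b) = b * e.
Proof.
have fl : linear (fun b : A^o => (b * e : A) : A^o).
  by move=> a b c; rewrite mulrDl -[a *: b]/(a * b : A) -mulrA.
have [|r rP] := @submod_lift K A _ _ (mk_submod e_fixed_submod) (mk_linear fl).
  by move=> b; apply/eqP; rewrite /= -mulrA ee.
by exists r; split=> // x; apply: val_inj; rewrite rP; apply: inclE.
Qed.

Let Ae_projective : projective_module Ae.
Proof.
by have [r [rK _]] := retract; apply: (projective_retract rK); apply: regular_projective.
Qed.

Let Ae_injective : injective_module Ae.
Proof.
have tl : linear (fun a : Ae => ((incl a : A) *: lambda : D)).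
  by move=> b x y; rewrite linearD linearZ scalerDl scalerA.
pose theta : {linear Ae -> D} := mk_linear tl.
have thetaE a x : val (theta a) x = val lambda (x * (incl a : A)) by [].
have theta_inj : injective theta.
  move=> x y exy; apply/eqP; rewrite -subr_eq0; apply/eqP/val_inj.
  apply: lambda_inj; first exact: (inclE (x - y)).
  by move=> w; rewrite -[val (x - y)]/(incl (x - y)) -thetaE linearB exy subrr.
have /choice [rho rhoP] : forall phi : D, exists a : Ae,
    forall x, val phi (e' * x) = val (theta a) x.
  move=> phi; have [a [ae aP]] := lambda_onto phi.
  have ha : a \in mk_submod e_fixed_submod by apply/eqP.
  by exists (exist (fun u => u \in mk_submod e_fixed_submod) a ha).
have rl : linear rho.
  move=> a phi psi; apply: theta_inj; apply: coind_ext => x.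
  rewrite -rhoP linearD linearZ_LR !coindDE !coindZE.
  by rewrite -!thetaE -!rhoP mulrA.
apply: (@injective_retract K A D Ae theta (mk_linear rl)); last exact: coind_injective.
move=> a; apply: theta_inj; apply: coind_ext => x; rewrite -rhoP !thetaE.
by rewrite -mulrA lambda_supp.
Qed.

Lemma idempotent_dom_dim_ge1 (I : finType) (g : I -> A) :
  (forall b, (forall i, b * g i * e = 0) -> b = 0) ->
  dom_dim_ge (A^o : lmodType A) 1.
Proof.
move=> g_inj; have [r [rK rP]] := retract.
have ml i : linear (fun b : A^o => (b * g i : A) : A^o).
  by move=> a b c; rewrite mulrDl -[a *: b]/(a * b : A) -mulrA.
have [j jP] := power_map (fun i => r \o mk_linear (ml i)).
apply: (@dom_dim_ge1 K A A^o _ j) => //.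
- exact/power_finite_dim/submodule_finite_dim.
- exact: power_injective.
- exact: power_projective.
move=> b c ebc; apply/eqP; rewrite -subr_eq0; apply/eqP/g_inj => i.
have : j (b - c) i = 0 by rewrite linearB ebc subrr ffunE.
by rewrite jP /= -rP => ->; rewrite linear0.
Qed.

End IdempotentIdeal.

Section ProjectiveInjective.
Variables (K : fieldType) (Q : quiver) (R : zero_relations Q).
Local Notation B := (bound_quiver_alg K R).
Local Notation D := (coind B K^o : lmodType B).
Local Notation endpoint x s := (last x (map (@target Q) s)).
Local Notation pathB := (@pathB K Q R).
Local Notation coefB := (@coefB K Q R).
Local Notation coef_dual := (@coef_dual K Q R).
Variable N : nat.
Hypothesis bounded : forall (x : vertex Q) s, is_path x s -> (size s <= N)%N.
Hypothesis no_fork : ~ fork (@source Q) (@target Q) predT (relation_seqs R).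
Hypothesis no_cofork : ~ cofork (@source Q) (@target Q) predT (relation_seqs R).

Let B_fd : finite_dim (B^o : lmodType B) := @bound_finite_dim K Q R N bounded.

Local Notation bpath := (bpath Q N).

Definition bimax z q : Prop := right_max R z q /\ left_max R z q.

Lemma bimax_source_inj z q q' : bimax z q -> bimax z q' -> q = q'.
Proof.
move=> [rq lq] [rq' lq'].
have [g eg] := bimax_prefix no_cofork rq lq (proj1 rq').
have [g' eg'] := bimax_prefix no_cofork rq' lq' (proj1 rq).
have := congr1 size eg; have := congr1 size eg'; rewrite !size_cat => e1 e2.
have /size0nil g0 : size g = 0%N by lia.
by rewrite eg g0 cats0.
Qed.

Lemma bimax_target_inj z q z' q' : bimax z q -> bimax z' q' ->
  endpoint z q = endpoint z' q' -> z = z' /\ q = q'.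
Proof.
move=> [rq lq] [rq' lq'] e.
have [g eg ez] := bimax_suffix no_fork rq lq (proj1 rq') (esym e).
case/lastP: g eg ez => [|g c] eg ez; first by split.
have ec : target c = z' by rewrite -ez map_rcons last_rcons.
case/negP: (proj2 lq' c ec); have := proj1 rq; rewrite eg cat_rcons => /nonzero_catr.
by rewrite !nonzero_path_cons eqxx => /andP [].
Qed.

Definition bimax_source z : bool := `[< exists q, bimax z q >].
Definition bimax_target y : bool := `[< exists z q, bimax z q /\ endpoint z q = y >].
Definition bimax_path (i : bpath) : bool := `[< bimax (bsource i) (barrows i) >].

Definition source_idem : B := \sum_(z | bimax_source z) pathB z [::].
Definition target_idem : B := \sum_(y | bimax_target y) pathB y [::].

(** Every nonzero path [s] from the source of a bimaximal path sends this
    functional to the one dual to the rest of that path after [s]. *)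
Definition bimax_dual : D :=
  \sum_(i : bpath | bimax_path i) coef_dual (bsource i) (barrows i).

Lemma bimax_dualE (a : B) : val bimax_dual a =
  \sum_(i : bpath | bimax_path i) coefB (bsource i) (barrows i) a.
Proof.
rewrite /bimax_dual; elim/big_rec2: _ => [|i y phi _ <-] //.
Qed.

Lemma coef_source_idem x s (a : B) :
  coefB x s (a * source_idem) = if bimax_source x then coefB x s a else 0.
Proof.
have [nz|nz] := boolP (nonzero_path R x s); last by rewrite !coefB0 ?if_same.
rewrite mulr_sumr linear_sum /=; case: ifP => Zx; last first.
  rewrite big1 // => z Zz; apply: coef_rmul0 => xz.
  by rewrite xz Zz in Zx.
rewrite (bigD1 x) //= big1 ?addr0 => [|z /andP [_ zx]].
  exact: (coef_rmul (s := [::]) a nz).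
by apply: coef_rmul0 => xz; rewrite xz eqxx in zx.
Qed.

Lemma coef_target_idem x s (a : B) : coefB x s (target_idem * a) =
  if bimax_target (endpoint x s) then coefB x s a else 0.
Proof.
have [nz|nz] := boolP (nonzero_path R x s); last by rewrite !coefB0 ?if_same.
rewrite mulr_suml linear_sum /=; case: ifP => Zx; last first.
  rewrite big1 // => z Zz; apply: coef_lmul0 => s'; rewrite cats0 => es ez.
  by rewrite es ez Zz in Zx.
rewrite (bigD1 (endpoint x s)) //= big1 ?addr0 => [|z /andP [_ zx]].
  have := coef_lmul (x := x) (s := s) (t := [::]) a; rewrite cats0; exact.
by apply: coef_lmul0 => s'; rewrite cats0 => es ez; rewrite es ez eqxx in zx.
Qed.

Lemma source_idem_path z q g : bimax z q -> pathB z g * source_idem = pathB z g.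
Proof.
move=> bq; apply/eqP; rewrite -subr_eq0; apply/eqP/coefB_eq0 => x s.
rewrite linearB /= coef_source_idem; case: ifP => Zx; first exact: subrr.
rewrite coefB_pathB; case: eqP => [xz|]; last by rewrite andbF subrr.
by case/asboolP: Zx; exists q; rewrite xz.
Qed.

Lemma source_idem_idem : source_idem * source_idem = source_idem.
Proof.
apply/eqP; rewrite -subr_eq0; apply/eqP/coefB_eq0 => x s.
rewrite linearB /= coef_source_idem; case: ifP => Zx; first exact: subrr.
by rewrite -[source_idem]mul1r coef_source_idem Zx subrr.
Qed.

(** A path occurring in [a] starts a bimaximal path, and the remaining part [g] of
    the latter is such that [bimax_dual] reads the coefficient of [a] at that
    path off the product of [g] and [a]; no other bimaximal path interferes,
    because it would have the same end. *)
Lemma bimax_dual_inj (a : B) : a * source_idem = a ->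
  (forall x, val bimax_dual (x * a) = 0) -> a = 0.
Proof.
move=> ae a0; apply/eqP/negPn/negP => /coef_neq0 [x [s [ns cs]]].
have /asboolP [q [rq lq]] : bimax_source x.
  by apply: contraNT cs => Zx; rewrite -ae coef_source_idem (negPf Zx).
have [g eg] := bimax_prefix no_cofork rq lq ns.
have [i [ix iq]] := bpath_of bounded (proj1 rq).
have := a0 (pathB (endpoint x s) g); rewrite bimax_dualE.
rewrite (bigD1 i) /=; last by rewrite /bimax_path ix iq; apply/asboolP.
rewrite ix iq eg coef_lmul -?eg ?(proj1 rq) // big1 => [|j /andP [/asboolP bj ij]].
  by rewrite addr0 => c0; rewrite c0 eqxx in cs.
apply: coef_lmul0 => w ew ewx.
have [xz qw] : x = bsource j /\ q = barrows j.
  apply: (bimax_target_inj (conj rq lq) bj).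
  by rewrite eg ew !endpoint_cat ewx.
by case/eqP: ij; apply: bpath_inj; rewrite ?ix ?iq.
Qed.

(** By linearity it is enough to treat the functionals dual to the paths that end
    where some bimaximal path does. Such a path is a final part of that
    bimaximal path, and its functional is the product of the complementary
    initial part with [bimax_dual]. *)
Lemma bimax_dual_onto (phi : D) : exists a : B, a * source_idem = a /\
  forall x, val phi (target_idem * x) = val bimax_dual (x * a).
Proof.
have each (i : bpath) : exists a : B, a * source_idem = a /\
    forall x, coefB (bsource i) (barrows i) (target_idem * x) = val bimax_dual (x * a).
  have [nz|nz] := boolP (nonzero_path R (bsource i) (barrows i)); last first.
    exists 0; rewrite mul0r; split=> // x; rewrite mulr0 coefB0 // bimax_dualE big1 //.
    by move=> j _; apply: linear0.
  have [/asboolP [z [q [[rq lq] ei]]]|Yi] :=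
    boolP (bimax_target (endpoint (bsource i) (barrows i))); last first.
    exists 0; rewrite mul0r; split=> // x; rewrite mulr0 coef_target_idem (negPf Yi).
    by rewrite bimax_dualE big1 // => j _; apply: linear0.
  have [g eg ez] := bimax_suffix no_fork rq lq nz (esym ei).
  exists (pathB z g); split=> [|x]; first exact: (source_idem_path _ (conj rq lq)).
  rewrite coef_target_idem; have -> : bimax_target (endpoint (bsource i) (barrows i)).
    by apply/asboolP; exists z, q.
  have [j [jz jq]] := bpath_of bounded (proj1 rq).
  rewrite bimax_dualE (bigD1 j) /=; last by rewrite /bimax_path jz jq; apply/asboolP.
  rewrite jz jq {1}eg coef_rmul -?eg ?(proj1 rq) // ez big1 ?addr0 //.
  move=> k /andP [/asboolP bk kj].
  apply: coef_rmul0 => kz; case/eqP: kj; apply: bpath_inj; rewrite ?jz ?jq //.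
  by rewrite kz in bk; rewrite (bimax_source_inj bk (conj rq lq)).
have [f fP] := choice each.
exists (\sum_(i : bpath) (val phi (pathB (bsource i) (barrows i)) : K) *: f i).
split=> [|x].
  by rewrite mulr_suml; apply: eq_bigr => i _; rewrite -scalerAl (proj1 (fP i)).
rewrite mulr_sumr coind_val_sum {1}(path_expand bounded (target_idem * x)).
rewrite coind_val_sum.
apply: eq_bigr => i _; rewrite -scalerAr !coind_valZ (proj2 (fP i)).
exact: mulrC.
Qed.

(** Any nonzero path is part of a bimaximal one, so that multiplying on the right
    by the part that comes before detects its coefficient. *)
Lemma no_fork_dom_dim_ge1 : dom_dim_ge (B^o : lmodType B) 1.
Proof.
apply: (@idempotent_dom_dim_ge1 K B source_idem target_idem bimax_dual B_fd
  source_idem_idem bimax_dual_inj bimax_dual_onto _ bpath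
  (fun i => pathB (bsource i) (barrows i))).
  move=> x; rewrite !bimax_dualE; apply: eq_bigr => i /asboolP bi.
  rewrite coef_target_idem ifT //; apply/asboolP.
  by exists (bsource i), (barrows i).
move=> b b0; apply: coefB_eq0 => x s.
have [ns|/coefB0 -> //] := boolP (nonzero_path R x s).
have [z [g [h [eg rg lg]]]] := bimax_ext bounded ns.
have nzg : nonzero_path R z (g ++ s).
  by have := proj1 rg; rewrite catA => /nonzero_catl.
have [i [iz ig]] := bpath_of bounded (nonzero_catl nzg).
have := congr1 (coefB z (g ++ s)) (b0 i).
rewrite iz ig linear0 coef_source_idem ifT.
  by rewrite coef_rmul // eg.
by apply/asboolP; exists (g ++ s ++ h).
Qed.

End ProjectiveInjective.

(** * The value of the dominant dimension *)

Section DominantDimensionValue.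
Variables (K : fieldType) (Q : quiver) (R : zero_relations Q) (N : nat).
Hypothesis bounded : forall (x : vertex Q) s, is_path x s -> (size s <= N)%N.
Hypothesis branching_vertex : exists a a' : arrow Q,
  a != a' /\ (source a = source a' \/ target a = target a').
Local Notation B := (bound_quiver_alg K R).
Local Notation unforked :=
  (~ fork (@source Q) (@target Q) predT (relation_seqs R) /\
   ~ cofork (@source Q) (@target Q) predT (relation_seqs R)).

Lemma dom_dim_unforked : unforked -> alg_dom_dim B = Some 1%N.
Proof.
move=> [nf ncf]; apply: dom_dimP; split=> [_|].
  exact: (@no_fork_dom_dim_ge1 K Q R N bounded nf ncf).
have [a [a' [aa [e|e]]]] := branching_vertex.
  exact: (@not_dom_dim_ge2 K Q R N bounded a a' aa e).
have [b [b' [bb eb]]] := joining_diverging bounded nf aa e.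
exact: (@not_dom_dim_ge2 K Q R N bounded b b' bb eb).
Qed.

Lemma dom_dim_forked : ~ unforked -> alg_dom_dim B = Some 0%N.
Proof.
move=> h; apply: dom_dimP; split=> // ge1; apply: h.
exact: (@dom_dim_ge1_no_fork K Q R N bounded ge1).
Qed.

End DominantDimensionValue.

(** * Forks and truncation of arms *)

Lemma infix_filter (T : eqType) (k : pred T) s t :
  infix s t -> infix (filter k s) (filter k t).
Proof.
by move=> /infixP [u [v ->]]; apply/infixP; exists (filter k u), (filter k v);
  rewrite !filter_cat.
Qed.

(** What truncation uses of right arms: [U] stands for the vertices of the arms,
    and [T] for those of them that are cut off. Left arms are the right arms
    of the opposite quiver. *)
Definition arm_region (V E : Type) (src tgt : E -> V) (U T : pred V) : Prop :=
  [/\ forall a b, U (src a) -> src a = src b -> a = b,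
      forall a b, U (tgt a) -> tgt a = tgt b -> a = b,
      forall v, T v -> U v,
      forall a, U (src a) -> T (tgt a)
    & forall a, T (tgt a) -> U (src a)].

Section Truncation.
Variables (V E : eqType) (src tgt : E -> V) (Z Z' : set (seq E)).
Variables (Ul Tl Ur Tr : pred V).
Hypothesis left_arms : arm_region tgt src Ul Tl.
Hypothesis right_arms : arm_region src tgt Ur Tr.

Definition kept_vertex v := ~~ (Tl v || Tr v).
Definition kept_arrow : pred E := fun a => kept_vertex (src a) && kept_vertex (tgt a).

Local Notation nz := (nonzero_seq src tgt predT Z).
Local Notation nz' := (nonzero_seq src tgt kept_arrow Z').

Lemma next_kept a : kept_vertex (src a) -> kept_vertex (tgt a) || Tr (tgt a).
Proof.
have [_ _ TlU UlT _] := left_arms.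
rewrite /kept_vertex !negb_or => /andP [nl nr].
case: (Tr _); rewrite ?orbT //= orbF andbT.
by apply: contra nl => /TlU /UlT.
Qed.

Lemma arm_closed x s : path (composable src tgt) x s ->
  Ur (tgt x) -> Ur (tgt (last x s)).
Proof.
have [_ _ TU UT _] := right_arms.
elim: s x => //= y s IH x /andP [/eqP e ys] Ux; apply: IH => //.
by apply/TU/UT; rewrite -e.
Qed.

Lemma truncated_closed x s : path (composable src tgt) x s ->
  Tr (tgt x) -> Tr (tgt (last x s)).
Proof.
have [_ _ TU UT _] := right_arms.
elim: s x => //= y s IH x /andP [/eqP e ys] Ux; apply: IH => //.
by apply: UT; rewrite -e; apply: TU.
Qed.

(** If the common end of a fork is the first vertex of an arm, then a
    longest common continuation of its two branches along the arm makes one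
    of them terminal. *)
Lemma fork_of_truncation N : (forall s, nz s -> (size s <= N)%N) ->
  (forall s, nz' s -> nz s) -> (forall s, all kept_arrow s -> nz s -> nz' s) ->
  fork src tgt kept_arrow Z' -> fork src tgt predT Z.
Proof.
move=> bounded up down [a [a' [t [b [p [aa e na na' [[nb nbc] eb]]]]]]].
have [/existsNP [c hc]|term] := pselect (~ forall c, ~~ nz (rcons (b :: p) c)); last first.
  exists a, a', t, b, p; split=> //; [exact: up|exact: up|].
  by split=> //; split; [apply: up|apply: contrapT].
move/negP/negPn: hc => nc; have kb : kept_vertex (tgt (last b p)).
  by case/and3P: nb => /allP /(_ (last b p) (mem_last _ _)) /andP [].
have sc : src c = tgt (last b p).
  by case/and3P: nc => _; rewrite /= rcons_path => /andP [_ /eqP ->].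
have Uy : Ur (tgt (last a t)).
  rewrite -eb -sc; have [_ _ _ _ TU] := right_arms; apply: TU.
  have := @next_kept c; rewrite sc => /(_ kb) /orP [kc|//].
  have /negP [] := nbc c; apply: down => //; rewrite all_rcons.
  case/and3P: nb => -> _ _; rewrite andbT /kept_arrow kc andbT.
  by rewrite sc.
pose P n := `[< exists r, [/\ nz (a :: t ++ r), nz (a' :: t ++ r) & size r = n] >].
have [||n /asboolP [r [nr nr' <-]] rmax] := @ex_maxnP P N.
- by exists 0%N; apply/asboolP; exists [::]; rewrite cats0; split=> //; apply: up.
- move=> _ /asboolP [r [/bounded h _ <-]].
  by apply: leq_trans h; rewrite /= size_cat leqW // leq_addl.
have [[d hd]|tr] := pselect (exists d, nz (rcons (a :: t ++ r) d)); last first.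
  exists a, a', (t ++ r), a, (t ++ r); split=> //; split=> //; split=> // d.
  by apply/negP => hd; apply: tr; exists d.
have lastE x s : tgt a = tgt x -> tgt (last a s) = tgt (last x s) by case: s.
have [[d' hd']|tr] := pselect (exists d, nz (rcons (a' :: t ++ r) d)); last first.
  exists a, a', (t ++ r), a', (t ++ r); split=> //; split; last by rewrite (lastE a').
  by split=> // d'; apply/negP => hd'; apply: tr; exists d'.
have sd x y : nz (rcons (x :: t ++ r) y) -> tgt (last x (t ++ r)) = src y.
  by case/and3P => _; rewrite /= rcons_path => /andP [_ /eqP ->].
have Ud : Ur (src d).
  rewrite -(sd a) //; case/and3P: nr => _ + _.
  rewrite /= cat_path last_cat => /andP [_ pr].
  move: pr Uy; move: (last a t) => x; exact: arm_closed.
have dd : d = d'.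
  have [U1 _ _ _ _] := right_arms; apply: U1 => //.
  by rewrite -(sd a) // -(sd a') // (lastE a').
have := rmax (size r).+1; rewrite ltnn => /(_ _) /negP []; last by [].
apply/asboolP; exists (rcons r d); rewrite size_rcons -rcons_cat.
by split=> //; rewrite dd.
Qed.

Lemma kept_prefix a t : path (composable src tgt) a t -> kept_arrow a ->
  exists t1 t2, [/\ t = t1 ++ t2, all kept_arrow t1 &
    if t2 is c :: _ then Tr (tgt c) else true].
Proof.
elim: t a => [|b t IH] a /=; first by exists [::], [::].
move=> /andP [/eqP ab pt] ka.
have [kb|kb] := boolP (kept_arrow b).
  have [t1 [t2 [-> h1 h2]]] := IH b pt kb.
  by exists (b :: t1), t2; rewrite /= kb.
exists [::], (b :: t); split=> //.
have ks : kept_vertex (src b) by rewrite -ab; case/andP: ka.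
have := next_kept ks; case/orP => // kt.
by rewrite /kept_arrow ks kt in kb.
Qed.

Lemma kept_suffix s : sorted (composable src tgt) s ->
  (forall a, ohead (rev s) = Some a -> kept_vertex (tgt a)) ->
  exists u w, [/\ s = u ++ w, all kept_arrow w & all (predC kept_arrow) u].
Proof.
elim: s => [|a s IH] ss hl; first by exists [::], [::].
have [||u [w [es kw ku]]] := IH; first by case: (s) ss => //= b s' /andP [].
  by move=> b; case: (s) hl => // c s' hl hb; apply: hl; rewrite rev_cons;
     case: (rev _) hb.
have [ka|ka] := boolP (kept_arrow a); last by exists (a :: u), w; rewrite es /= ka.
exists [::], (a :: s); split=> //=; rewrite ka /=.
have nT : ~~ Tr (tgt (last a s)).
  have /hl : ohead (rev (a :: s)) = Some (last a s).
    by rewrite lastI rev_rcons.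
  by rewrite /kept_vertex negb_or => /andP [].
clear IH hl es; elim: (s) (a) ss ka nT => //= b s' IH c /andP [/eqP cb ps] kc nT.
have kb : kept_arrow b.
  have ks : kept_vertex (src b) by rewrite -cb; case/andP: kc.
  rewrite /kept_arrow ks /=; have := next_kept ks; case/orP => // /(truncated_closed ps).
  by rewrite (negPf nT).
by rewrite kb (IH b).
Qed.

(** The common end of two different arrows lies on no arm, and the arrows cut off
    start and end on arms. *)
Lemma joining_kept a a' : a != a' -> tgt a = tgt a' -> kept_arrow a.
Proof.
move=> aa e; have [_ UrI TrU UrT TrU'] := right_arms.
have [UlI _ TlU UlT TlU'] := left_arms.
have nUr : ~~ Ur (tgt a) by apply: contraNN aa => h; rewrite (UrI a a').
have nUl : ~~ Ul (tgt a) by apply: contraNN aa => h; rewrite (UlI a a').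
rewrite /kept_arrow /kept_vertex !negb_or; apply/andP; split; apply/andP; split.
- by apply: contra nUl => /TlU'.
- by apply: contra nUr => /TrU /UrT /TrU.
- by apply: contra nUl => /TlU.
- by apply: contra nUr => /TrU.
Qed.

(** Vertices are cut off at the start of a path or at its end. If the common end of
    the fork is cut off, then its branches are cut at the first vertex of an
    arm, a sink of the truncation. Otherwise they are kept whole, and the
    terminal path loses an initial part through which no relation passes. *)
Lemma fork_to_truncation : (forall r, Z r -> all kept_arrow r) ->
  fork src tgt predT Z -> fork src tgt kept_arrow Z.
Proof.
move=> kZ [a [a' [t [b [p [aa e na na' [[nb nbc] eb]]]]]]].
have ka := joining_kept aa e.
have ka' : kept_arrow a' by apply: joining_kept (esym e); rewrite eq_sym.
have [Ur1 _ _ _ TU] := right_arms.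
have nzk s : all kept_arrow s -> nz s -> nonzero_seq src tgt kept_arrow Z s.
  by move=> ks /and3P [_ ? ?]; apply/and3P.
have pt : path (composable src tgt) a t by case/and3P: na.
have [t1 [[|c t2] [et k1 hc]]] := kept_prefix pt ka; last first.
  have pre x : kept_arrow x -> nz (x :: t) -> nonzero_seq src tgt kept_arrow Z (x :: t1).
    move=> kx nx; apply: nzk; first by rewrite /= kx.
    apply: nonzero_seq_infix nx; rewrite et -cat_cons; apply: prefixW.
    exact: prefix_prefix.
  exists a, a', t1, a, t1; split=> //; try exact: pre; split=> //.
  split; first exact: pre.
  move=> d; apply/negP => /and3P [kd cd _].
  have sd : tgt (last a t1) = src d by move: cd; rewrite /= rcons_path => /andP [_ /eqP].
  have sc : tgt (last a t1) = src c.
    by move: pt; rewrite et cat_path /= => /and3P [_ /eqP].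
  have dc : c = d by apply: Ur1; [exact: TU|rewrite -sd].
  move: kd; rewrite -dc all_rcons => /andP [/andP [_]].
  by rewrite /kept_vertex hc orbT.
rewrite cats0 in et; rewrite -et in k1.
have kl : kept_arrow (last a t).
  have kat : all kept_arrow (a :: t) by rewrite /= ka.
  exact: (allP kat) (mem_last a t).
have [|x|u [w [es kw ku]]] := @kept_suffix (b :: p).
- by case/and3P: nb.
- by rewrite lastI rev_rcons => -[<-]; rewrite eb; case/andP: kl.
case: w => [|c w] in es kw *.
  rewrite cats0 in es; have [Ul1 Ul2 TlU UlT TlU'] := left_arms.
  have [_ _ TrU UrT _] := right_arms.
  have nl : ~~ kept_arrow (last b p).
    by move: ku; rewrite -es => /allP /(_ _ (mem_last b p)).
  have kt : kept_vertex (tgt (last b p)) by rewrite eb; case/andP: kl.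
  have Us : Ul (tgt (last b p)).
    apply: TlU'; move: nl; rewrite /kept_arrow kt andbT /kept_vertex negbK => /orP [//|].
    by move=> /TrU /UrT h; rewrite /kept_vertex h orbT in kt.
  by rewrite (Ul1 _ _ Us eb) kl in nl.
have lw : last c w = last b p.
  by have := congr1 (last b) es; rewrite /= last_cat /= => ->.
exists a, a', t, c, w; split=> //; try (by apply: nzk => //=; rewrite ?ka ?ka').
split; last by rewrite lw.
split.
  apply: nzk => //; apply: nonzero_seq_infix nb; rewrite es.
  exact/suffixW/suffix_suffix.
move=> d; apply/negP => /and3P [kd cd nd]; case/negP: (nbc d).
apply/and3P; split; first by rewrite all_predT.
  move: cd; rewrite /= !rcons_path lw => /andP [_ ->].
  by rewrite andbT; case/and3P: nb.
apply/asboolPn => -[r Zr rs]; move/asboolPn: nd; apply; exists r => //.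
have := infix_filter kept_arrow rs; rewrite (all_filterP (kZ r Zr)).
rewrite es rcons_cat filter_cat (all_filterP kd).
rewrite (_ : filter _ u = [::]) //.
by apply/eqP; rewrite -(negbK (_ == _)) -has_filter -all_predC.
Qed.

End Truncation.

Lemma kept_arrow_op (V E : eqType) (src tgt : E -> V) Tl Tr :
  kept_arrow tgt src Tr Tl =1 kept_arrow src tgt Tl Tr.
Proof. by move=> a; rewrite /kept_arrow /kept_vertex andbC ![Tr _ || _]orbC. Qed.

(** * Arms and the truncated quiver *)

Section MapForks.
Variables (V V' E E' : eqType) (src tgt : E -> V) (src' tgt' : E' -> V').
Variables (f : E' -> E) (g : V' -> V) (k : pred E) (Z : set (seq E')).
Hypotheses (f_inj : injective f) (g_inj : injective g).
Hypothesis srcf : forall a, src (f a) = g (src' a).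
Hypothesis tgtf : forall a, tgt (f a) = g (tgt' a).
Hypothesis kf : forall a, k a <-> exists a', a = f a'.

Lemma nonzero_seq_map s :
  nonzero_seq src tgt k (map f @` Z)%classic (map f s) =
  nonzero_seq src' tgt' predT Z s.
Proof.
have ks : all k (map f s) by apply/allP => _ /mapP [a _ ->]; apply/kf; exists a.
have fK : infix (map f s) (map f s) by apply: infix_refl.
rewrite /nonzero_seq ks all_predT; congr [&& _, _ & ~~ _].
  case: s {ks fK} => //= a s; rewrite path_map; apply: eq_path => b c.
  by rewrite /composable /= tgtf srcf (inj_eq g_inj).
apply/asbool_equiv_eq; split=> [[_ [r Zr <-]]|[r Zr rs]].
  move=> /infixP [u [v e]]; exists r => //; apply/infixP.
  exists (take (size u) s), (drop (size r) (drop (size u) s)).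
  apply: (inj_map f_inj); rewrite !map_cat map_take !map_drop e.
  by rewrite take_size_cat // drop_size_cat // drop_size_cat ?size_map.
exists (map f r); first by exists r.
move/infixP: rs => [u [v ->]]; apply/infixP; exists (map f u), (map f v).
by rewrite !map_cat.
Qed.

Lemma all_kept_map s : all k s -> exists s', s = map f s'.
Proof.
elim: s => [|a s IH] /=; first by exists [::].
by move=> /andP [/kf [a' ->] /IH [s' ->]]; exists (a' :: s').
Qed.

Lemma fork_map : fork src' tgt' predT Z <-> fork src tgt k (map f @` Z)%classic.
Proof.
split=> [[a [a' [t [b [p [aa e na na' [[nb nbc] eb]]]]]]]|].
  exists (f a), (f a'), (map f t), (f b), (map f p).
  rewrite (inj_eq f_inj) !tgtf e /terminal_seq -![f _ :: _]map_cons !nonzero_seq_map.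
  split=> //; split; last by rewrite !last_map !tgtf eb.
  split=> // c; apply/negP => hc; have kc : k c.
    by case/and3P: hc; rewrite all_rcons => /andP [].
  have [c' ec] := (proj1 (kf c)) kc; move: hc; rewrite ec -map_rcons nonzero_seq_map.
  exact/negP.
move=> [a [a' [t [b [p [aa e na na' [[nb nbc] eb]]]]]]].
have kall s : nonzero_seq src tgt k (map f @` Z)%classic s -> exists s', s = map f s'.
  by move=> /and3P [/all_kept_map].
have [[|x t1] // [ea et]] := kall _ na; have [[|x' t1'] // [ea' _]] := kall _ na'.
have [[|y p1] // [eb' ep]] := kall _ nb.
move: aa e na na' nb nbc eb; rewrite ea et ea' eb' ep -!map_cons !nonzero_seq_map.
rewrite !last_map !tgtf (inj_eq f_inj) => aa /g_inj e na na' nb nbc /g_inj eb.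
exists x, x', t1, y, p1; split=> //; split=> //; split=> // c.
by have := nbc (f c); rewrite -map_rcons nonzero_seq_map.
Qed.

End MapForks.

Section Arms.
Variable Q : quiver.
Implicit Types (v : vertex Q) (a b c : arrow Q) (p : qpath Q).

Lemma nonbranching_source v a b :
  ~~ branching v -> source a = v -> source b = v -> a = b.
Proof.
move=> nv ea eb; apply/eqP; apply: contraNT nv => ab.
by apply/existsP; exists a; apply/existsP; exists b; rewrite ab ea eb !eqxx.
Qed.

Lemma nonbranching_target v a b :
  ~~ branching v -> target a = v -> target b = v -> a = b.
Proof.
move=> nv ea eb; apply/eqP; apply: contraNT nv => ab.
by apply/existsP; exists a; apply/existsP; exists b; rewrite ab ea eb !eqxx orbT.
Qed.

Lemma pverts_next p v : v \in pverts p -> v <> ptarget p ->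
  exists c, [/\ source c = v & target c \in pverts p].
Proof.
rewrite /pverts /ptarget; have := valP p; rewrite /is_qpath -/(psource p) -/(parrows p).
elim: (parrows p) (psource p) => [|c s IH] x /=; first by rewrite inE => _ /eqP.
move=> /andP [/eqP cx cs]; rewrite inE => /orP [/eqP ->|vs] ne.
  by exists c; rewrite cx !inE eqxx orbT.
have [d [dv dt]] := IH _ cs vs ne; exists d; split=> //.
by rewrite inE dt orbT.
Qed.

Lemma pverts_prev p v : v \in pverts p -> v <> psource p ->
  exists c, [/\ target c = v & source c \in pverts p].
Proof.
rewrite /pverts; have := valP p; rewrite /is_qpath -/(psource p) -/(parrows p).
elim: (parrows p) (psource p) => [|c s IH] x /=; first by rewrite inE => _ /eqP.
move=> /andP [/eqP cx cs]; rewrite inE => /orP [/eqP //|vs] _.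
have [vt|vt] := eqVneq v (target c); first by exists c; rewrite cx inE eqxx.
have [d [dv dt]] := IH _ cs vs (elimN eqP vt); exists d; split=> //.
by rewrite inE dt orbT.
Qed.

Definition on_arm (arm : pred (qpath Q)) : pred (vertex Q) :=
  fun v => `[< exists2 p, arm p & v \in pverts p >].
Definition right_truncated : pred (vertex Q) :=
  fun v => `[< exists2 p, right_arm p & v \in pverts p /\ v <> psource p >].
Definition left_truncated : pred (vertex Q) :=
  fun v => `[< exists2 p, left_arm p & v \in pverts p /\ v <> ptarget p >].

Lemma right_arm_region :
  arm_region (@source Q) (@target Q) (on_arm (@right_arm Q)) right_truncated.
Proof.
have nb p v : right_arm p -> v \in pverts p -> ~~ branching v.
  by move=> /and3P [/allP h _ _] /h.
split=> [a b /asboolP [p rp vp] e|a b /asboolP [p rp vp] e|v|a|a].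
- exact: nonbranching_source (nb _ _ rp vp) erefl (esym e).
- exact: nonbranching_target (nb _ _ rp vp) erefl (esym e).
- by move=> /asboolP [p rp [vp _]]; apply/asboolP; exists p.
- move=> /asboolP [p rp vp]; apply/asboolP; exists p => //.
  have /and3P [_ /forallP sink /existsP [d /andP [/eqP dt bd]]] := rp.
  have [|c [ca ct]] := pverts_next vp; first by apply/eqP/sink.
  have ec := nonbranching_source (nb _ _ rp vp) ca erefl.
  rewrite -{1}ec; split=> // eat.
  have sp : psource p \in pverts p by apply: mem_head.
  have ed := nonbranching_target (nb _ _ rp sp) dt eat.
  by have := nb _ _ rp vp; rewrite -ed bd.
- move=> /asboolP [p rp [vp ne]]; apply/asboolP; exists p => //.
  have [c [ca cs]] := pverts_prev vp ne.
  by rewrite -(nonbranching_target (nb _ _ rp vp) ca erefl).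
Qed.

Lemma left_arm_region :
  arm_region (@target Q) (@source Q) (on_arm (@left_arm Q)) left_truncated.
Proof.
have nb p v : left_arm p -> v \in pverts p -> ~~ branching v.
  by move=> /and3P [/allP h _ _] /h.
split=> [a b /asboolP [p rp vp] e|a b /asboolP [p rp vp] e|v|a|a].
- exact: nonbranching_target (nb _ _ rp vp) erefl (esym e).
- exact: nonbranching_source (nb _ _ rp vp) erefl (esym e).
- by move=> /asboolP [p rp [vp _]]; apply/asboolP; exists p.
- move=> /asboolP [p rp vp]; apply/asboolP; exists p => //.
  have /and3P [_ /forallP src /existsP [d /andP [/eqP dt bd]]] := rp.
  have [|c [ca ct]] := pverts_prev vp; first by apply/eqP/src.
  have ec := nonbranching_target (nb _ _ rp vp) ca erefl.
  rewrite -{1}ec; split=> // eat.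
  have sp : ptarget p \in pverts p by apply: mem_last.
  have ed := nonbranching_source (nb _ _ rp sp) dt eat.
  by have := nb _ _ rp vp; rewrite -ed bd.
- move=> /asboolP [p rp [vp ne]]; apply/asboolP; exists p => //.
  have [c [ca cs]] := pverts_next vp ne.
  by rewrite -(nonbranching_source (nb _ _ rp vp) ca erefl).
Qed.

Lemma in_kept v : (v \in kept Q) = kept_vertex left_truncated right_truncated v.
Proof.
rewrite inE /kept_vertex; congr (~~ _); apply/idP/idP => [/asboolP [p _ [vp h]]|].
  by case: h => -[hp ne]; apply/orP; [left|right]; apply/asboolP; exists p.
have nontriv p w :
    w \in pverts p -> w <> psource p \/ w <> ptarget p -> (0 < plength p)%N.
  rewrite /plength /pverts /ptarget; case: (parrows p) => //=.
  by rewrite inE => /eqP -> [].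
move=> /orP [] /asboolP [p hp [vp ne]]; apply/asboolP.
  by exists p; [apply: nontriv vp _; right|split=> //; left].
by exists p; [apply: nontriv vp _; left|split=> //; right].
Qed.

Lemma has_arms_branching : has_arms Q -> exists v : vertex Q, branching v.
Proof.
by move=> [p [[] /and3P [_ _ /existsP [a /andP [_ h]]] _]];
  [exists (target a)|exists (source a)].
Qed.

Lemma branching_arrows v : branching v -> exists a a' : arrow Q,
  a != a' /\ (source a = source a' \/ target a = target a').
Proof.
move=> /existsP [a /existsP [b /andP [ab h]]]; exists a, b; split=> //.
by case/orP: h => /andP [/eqP -> /eqP ->]; [left|right].
Qed.

(** A shortest oriented cycle does not repeat arrows, hence would be a second
    unoriented path besides the empty one. *)
Lemma tree_acyclic (x : vertex Q) s : is_tree Q -> is_path x s ->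
  last x (map (@target Q) s) = x -> s = [::].
Proof.
move=> tree; have [n] := ubnP (size s); elim: n s x => // n IH s x sn xs ex.
have [us|nus] := boolP (uniq s).
  have [w [_ wuniq]] := tree x x.
  have w0 : unoriented_path x x [::] by split=> //=; rewrite eqxx.
  have : unoriented_path x x (map (fun a => (a, true)) s).
    split; last by rewrite -map_comp map_id_in.
    have walk z y t : is_path y t -> last y (map (@target Q) t) = z ->
        is_walk y z (map (fun a => (a, true)) t).
      elim: t y => [|a t IHt] y /=; first by move=> _ ->.
      by move=> /andP [/eqP <- at_] h; rewrite /estart eqxx /=; apply: IHt.
    exact: walk.
  by move=> /wuniq ws; have := wuniq _ w0; rewrite ws; case: (s).
have [a [u [v [w es]]]] : exists a (u v w : seq (arrow Q)),
    s = u ++ a :: v ++ a :: w.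
  elim: s nus {IH sn xs ex} => //= a s IH; rewrite negb_and negbK.
  case/orP => [as_|/IH [b [u [v [w ->]]]]].
    by case/splitPr: as_ => v w; exists a, [::], v, w.
  by exists b, (a :: u), v, w.
suff : a :: v = [::] by [].
move: xs; rewrite es is_path_cat /= is_path_cat /= => /andP [_ /and4P [_ av /eqP ea _]].
have sz : (size (a :: v) < n)%N.
  by move: sn; rewrite es !size_cat /= size_cat /=; lia.
by apply: (IH _ (source a) sz) => /=; [rewrite eqxx|rewrite -ea].
Qed.

Lemma tree_bounded (x : vertex Q) s :
  is_tree Q -> is_path x s -> (size s <= #|arrow Q|)%N.
Proof.
move=> tree xs; suff us : uniq s by rewrite -(card_uniqP us) max_card.
elim: s x xs => //= a s IH x /andP [_ ss]; rewrite (IH _ ss) andbT.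
apply/negP => as_; case/splitPr: as_ ss => u v.
rewrite is_path_cat /= => /andP [us /andP [/eqP ea _]].
by have := @tree_acyclic (source a) (a :: u) tree; rewrite /= eqxx => /(_ us (esym ea)).
Qed.

End Arms.

Section TruncatedQuiver.
Variable Q : quiver.
Local Notation Q' := (truncation Q).
Local Notation k := (kept_arrow (@source Q) (@target Q)
  (@left_truncated Q) (@right_truncated Q)).

Definition arrow_incl (a : arrow Q') : arrow Q := val a.
Definition vertex_incl (v : vertex Q') : vertex Q := val v.

Lemma kept_arrowP a : k a <-> exists a', a = arrow_incl a'.
Proof.
split=> [ka|[[a' /= ha] ->]]; last by rewrite /kept_arrow -!in_kept.
have ha : (source a \in kept Q) && (target a \in kept Q) by rewrite !in_kept.
by exists (exist (fun a => (source a \in kept Q) && (target a \in kept Q)) a ha).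
Qed.

Lemma truncation_bounded N : (forall (x : vertex Q) s, is_path x s -> (size s <= N)%N) ->
  forall (x : vertex Q') s, is_path x s -> (size s <= N)%N.
Proof.
move=> bounded x s xs; rewrite -(size_map arrow_incl).
exact: bounded (sub_path_is_qpath (exist (@is_qpath Q') (x, s) xs)).
Qed.

Lemma truncation_branching : (exists v : vertex Q, branching v) ->
  exists a a' : arrow Q', a != a' /\ (source a = source a' \/ target a = target a').
Proof.
move=> [v /branching_arrows [a [a' [aa h]]]].
have kk : k a /\ k a'.
  case: h => e.
    have op b b' : b != b' -> source b = source b' -> k b.
      move=> bb eb; rewrite -kept_arrow_op.
      exact: (joining_kept (@right_arm_region Q) (@left_arm_region Q) bb eb).
    by split; [apply: op aa e|apply: op (esym e); rewrite eq_sym].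
  split; [exact: (joining_kept (@left_arm_region Q) (@right_arm_region Q) aa e)|].
  apply: (joining_kept (@left_arm_region Q) (@right_arm_region Q) _ (esym e)).
  by rewrite eq_sym.
have [/kept_arrowP [b eb] /kept_arrowP [b' eb']] := kk.
exists b, b'; split; first by apply: contraNneq aa => e; rewrite eb eb' e.
by case: h => e; [left|right]; apply: val_inj; rewrite /= -[val b]eb -[val b']eb'.
Qed.

Section Relations.
Variables (R : zero_relations Q) (R' : zero_relations Q').
Local Notation Z := (relation_seqs R).
Local Notation Z' := (map arrow_incl @` relation_seqs R')%classic.
Local Notation R'Q := (@truncation_path Q @` (R' : set _))%classic.
Local Notation nz := (nonzero_seq (@source Q) (@target Q) predT Z).
Local Notation nz' := (nonzero_seq (@source Q) (@target Q) k Z').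

Lemma truncation_relations r : Z' r <-> exists2 p, R'Q p & r = parrows p.
Proof.
split=> [[_ [p Rp <-] <-]|[_ [p Rp <-] ->]].
  by exists (truncation_path p) => //; exists p.
by exists (parrows p) => //; exists p.
Qed.

Lemma truncation_fork :
  fork (@source Q') (@target Q') predT (relation_seqs R') <->
  fork (@source Q) (@target Q) k Z'.
Proof.
apply: (@fork_map _ _ _ _ _ _ _ _ arrow_incl vertex_incl) => //.
- exact: val_inj.
- exact: val_inj.
- exact: kept_arrowP.
Qed.

Lemma truncation_cofork :
  cofork (@source Q') (@target Q') predT (relation_seqs R') <->
  cofork (@source Q) (@target Q) k Z'.
Proof.
have -> : cofork (@source Q) (@target Q) k Z' =
  fork (@target Q) (@source Q) k (map arrow_incl @` (rev @` relation_seqs R'))%classic.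
  congr (fork _ _ _ _); apply/predeqP => r; split.
    move=> [_ [_ [p Rp <-] <-] <-]; exists (rev (parrows p)); last by rewrite map_rev.
    by exists (parrows p) => //; exists p.
  move=> [_ [_ [p Rp <-] <-] <-].
  exists (map arrow_incl (parrows p)); last by rewrite map_rev.
  by exists (parrows p) => //; exists p.
apply: (@fork_map _ _ _ _ _ _ _ _ arrow_incl vertex_incl) => //.
- exact: val_inj.
- exact: val_inj.
- exact: kept_arrowP.
Qed.

End Relations.
End TruncatedQuiver.

(** * Comparison of a tree and its truncation *)

Section Comparison.
Variables (Q : quiver) (R : zero_relations Q) (R' : zero_relations (truncation Q)).
Hypothesis tree : is_tree Q.
Local Notation Q' := (truncation Q).
Local Notation k := (kept_arrow (@source Q) (@target Q)
  (@left_truncated Q) (@right_truncated Q)).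
Local Notation Z := (relation_seqs R).
Local Notation Z' := (map (@arrow_incl Q) @` relation_seqs R')%classic.
Local Notation R'Q := (@truncation_path Q @` (R' : set _))%classic.

Local Notation unforked P S :=
  (~ fork (@source P) (@target P) predT (relation_seqs S) /\
   ~ cofork (@source P) (@target P) predT (relation_seqs S)).

Lemma nonzero_seq_bounded s :
  nonzero_seq (@source Q) (@target Q) predT Z s -> (size s <= #|arrow Q|)%N.
Proof.
case: s => // a s na; have : nonzero_path R (source a) (a :: s).
  by rewrite nonzero_path_cons eqxx.
by case/andP => /(tree_bounded tree).
Qed.

(** Under this hypothesis a sequence of kept arrows is nonzero for [Q'] if and only
    if it is for [Q], which is what [fork_of_truncation] asks for. *)
Lemma unforked_truncation : (forall r, Z' r <-> Z r /\ all k r) ->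
  unforked Q R -> unforked Q' R'.
Proof.
move=> ZZ.
have up s : nonzero_seq (@source Q) (@target Q) k Z' s ->
    nonzero_seq (@source Q) (@target Q) predT Z s.
  move=> /and3P [ks cs /asboolPn nZ]; apply/and3P; split; rewrite ?all_predT //.
  apply/asboolPn => -[r Zr rs]; apply: nZ; exists r => //; apply/ZZ; split=> //.
  by apply/allP => a /(mem_infix rs) /(allP ks).
have down s : all k s -> nonzero_seq (@source Q) (@target Q) predT Z s ->
    nonzero_seq (@source Q) (@target Q) k Z' s.
  move=> ks /and3P [_ cs /asboolPn nZ]; apply/and3P; split=> //.
  by apply/asboolPn => -[r /ZZ [Zr _] rs]; apply: nZ; exists r.
move=> [nf ncf]; split=> [/truncation_fork|/truncation_cofork] h; [apply: nf|apply: ncf].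
  exact: (fork_of_truncation (@left_arm_region Q) (@right_arm_region Q)
    nonzero_seq_bounded up down h).
rewrite /cofork -(funext (kept_arrow_op _ _ _ _)) in h.
apply: (fork_of_truncation (@right_arm_region Q) (@left_arm_region Q)
  (N := #|arrow Q|) _ _ _ h).
- by move=> s; rewrite nonzero_seq_rev => /nonzero_seq_bounded; rewrite size_rev.
- by move=> s; rewrite (funext (kept_arrow_op _ _ _ _)) !nonzero_seq_rev; apply: up.
- move=> s; rewrite (funext (kept_arrow_op _ _ _ _)) -all_rev !nonzero_seq_rev.
  exact: down.
Qed.

Lemma truncation_unforked : Z = Z' -> unforked Q' R' -> unforked Q R.
Proof.
move=> ZZ [nf ncf].
have kZ r : Z r -> all k r.
  rewrite ZZ => -[s _ <-]; apply/allP => _ /mapP [a _ ->].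
  by apply/kept_arrowP; exists a.
split=> h; [apply/nf/truncation_fork|apply/ncf/truncation_cofork]; rewrite -ZZ.
  exact: (fork_to_truncation (@left_arm_region Q) (@right_arm_region Q) kZ h).
rewrite /cofork -(funext (kept_arrow_op _ _ _ _)).
apply: (fork_to_truncation (@right_arm_region Q) (@left_arm_region Q) _ h).
by move=> _ [r Zr <-]; rewrite (funext (kept_arrow_op _ _ _ _)) all_rev; apply: kZ.
Qed.

Lemma kept_path (p : qpath Q) : (0 < plength p)%N -> all k (parrows p) ->
  exists p' : qpath Q', truncation_path p' = p.
Proof.
move=> p0 kp; have [s es] := all_kept_map (@kept_arrowP Q) kp.
case: s es => [|a s] es; first by rewrite /plength es in p0.
have hp := valP p; rewrite /is_qpath -/(psource p) -/(parrows p) es in hp.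
have hs : @is_path Q' (source a) (a :: s).
  rewrite /= eqxx /=; move: hp => /= /andP [_].
  elim: s (a) {es} => //= b s IH c /andP [/eqP bc bs].
  rewrite IH // andbT; apply/eqP; apply: val_inj; exact: bc.
exists (exist (@is_qpath Q') (source a, a :: s) hs).
apply: qpath_inj; last by rewrite es.
by move: hp => /= /andP [/eqP].
Qed.

Lemma truncation_relationsP :
  ((R : set _) `&` (@truncation_path Q @` [set p | zero_relation p]) = R'Q)%classic ->
  forall r, Z' r <-> Z r /\ all k r.
Proof.
move=> RS r; rewrite truncation_relations; split.
  move=> [p]; rewrite -RS => -[Rp [p' _ ep]] ->; split; first by exists p.
  by rewrite -ep; apply/allP => _ /mapP [a _ ->]; apply/kept_arrowP; exists a.
move=> [[p Rp <-] kp]; exists p => //; rewrite -RS; split=> //.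
have p2 := relset_zero Rp; have [|p' ep] := kept_path _ kp; first exact: ltnW.
exists p' => //; move: p2; rewrite -ep /= /zero_relation /plength /parrows /=.
by rewrite size_map.
Qed.

Lemma truncation_relations_eq : (R : set _) = R'Q -> Z = Z'.
Proof.
move=> RR; apply/predeqP => r; rewrite truncation_relations -RR.
by split=> [[p Rp <-]|[p Rp ->]]; exists p.
Qed.

End Comparison.

Local Open Scope classical_set_scope.

Theorem proposition5p13 (K : fieldType) (Q : quiver)
    (hQ : is_tree Q) (harms : has_arms Q) (hlin : ~ linearly_oriented Q)
    (R : zero_relations Q) (R' : zero_relations (truncation Q)) :
  (* R' and S' as sets of paths of Q *)
  let R'Q : set (qpath Q) := @truncation_path Q @` (R' : set _) in
  let S'Q : set (qpath Q) :=
    @truncation_path Q @` [set p | zero_relation p] in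
  let B := bound_quiver_alg K R in
  let B' := bound_quiver_alg K R' in
  ((R : set _) = R'Q -> alg_dom_dim B = alg_dom_dim B') /\
  (R'Q `<` R -> R `&` S'Q = R'Q ->
     alg_dom_dim B' = Some 0%N -> alg_dom_dim B = Some 0%N).
Proof.
move=> R'Q S'Q B B'.
have bounded := fun x s => @tree_bounded Q x s hQ.
have bounded' := truncation_bounded bounded.
have [v bv] := has_arms_branching harms.
have br := branching_arrows bv.
have br' := truncation_branching (ex_intro _ v bv).
split=> [RR|_ RS dB'].
  have ZZ := truncation_relations_eq RR.
  have RS : R `&` S'Q = R'Q.
    rewrite RR; apply/predeqP => p; split=> [[]//|Rp]; split=> //.
    by case: Rp => p' /relset_zero p2 <-; exists p'.
  have up := unforked_truncation hQ (truncation_relationsP RS).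
  have down := truncation_unforked ZZ.
  case: (pselect (~ fork (@source Q) (@target Q) predT (relation_seqs R) /\
                  ~ cofork (@source Q) (@target Q) predT (relation_seqs R))) => h.
    rewrite (dom_dim_unforked K bounded br h).
    by rewrite (dom_dim_unforked K bounded' br' (up h)).
  rewrite (dom_dim_forked K bounded h) (dom_dim_forked K bounded') //.
  by move=> /down.
apply: (dom_dim_forked K bounded) => h.
have h' := unforked_truncation hQ (truncation_relationsP RS) h.
by have := dom_dim_unforked K bounded' br' h'; rewrite -/B' dB'.
Qed.
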